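(* Let $g\in\Bbbk[c]$ with $\deg g\geq1$ and $f=cg$. The algebra $\mathcal{G}_f$ is a noetherian domain with global dimension and Gelfand–Kirillov dimension $\operatorname{gldim}\mathcal{G}_f=\operatorname{GKdim}\mathcal{G}_f=4$. Moreover, the center of $\mathcal{G}_f$ is $\Bbbk[z]$, where $z=gb+(g-u)a-a^2$.
   Context: $\Bbbk$ is an algebraically closed field of characteristic zero. For $f=cg\in\Bbbk[c]$, put $h=cg'$ ($g'$ the derivative with respect to $c$) and $\gamma=h+u+2a$. The algebra $\mathcal{G}_f$ is the $\Bbbk$-algebra on generators $a,b,c,u$ with relations $ac=ca+f$, $au=ua+ug$, $cu=uc$, $bc=cb+c\gamma$, $bu=ub+u\gamma$, $ba=(a+h)b+(h-u)a$. It is the skew polynomial ring $P[b;\sigma,\delta]$ (with $br=\sigma(r)b+\delta(r)$) over $P=\Bbbk[c,u][a;f\partial_c+gu\partial_u]$ (with $ar=ra+D(r)$, $D=f\partial_c+gu\partial_u$), where $\sigma(c)=c$, $\sigma(u)=u$, $\sigma(a)=a+h$, $\delta(c)=c\gamma$, $\delta(u)=u\gamma$, $\delta(a)=(h-u)a$. *)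

(* Defs.v *)
From HB Require Import structures.
From mathcomp Require Import all_boot all_order all_algebra.
From mathcomp Require Import boolp classical_sets reals ereal topology.
From mathcomp Require Import normedtype sequences exp.
(* The notations of monalg are incompatible with those of mathcomp-analysis. *)
From mathcomp.multinomials Require Import -(notations) monalg.

Set Implicit Arguments.
Unset Strict Implicit.
Unset Printing Implicit Defensive.

Import Order.TTheory GRing.Theory Num.Theory.
Import Quotient.Exports.
Local Open Scope ring_scope.
Local Open Scope quotient_scope.
Local Open Scope classical_set_scope.

Section FreeAlgebra.
Variable k : comNzRingType.

Definition free4 : Type := malg (fmonom 'I_4) k.

HB.instance Definition _ := GRing.Lalgebra.on free4.

Fact free4_scalerAr (x : k) (p q : free4) : x *: (p * q) = p * (x *: q).
Proof.
have malgCC (y : malg (fmonom 'I_4) k) : malgC x * y = y * malgC x.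
  rewrite !malgM_def fgmulUg fgmulgU; apply: eq_bigr => m _.
  by rewrite mul1m mulm1 mulrC.
have mulC (y : malg (fmonom 'I_4) k) : x *: y = malgC x * y.
  by rewrite mul_malgC.
rewrite -[LHS]/(x *: (p * q : malg (fmonom 'I_4) k)).
rewrite -[RHS]/((p : malg (fmonom 'I_4) k) * (x *: (q : malg _ k))).
by rewrite !mulC !mulrA malgCC.
Qed.

HB.instance Definition _ := GRing.Lalgebra_isAlgebra.Build k free4
  free4_scalerAr.

Definition free4_gen (i : 'I_4) : free4 := mkmalgU (fmu i) 1.

End FreeAlgebra.

Section TwoSidedIdeal.
Variables (A : nzRingType) (S : seq A).

Definition ideal_gen : {pred A} := fun x => `[<
  exists (n : nat) (l s r : 'I_n -> A),
    (forall i, s i \in S) /\ x = \sum_i l i * s i * r i >].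

Fact ideal_gen_zmod_closed : zmod_closed ideal_gen.
Proof.
split=> [|x y /asboolP [n [l [s [r [Hs ->]]]]] /asboolP [m [l' [s' [r' [Hs' ->]]]]]].
  apply/asboolP; exists 0%N, (fun=> 0), (fun=> 0), (fun=> 0).
  by split=> [[]//|]; rewrite big_ord0.
apply/asboolP.
pose pick T (v : 'I_n -> T) (w : 'I_m -> T) (i : 'I_(n + m)) :=
  match split i with inl j => v j | inr j => w j end.
exists (n + m)%N, (pick A l (fun i => - l' i)), (pick A s s'), (pick A r r').
split=> [i|]; first by rewrite /pick; case: (split i).
rewrite big_split_ord /= -sumrN; congr (_ + _); apply: eq_bigr => i _.
  by rewrite /pick (unsplitK (inl i)).
by rewrite /pick (unsplitK (inr i)) !mulNr.
Qed.

HB.instance Definition _ :=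
  GRing.isZmodClosed.Build A ideal_gen ideal_gen_zmod_closed.

Fact ideal_genMl x y : y \in ideal_gen -> x * y \in ideal_gen.
Proof.
move=> /asboolP [n [l [s [r [Hs ->]]]]]; apply/asboolP.
exists n, (fun i => x * l i), s, r; split=> //.
by rewrite mulr_sumr; apply: eq_bigr => i _; rewrite !mulrA.
Qed.

Fact ideal_genMr x y : x \in ideal_gen -> x * y \in ideal_gen.
Proof.
move=> /asboolP [n [l [s [r [Hs ->]]]]]; apply/asboolP.
exists n, l, s, (fun i => r i * y); split=> //.
by rewrite mulr_suml; apply: eq_bigr => i _; rewrite !mulrA.
Qed.

Fact ideal_gen_mem x : x \in S -> x \in ideal_gen.
Proof.
move=> Sx; apply/asboolP; exists 1%N, (fun=> 1), (fun=> x), (fun=> 1).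
by split=> //; rewrite big_ord1 mul1r mulr1.
Qed.

End TwoSidedIdeal.

Section QuotientAlgebra.
Variables (k : comNzRingType) (A : algType k) (S : seq A).
Hypothesis S_proper : 1 \notin ideal_gen S.

Definition alg_quot & 1 \notin ideal_gen S : Type := Quotient.quot (ideal_gen S).
Local Notation Q := (alg_quot S_proper).

HB.instance Definition _ := GRing.Zmodule.on Q.
HB.instance Definition _ : EqQuotient A (Quotient.equiv (ideal_gen S)) Q :=
  EqQuotient.on Q.

Definition qproj (x : A) : Q := \pi_Q x.

Fact qproj_eq (x y : A) : qproj x = qproj y <-> x - y \in ideal_gen S.
Proof. by rewrite Quotient.idealrBE; split=> /eqP. Qed.

Fact qprojK (x : Q) : qproj (repr x) = x.
Proof. exact: reprK. Qed.

Fact qprojD (x y : A) : qproj (x + y) = qproj x + qproj y.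
Proof. exact: Quotient.pi_add. Qed.

Definition qone : Q := qproj 1.
Definition qmul (x y : Q) : Q := qproj (repr x * repr y).
Definition qscale (a : k) (x : Q) : Q := qproj (a *: repr x).

Fact qprojM (x y : A) : qproj (x * y) = qmul (qproj x) (qproj y).
Proof.
apply/qproj_eq; set x' := repr _; set y' := repr _.
have -> : x * y - x' * y' = x * (y - y') + (x - x') * y'.
  by rewrite mulrBr mulrBl addrA subrK.
apply: rpredD; [apply: ideal_genMl|apply: ideal_genMr];
  by apply/qproj_eq; rewrite qprojK.
Qed.

Fact qprojZ (a : k) (x : A) : qproj (a *: x) = qscale a (qproj x).
Proof.
apply/qproj_eq; rewrite -scalerBr -mulr_algl; apply: ideal_genMl.
by apply/qproj_eq; rewrite qprojK.
Qed.

Let qind (P : Q -> Prop) : (forall x, P (qproj x)) -> forall x, P x.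
Proof. by move=> H x; rewrite -[x]qprojK. Qed.

Fact qmulA : associative qmul.
Proof. by do 3![elim/qind => ?]; rewrite -!qprojM mulrA. Qed.
Fact qmul1 : left_id qone qmul.
Proof. by elim/qind => x; rewrite -qprojM mul1r. Qed.
Fact qmulr1 : right_id qone qmul.
Proof. by elim/qind => x; rewrite -qprojM mulr1. Qed.
Fact qmulDl : left_distributive qmul +%R.
Proof. by do 3![elim/qind => ?]; rewrite -!(qprojM, qprojD) mulrDl. Qed.
Fact qmulDr : right_distributive qmul +%R.
Proof. by do 3![elim/qind => ?]; rewrite -!(qprojM, qprojD) mulrDr. Qed.
Fact qone_neq0 : qone != 0.
Proof.
have <- : qproj 0 = 0 by apply: (addIr (qproj 0)); rewrite -qprojD !add0r.
by apply/eqP => /qproj_eq; rewrite subr0; apply/negP.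
Qed.

HB.instance Definition _ := GRing.Zmodule_isNzRing.Build Q
  qmulA qmul1 qmulr1 qmulDl qmulDr qone_neq0.

Fact qscaleA (a b : k) (x : Q) : qscale a (qscale b x) = qscale (a * b) x.
Proof. by elim/qind: x => x; rewrite -!qprojZ scalerA. Qed.
Fact qscale1 : left_id 1 qscale.
Proof. by elim/qind => x; rewrite -qprojZ scale1r. Qed.
Fact qscaleDr : right_distributive qscale +%R.
Proof. by move=> a; do 2![elim/qind => ?]; rewrite -!(qprojZ, qprojD) scalerDr. Qed.
Fact qscaleDl (x : Q) : {morph qscale^~ x : a b / a + b}.
Proof. by move=> a b; elim/qind: x => x; rewrite -!(qprojZ, qprojD) scalerDl. Qed.

HB.instance Definition _ := GRing.Zmodule_isLmodule.Build k Q
  qscaleA qscale1 qscaleDr qscaleDl.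

Fact qscaleAl (a : k) (x y : Q) : a *: (x * y) = (a *: x) * y.
Proof.
elim/qind: x => x; elim/qind: y => y.
rewrite -[_ * _]qprojM -![_ *: qproj _]qprojZ -[RHS]qprojM.
by rewrite scalerAl.
Qed.
HB.instance Definition _ := GRing.Lmodule_isLalgebra.Build k Q qscaleAl.

Fact qscaleAr (a : k) (x y : Q) : a *: (x * y) = x * (a *: y).
Proof.
elim/qind: x => x; elim/qind: y => y.
rewrite -[_ * _]qprojM -![_ *: qproj _]qprojZ -[RHS]qprojM.
by rewrite scalerAr.
Qed.
HB.instance Definition _ := GRing.Lalgebra_isAlgebra.Build k Q qscaleAr.

End QuotientAlgebra.

Section Presentation.
Variables (k : fieldType) (g : {poly k}).

(* The relators, left-hand side minus right-hand side, of $\mathcal{G}_f$ for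
   $f = cg$; a polynomial in $c$ is evaluated at $c$ by [horner_alg]. *)
Definition Gf_relators (B : algType k) (a b c u : B) : seq B :=
  let f := horner_alg c ('X * g) in
  let gc := horner_alg c g in
  let h := horner_alg c ('X * g^`()) in
  let gamma := h + u + a *+ 2 in
  [:: a * c - (c * a + f);
      a * u - (u * a + u * gc);
      c * u - u * c;
      b * c - (c * b + c * gamma);
      b * u - (u * b + u * gamma);
      b * a - ((a + h) * b + (h - u) * a)].

Definition Gf_free_relators : seq (free4 k) :=
  Gf_relators (free4_gen k (inord 0)) (free4_gen k (inord 1))
              (free4_gen k (inord 2)) (free4_gen k (inord 3)).

(* [alg_quot] needs a nonzero quotient; every relator has constant term 0. *)
Fact Gf_relators_augmentation (B : algType k) (e : {rmorphism B -> k})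
    (a b c u x : B) : e a = 0 -> e b = 0 -> e c = 0 -> e u = 0 ->
  x \in Gf_relators a b c u -> e x = 0.
Proof.
move=> ea eb ec eu; rewrite !inE; do ![case/orP]; move=> /eqP ->;
  rewrite ?mulr2n !(rmorphB, rmorphD, rmorphM) /= ?horner_algX;
  by rewrite ?(ea, eb, ec, eu) ?(mul0r, mulr0, subr0, addr0).
Qed.

Fact Gf_proper : 1 \notin ideal_gen Gf_free_relators.
Proof.
pose e : {rmorphism free4 k -> k} := mcoeff (mone : fmonom 'I_4).
have eX i : e (free4_gen k i) = 0.
  by rewrite /e /= /free4_gen mcoeffU fmuE -[mone]/(fmone _) fmoneE.
move: e eX => e eX; apply/negP => /asboolP [n [l [s [r [Hs]]]]] /(congr1 e).
rewrite rmorph1 rmorph_sum big1 => [/eqP|i _]; first by rewrite oner_eq0.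
have /Gf_relators_augmentation es := Hs i.
by rewrite 2!rmorphM /= es // mulr0 mul0r.
Qed.

Definition Gf : algType k := alg_quot Gf_proper.

Definition Gf_a : Gf := qproj Gf_proper (free4_gen k (inord 0)).
Definition Gf_b : Gf := qproj Gf_proper (free4_gen k (inord 1)).
Definition Gf_c : Gf := qproj Gf_proper (free4_gen k (inord 2)).
Definition Gf_u : Gf := qproj Gf_proper (free4_gen k (inord 3)).

Definition Gf_z : Gf :=
  let gc := horner_alg Gf_c g in
  gc * Gf_b + (gc - Gf_u) * Gf_a - Gf_a ^+ 2.

End Presentation.

Section RingProperties.
Variable A : nzRingType.

Definition is_domain : Prop := forall x y : A, x * y = 0 -> x = 0 \/ y = 0.

Definition is_central (x : A) : Prop := forall y : A, x * y = y * x.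

Definition is_left_ideal (I : set A) : Prop :=
  [/\ I 0, forall x y, I x -> I y -> I (x + y) & forall a x, I x -> I (a * x)].

Definition left_noetherian : Prop :=
  forall I : nat -> set A,
    (forall n, is_left_ideal (I n)) -> (forall n, I n `<=` I n.+1) ->
    exists N, forall n, (N <= n)%N -> I n = I N.

Definition projective (P : lmodType A) : Prop :=
  forall (M N : lmodType A) (p : {linear M -> N}) (f : {linear P -> N}),
    (forall y, exists x, p x = y) ->
    exists f' : {linear P -> M}, forall x, p (f' x) = f x.

(* M has a projective resolution 0 -> P_n -> ... -> P_1 -> P_0 -> M -> 0. *)
Definition has_projective_resolution (M : lmodType A) (n : nat) : Prop :=
  exists (P : nat -> lmodType A) (d : forall i, {linear P i.+1 -> P i})
         (e : {linear P 0 -> M}),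
    [/\ forall i, projective (P i),
        forall i, (n < i)%N -> forall x : P i, x = 0,
        forall y, exists x, e x = y,
        forall x, e x = 0 <-> exists y, d 0 y = x &
        forall i x, d i x = 0 <-> exists y, d i.+1 y = x].

Section Dimensions.
Variable R : realType.

Definition projective_dim (M : lmodType A) : \bar R :=
  ereal_inf [set (n%:R)%:E | n in has_projective_resolution M].

Definition left_gldim : \bar R :=
  ereal_sup [set x | exists M : lmodType A, x = projective_dim M].

End Dimensions.
End RingProperties.

(* Right ideals and right modules are those of the converse ring. *)
Definition noetherian (A : nzRingType) : Prop :=
  left_noetherian A /\ left_noetherian A^c.

Definition right_gldim (A : nzRingType) (R : realType) : \bar R :=
  left_gldim A^c R.

Section GelfandKirillov.
Variables (k : fieldType) (R : realType).

Definition lspan (V : lmodType k) (S : set V) : set V :=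
  [set x | exists (n : nat) (t : 'I_n -> k) (v : 'I_n -> V),
     (forall i, S (v i)) /\ x = \sum_i t i *: v i].

Definition lin_indep (V : lmodType k) (n : nat) (v : 'I_n -> V) : Prop :=
  forall t : 'I_n -> k, \sum_i t i *: v i = 0 -> forall i, t i = 0.

Definition ldim (V : lmodType k) (W : set V) : \bar R :=
  ereal_sup [set (n%:R)%:E | n in
    [set n | exists v : 'I_n -> V, (forall i, W (v i)) /\ lin_indep v]].

Variable A : algType k.

(* For V the span of s, the subspace k + V + V^2 + ... + V^n. *)
Definition growth_space (s : seq A) (n : nat) : set A :=
  lspan [set x | exists w : seq A,
    [/\ (size w <= n)%N, {subset w <= s} & x = \prod_(y <- w) y]].

(* The supremum, over the finite-dimensional subspaces V of A, of
   limsup_n log_n dim(k + V + ... + V^n); these dimensions are finite, so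
   [fine] loses nothing. *)
Definition GKdim : \bar R :=
  ereal_sup [set limn_esup (fun n : nat =>
      (ln (fine (ldim (growth_space s n))) / ln n%:R)%:E) | s in [set: seq A]].

End GelfandKirillov.

(* Main.v *)
From HB Require Import structures.
Require Import Defs.
From mathcomp Require Import all_boot all_order all_algebra.
From mathcomp Require Import ring zify.
From mathcomp Require Import boolp classical_sets functions reals ereal.
From mathcomp Require Import topology normedtype sequences exp.
From mathcomp.multinomials Require Import -(notations) monalg.

Set Implicit Arguments.
Unset Strict Implicit.
Unset Printing Implicit Defensive.

Import Order.TTheory GRing.Theory Num.Theory.
Local Open Scope ring_scope.
Local Open Scope classical_set_scope.

(** With $E=c\partial_c+u\partial_u$ the Euler derivation of $\Bbbk[c,u]$ one has $D=gE$, and the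
    algebra $\mathcal{G}_f$ is a tower of four Ore extensions
    $\Bbbk\subset\Bbbk[c]\subset\Bbbk[c,u]\subset P\subset\mathcal{G}_f$ with bijective twists. To
    see that the presentation gives nothing smaller, the skew polynomial ring $P[b;\sigma,\delta]$
    is constructed as an algebra on polynomials; the relators vanish in it, so $\mathcal{G}_f$
    maps to it, and the universal property of skew polynomials provides a surjective right inverse
    ([Gf_ore]). That $\delta$ exists at all is the identity that $\delta$ respects the relation
    $ar=ra+D(r)$ ([delta_rel]).

    The noetherian and domain properties pass from $R$ to an Ore extension of $R$: leading
    coefficients give a skew Hilbert basis theorem ([ore_left_noetherian]) and the absence of zero
    divisors ([ore_domain]). The converse of an Ore extension with bijective twist is again one
    ([ore_conv]), so the right-hand versions cost nothing.

    The global dimension grows by at most one at each step: a module $M$ over the extension $A$ of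
    $R$ is the cokernel of an injective map $A\otimes_R M^{\tau}\to A\otimes_R M$
    ([ore_projective_resolution]), and over a field every module is projective. For the lower
    bound, $c,u$ is a regular sequence of normal elements with quotient $\Bbbk[a,b]$, so $0\to
    A\to A^2\to A$ resolves $\Bbbk[a,b]$; mapping cones of multiplication by $a$ and by $b$ then
    resolve $\Bbbk$ with last term $A$ in degree 4. Commuting $a$ and $b$ past $c$ and $u$ changes
    them into $a_2$ and $b_2$, and a character $\chi$ that kills $c,u,a_2,b_2$ represents a
    nonzero class in $\mathrm{Ext}^4(\Bbbk,\Bbbk_\chi)$ ([normal_sequence_length]).

    For the center, give $a$ weight 1, $b$ weight 2 and $\Bbbk[c,u]$ weight 0. The leading term
    $\sum_{n+2l=m}r_{n,l}a^nb^l$ of a central element satisfies, from the commutator with $c$,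
    $(n+1)g\,r_{n+1,l}+2(l+1)r_{n-1,l+1}=0$, so it is determined by $r_{m,0}$, which is zero for
    $m$ odd, and from the commutator with $a$, $E(r_{m,0})=0$, so that $r_{m,0}$ is a scalar. As
    $z^n$ has $r_{2n,0}=(-1)^n$, subtracting a scalar multiple of a power of $z$ lowers the weight
    ([central_horner_zz]).

    For the Gelfand-Kirillov dimension, give $c$ weight 1 and $a,b,u$ a weight exceeding $\deg g$:
    the spans of the monomials $c^iu^ja^pb^q$ of bounded weight form a filtration by left
    multiplications, so words of length $n$ in any finite set stay in a space of dimension
    $O(n^4)$, while the monomials with exponents at most $n/4$ are independent words
    ([presented_GKdim]). *)

(** * Comparison of projective resolutions *)

(** Dependent choice for sequences whose terms live in varying types; the lifts in degree [i.+1]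
    of a chain map or of a homotopy depend on those chosen in degree [i]. *)
Lemma dependent_sequence (X : nat -> Type) (Y : forall i, X i -> X i.+1 -> Prop)
    (x0 : X 0%N) (x1 : X 1%N) :
  Y 0%N x0 x1 ->
  (forall i x x', Y i x x' -> exists x'', Y i.+1 x' x'') ->
  exists f : forall i, X i, f 0%N = x0 /\ forall i, Y i (f i) (f i.+1).
Proof.
move=> Y01 step.
pose T i := {p : X i * X i.+1 | Y i p.1 p.2}.
have next i (t : T i) : {t' : T i.+1 | (sval t').1 = (sval t).2}.
  case: t => [[x x'] /= Yxx']; have /cid[x'' Yx''] := step _ _ _ Yxx'.
  by exists (exist (fun p : X i.+1 * X i.+2 => Y i.+1 p.1 p.2) (x', x'') Yx'').
pose t0 : T 0%N :=
  exist (fun p : X 0%N * X 1%N => Y 0%N p.1 p.2) (x0, x1) Y01.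
pose t := fix t i : T i := if i is j.+1 then sval (next j (t j)) else t0.
exists (fun i => (sval (t i)).1); split=> // i.
have -> : (sval (t i.+1)).1 = (sval (t i)).2 := svalP (next i (t i)).
exact: (svalP (t i)).
Qed.

Section LinearKernel.
Variables (A : nzRingType) (Y Z : lmodType A) (f : {linear Y -> Z}).

Definition lker_pred : {pred Y} := fun y => f y == 0.

Fact lker_submod_closed : submod_closed lker_pred.
Proof.
split=> [|a x y]; rewrite !unfold_in /lker_pred; first by rewrite raddf0 eqxx.
by move=> /eqP fx /eqP fy; rewrite linearP fx fy scaler0 addr0.
Qed.

HB.instance Definition _ :=
  GRing.isSubmodClosed.Build A Y lker_pred lker_submod_closed.

Record lkernel := LKernel { lkval : Y; _ : lkval \in lker_pred }.

HB.instance Definition _ := [isSub for lkval].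
HB.instance Definition _ := [Choice of lkernel by <:].
HB.instance Definition _ := [SubChoice_isSubLmodule of lkernel by <:].

Lemma lkvalE (x : lkernel) : f (lkval x) = 0.
Proof. by case: x => y /= /eqP. Qed.

End LinearKernel.

(** Packs a function with a proof of linearity, for maps built inside proofs. *)
Definition mk_linear (A : nzRingType) (U V : lmodType A) (f : U -> V)
    (fL : linear f) : {linear U -> V} :=
  HB.pack f (GRing.isLinear.Build A U V *:%R f fL).

Section Resolutions.
Variable A : nzRingType.
Implicit Types M N : lmodType A.

(** Projectivity is used against surjections; corestricting [d] and [f] to the kernel of [d']
    turns exactness at [Y] into surjectivity. *)
Lemma projective_lift (P X Y Z : lmodType A) (d : {linear X -> Y})
    (d' : {linear Y -> Z}) (f : {linear P -> Y}) :
  projective P -> (forall y, d' y = 0 -> exists x, d x = y) ->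
  (forall x, d' (d x) = 0) -> (forall p, d' (f p) = 0) ->
  exists f' : {linear P -> X}, forall p, d (f' p) = f p.
Proof.
move=> Pproj ex dd fd.
have dK x : d x \in lker_pred d' by apply/eqP.
have fK p : f p \in lker_pred d' by apply/eqP.
pose dc (x : X) : lkernel d' := LKernel (dK x).
pose fc (p : P) : lkernel d' := LKernel (fK p).
have dcL : linear dc by move=> a x y; apply: val_inj; rewrite /= linearP.
have fcL : linear fc by move=> a x y; apply: val_inj; rewrite /= linearP.
have [|f' Hf'] := Pproj _ _ (mk_linear dcL) (mk_linear fcL).
  move=> y; have [x xy] := ex _ (lkvalE y).
  by exists x; apply: val_inj.
by exists f' => p; have /(congr1 (@lkval _ _ _ _)) := Hf' p.
Qed.

Definition is_resolution M (P : nat -> lmodType A)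
    (d : forall i, {linear P i.+1 -> P i}) (e : {linear P 0%N -> M}) : Prop :=
  [/\ forall y, exists x, e x = y,
      forall x, e x = 0 <-> exists y, d 0%N y = x &
      forall i x, d i x = 0 <-> exists y, d i.+1 y = x].

Lemma resolution_dd M (P : nat -> lmodType A)
    (d : forall i, {linear P i.+1 -> P i}) (e : {linear P 0%N -> M}) :
  is_resolution d e -> forall i x, d i (d i.+1 x) = 0.
Proof. by move=> [_ _ H] i x; apply/H; exists x. Qed.

Lemma resolution_ed M (P : nat -> lmodType A)
    (d : forall i, {linear P i.+1 -> P i}) (e : {linear P 0%N -> M}) :
  is_resolution d e -> forall x, e (d 0%N x) = 0.
Proof. by move=> [_ H _] x; apply/H; exists x. Qed.

Section Comparison.
Variables (M M' : lmodType A) (P Q : nat -> lmodType A).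
Variables (dP : forall i, {linear P i.+1 -> P i}) (eP : {linear P 0%N -> M}).
Variables (dQ : forall i, {linear Q i.+1 -> Q i}) (eQ : {linear Q 0%N -> M'}).
Hypotheses (Pproj : forall i, projective (P i)).
Hypotheses (Pdd : forall i x, dP i (dP i.+1 x) = 0).
Hypotheses (Ped : forall x, eP (dP 0%N x) = 0).
Hypotheses (Qres : is_resolution dQ eQ).

Lemma chain_lift (f : {linear M -> M'}) :
  exists F : forall i, {linear P i -> Q i},
    (forall x, eQ (F 0%N x) = f (eP x)) /\
    (forall i x, dQ i (F i.+1 x) = F i (dP i x)).
Proof.
have [Qs Q0 Qi] := Qres.
have [F0 F0E] := @Pproj 0%N _ _ eQ (f \o eP : {linear P 0%N -> M'}) Qs.
have [F1 F1E] : exists F1 : {linear P 1%N -> Q 1%N},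
    forall p, dQ 0%N (F1 p) = (F0 \o dP 0%N) p.
  apply: (projective_lift (d' := eQ)) => //.
  - by move=> y /Q0.
  - exact: resolution_ed.
  - by move=> p /=; rewrite F0E /= Ped raddf0.
have [|F [FE0 FE]] := dependent_sequence (X := fun i => {linear P i -> Q i})
    (Y := fun i F F' => forall x, dQ i (F' x) = F (dP i x)) F1E.
  move=> i G G' GE.
  apply: (projective_lift (d' := dQ i) (f := (G' \o dP i.+1))) => //.
  - by move=> y /Qi.
  - exact: resolution_dd.
  - by move=> p /=; rewrite GE Pdd raddf0.
by exists F; split=> // x; rewrite FE0 F0E.
Qed.

(** In degree [i.+1] the difference of [F] and of the part of the homotopy already constructed is
    a cycle, because [F] is a chain map, hence lifts through the next differential. *)
Lemma chain_homotopy (F : forall i, {linear P i -> Q i}) :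
  (forall x, eQ (F 0%N x) = 0) ->
  (forall i x, dQ i (F i.+1 x) = F i (dP i x)) ->
  exists s : forall i, {linear P i -> Q i.+1},
    (forall x, F 0%N x = dQ 0%N (s 0%N x)) /\
    (forall i x, F i.+1 x = dQ i.+1 (s i.+1 x) + s i (dP i x)).
Proof.
move=> F0 FE; have [Qs Q0 Qi] := Qres.
have [s0 s0E] : exists s0 : {linear P 0%N -> Q 1%N},
    forall p, dQ 0%N (s0 p) = F 0%N p.
  apply: (projective_lift (d' := eQ)) => //; first by move=> y /Q0.
  exact: resolution_ed.
have mk i (s : {linear P i -> Q i.+1}) :
    (forall x, dQ i (F i.+1 x - s (dP i x)) = 0) ->
    exists s' : {linear P i.+1 -> Q i.+2},
      forall x, F i.+1 x = dQ i.+1 (s' x) + s (dP i x).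
  move=> H.
  have [s' s'E] : exists s' : {linear P i.+1 -> Q i.+2},
      forall p, dQ i.+1 (s' p) = (F i.+1 \- (s \o dP i)) p.
    apply: (projective_lift (d' := dQ i)) => //; first by move=> y /Qi.
    exact: resolution_dd.
  by exists s' => x; rewrite s'E /= subrK.
have [|s1 s1E] := mk 0%N s0; first by move=> x; rewrite raddfB /= s0E FE subrr.
have [|s [sE0 sE]] := dependent_sequence
    (X := fun i => {linear P i -> Q i.+1})
    (Y := fun i s s' => forall x, F i.+1 x = dQ i.+1 (s' x) + s (dP i x)) s1E.
  move=> i G G' GE; apply: mk => x.
  by rewrite raddfB /= FE GE /= Pdd raddf0 addr0 subrr.
by exists s; split=> // x; rewrite sE0 s0E.
Qed.

End Comparison.
End Resolutions.

(** * Mapping cones *)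

Section Cone.
Variable A : nzRingType.
Variables (K L : nat -> lmodType A).
Variables (dK : forall i, {linear K i.+1 -> K i}).
Variables (dL : forall i, {linear L i.+1 -> L i}).
Variables (F : forall i, {linear L i -> K i}).
Hypothesis FE : forall i x, dK i (F i.+1 x) = F i (dL i x).

(** The differential sends [(k, l)] to [(dK k + F l, - dL l)]. *)
Definition cone i : lmodType A :=
  if i is j.+1 then (K j.+1 * L j)%type else K 0%N.

Fact cone_d0_linear : linear (fun x : cone 1 => dK 0%N x.1 + F 0%N x.2).
Proof.
by move=> a x y /=; rewrite (linearP (dK 0%N)) (linearP (F 0%N)) scalerDr addrACA.
Qed.

Fact cone_dS_linear i : linear (fun x : cone i.+2 =>
  (dK i.+1 x.1 + F i.+1 x.2, - dL i x.2) : cone i.+1).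
Proof.
move=> a x y /=.
rewrite (linearP (dK i.+1)) (linearP (F i.+1)) (linearP (dL i)).
by rewrite opprD -scalerN addrACA -scalerDr.
Qed.

Definition cone_d i : {linear cone i.+1 -> cone i} :=
  match i with
  | 0 => mk_linear cone_d0_linear
  | j.+1 => mk_linear (@cone_dS_linear j)
  end.

Variables (M M' M'' : lmodType A).
Variables (eK : {linear K 0%N -> M}) (eL : {linear L 0%N -> M'}).
Variables (phi : {linear M' -> M}) (q : {linear M -> M''}).
Hypotheses (resK : is_resolution dK eK) (resL : is_resolution dL eL).
Hypotheses (phi_inj : forall x, phi x = 0 -> x = 0).
Hypotheses (q_surj : forall y, exists x, q x = y).
Hypotheses (q_ker : forall x, q x = 0 <-> exists y, phi y = x).
Hypothesis F0E : forall x, eK (F 0%N x) = phi (eL x).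

Definition cone_e : {linear cone 0 -> M''} := q \o eK.

(** The cone of a chain map over an injection [phi] resolves the cokernel of [phi]: a cycle [(k,
    l)] has [l] a cycle of the second complex, which is then a boundary (in degree 0 thanks to the
    injectivity of [phi]), and correcting [k] by its image leaves a cycle of the first complex. *)
Lemma cone_resolution : is_resolution cone_d cone_e.
Proof.
have [Ks K0 Ki] := resK; have [Ls L0 Li] := resL.
split.
- by move=> y; have [x <-] := q_surj y; have [z <-] := Ks x; exists z.
- move=> x; split=> [/= /q_ker [y yE]|[[k l] <-] /=].
    have [l lE] := Ls y; have : eK (x - F 0%N l) = 0.
      by rewrite raddfB /= F0E lE yE subrr.
    move=> /K0 [k kE]; exists (k, l); rewrite /= kE subrK //.
  rewrite !raddfD /= (resolution_ed resK) F0E raddf0 add0r.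
  by apply/q_ker; exists (eL l).
- case=> [|i] [k l]; split=> /=.
  + move=> E; have : phi (eL l) = 0.
      by move/(congr1 eK): E; rewrite raddfD /= (resolution_ed resK) F0E add0r raddf0.
    move=> /phi_inj/L0 [l' l'E].
    have : dK 0%N (k + F 1%N l') = 0 by rewrite raddfD /= FE l'E.
    move=> /Ki [k' k'E]; exists (k', - l').
    by rewrite /= k'E !raddfN /= opprK l'E addrK.
  + move=> [[k' l'] [<- <-]].
    by rewrite raddfD /= (resolution_dd resK) add0r raddfN /= FE subrr.
  + move=> [E1 /eqP]; rewrite oppr_eq0 => /eqP/Li [l' l'E].
    have : dK i.+1 (k + F i.+2 l') = 0 by rewrite raddfD /= FE l'E.
    move=> /Ki [k' k'E]; exists (k', - l').
    by rewrite /= k'E !raddfN /= opprK l'E addrK.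
  + move=> [[k' l'] [<- <-]].
    rewrite raddfD /= (resolution_dd resK) add0r !raddfN /= FE subrr.
    by rewrite (resolution_dd resL) opprK.
Qed.

End Cone.

Lemma inl_linear (A : nzRingType) (P Q : lmodType A) :
  linear (fun x : P => (x, 0) : (P * Q)%type).
Proof. by move=> a x y; rewrite -[RHS]/(_, _) /= scaler0 addr0. Qed.
Lemma inr_linear (A : nzRingType) (P Q : lmodType A) :
  linear (fun x : Q => (0, x) : (P * Q)%type).
Proof. by move=> a x y; rewrite -[RHS]/(_, _) /= scaler0 addr0. Qed.

Lemma projective_pair (A : nzRingType) (P Q : lmodType A) :
  projective P -> projective Q -> projective (P * Q)%type.
Proof.
move=> Pp Qp M N p f ps.
have [f1 f1E] := Pp _ _ p (f \o mk_linear (@inl_linear A P Q) : {linear P -> N}) ps.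
have [f2 f2E] := Qp _ _ p (f \o mk_linear (@inr_linear A P Q) : {linear Q -> N}) ps.
have gL : linear (fun x : (P * Q)%type => f1 x.1 + f2 x.2).
  by move=> a x y /=; rewrite (linearP f1) (linearP f2) scalerDr addrACA.
exists (mk_linear gL) => -[x y] /=; rewrite raddfD /= f1E f2E /=.
by rewrite -raddfD /= -[(x, 0) + _]/(_, _) /= addr0 add0r.
Qed.

Lemma cone_projective (A : nzRingType) (K L : nat -> lmodType A) :
  (forall i, projective (K i)) -> (forall i, projective (L i)) ->
  forall i, projective (cone K L i).
Proof. by move=> Kp Lp [|i] //=; apply: projective_pair. Qed.

(** Lifting [phi] to the resolutions and taking the cone costs one degree. *)
Lemma has_projective_resolution_coker (A : nzRingType) (M M' M'' : lmodType A)
    (phi : {linear M' -> M}) (q : {linear M -> M''}) n :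
  (forall x, phi x = 0 -> x = 0) -> (forall y, exists x, q x = y) ->
  (forall x, q x = 0 <-> exists y, phi y = x) ->
  has_projective_resolution M n -> has_projective_resolution M' n ->
  has_projective_resolution M'' n.+1.
Proof.
move=> phi_inj q_surj q_ker [K [dK [eK [Kp Kn K1 K2 K3]]]].
move=> [L [dL [eL [Lp Ln L1 L2 L3]]]].
have resK : is_resolution dK eK by [].
have resL : is_resolution dL eL by [].
have [F [F0E FE]] := chain_lift Lp (resolution_dd resL) (resolution_ed resL)
  resK phi.
exists (cone K L), (cone_d dK dL F), (cone_e L eK q).
have [C1 C2 C3] := cone_resolution FE resK resL phi_inj q_surj q_ker F0E.
split=> //; first exact: cone_projective.
case=> // i; rewrite ltnS => ni [x y] /=.
by rewrite (Kn i.+1 (leqW ni) x) (Ln i ni y).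
Qed.

(** * Lower bounds for projective dimension *)

Section Restriction.
Variables (R A : nzRingType) (f : {rmorphism R -> A}) (M : lmodType A).

(** The morphism is a parameter of the type, so that the module structure can be inferred. *)
Definition restr & {rmorphism R -> A} : Type := M.
Local Notation Mf := (restr f).

HB.instance Definition _ := GRing.Zmodule.on Mf.

Definition restr_scale (r : R) (x : Mf) : Mf := f r *: (x : M).

Fact restr_scaleA r s x : restr_scale r (restr_scale s x) = restr_scale (r * s) x.
Proof. by rewrite /restr_scale scalerA rmorphM. Qed.
Fact restr_scale1 : left_id 1 restr_scale.
Proof. by move=> x; rewrite /restr_scale rmorph1 scale1r. Qed.
Fact restr_scaleDr : right_distributive restr_scale +%R.
Proof. by move=> r x y; rewrite /restr_scale scalerDr. Qed.
Fact restr_scaleDl (x : Mf) : {morph restr_scale^~ x : r s / r + s}.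
Proof. by move=> r s; rewrite /restr_scale rmorphD scalerDl. Qed.

HB.instance Definition _ := GRing.Zmodule_isLmodule.Build R Mf
  restr_scaleA restr_scale1 restr_scaleDr restr_scaleDl.

Lemma restr_scaleE (r : R) (x : Mf) : r *: x = (f r *: (x : M)) :> M.
Proof. by []. Qed.

End Restriction.

Lemma restr_regularE (A S : nzRingType) (f : {rmorphism A -> S}) (a : A)
    (x : restr (S^o : lmodType S) f) : a *: x = (f a * (x : S)) :> S.
Proof. by []. Qed.

Section LowerBound.
Variable A : nzRingType.

Section Coboundaries.
Variables (K : nat -> lmodType A) (d : forall i, {linear K i.+1 -> K i}).
Variable (N : lmodType A).

Definition coboundary i (theta : {linear K i.+1 -> N}) : Prop :=
  exists psi : {linear K i -> N}, forall x, theta x = psi (d i x).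

End Coboundaries.

(** A nonzero class in $\mathrm{Ext}^{n+1}$ at the top of one projective resolution forces every
    resolution to be that long. With a resolution [P] of length at most [n], the composite K -> P
    -> K is homotopic to the identity and vanishes in degree [n.+1]; since [K] ends there, the
    identity of its last term factors through the last differential, and so does [theta]. *)
Lemma resolution_length_gt (K : nat -> lmodType A)
    (d : forall i, {linear K i.+1 -> K i})
    (M N : lmodType A) (e : {linear K 0%N -> M}) n (theta : {linear K n.+1 -> N}) m :
  (forall i, projective (K i)) -> is_resolution d e ->
  (forall x : K n.+2, x = 0) -> ~ coboundary d theta ->
  has_projective_resolution M m -> (n < m)%N.
Proof.
move=> Kp resK Kn ncob [P [dP [eP [Pp Pm P1 P2 P3]]]].
have resP : is_resolution dP eP by [].
rewrite ltnNge; apply/negP => mn; apply: ncob.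
have [F [F0E FE]] := chain_lift Kp (resolution_dd resK) (resolution_ed resK)
  resP idfun.
have [G [G0E GE]] := chain_lift Pp (resolution_dd resP) (resolution_ed resP)
  resK idfun.
pose H i : {linear K i -> K i} := (G i \o F i) \- idfun.
have [||s [_ sE]] := chain_homotopy Kp (resolution_dd resK) (F := H) resK.
- by move=> x; rewrite /H /= raddfB /= G0E F0E subrr.
- by move=> i x; rewrite /H /= raddfB /= GE FE.
exists (theta \o (\- s n)) => x.
have := sE n x; rewrite (Kn (s n.+1 x)) raddf0 add0r /H /=.
by rewrite (Pm n.+1 mn (F n.+1 x)) raddf0 sub0r => <-; rewrite opprK.
Qed.

Section SelfCone.
Variables (K : nat -> lmodType A) (d : forall i, {linear K i.+1 -> K i}).
Variables (M : lmodType A) (e : {linear K 0%N -> M}).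
Hypotheses (Kp : forall i, projective (K i)) (resK : is_resolution d e).
Variable F : forall i, {linear K i -> K i}.
Hypothesis FE : forall i x, d i (F i.+1 x) = F i (d i x).

(** The long exact sequence of the cone at its top degree: if [F] acts by zero on the classes in
    degree [n.+1], then the connecting map is injective. *)
Lemma cone_not_coboundary (N : lmodType A) n (theta : {linear K n.+1 -> N}) :
  ~ coboundary d theta ->
  (forall psi : {linear K n.+1 -> N}, coboundary d (psi \o F n.+1)) ->
  ~ coboundary (cone_d d d F)
      (theta \o (snd : {linear (K n.+2 * K n.+1)%type -> K n.+1})
         : {linear cone K K n.+2 -> N}).
Proof.
move=> ncob FN [psi psiE]; apply: ncob.
have iL : linear (fun x : K n.+1 => (x, 0) : cone K K n.+1) := @inl_linear _ _ _.
have jL : linear (fun x : K n => (0, x) : cone K K n.+1) := @inr_linear _ _ _.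
have [psi' psi'E] := FN (psi \o mk_linear iL).
exists (psi' \- (psi \o mk_linear jL)) => x /=.
rewrite -psi'E /= -raddfB /= -[(F n.+1 x, 0) - _]/(_, _) /= subr0 sub0r.
by have := psiE (0, x); rewrite /= raddf0 add0r.
Qed.

(** A chain map that commutes with [F] only up to homotopy still acts on the cone of [F], through
    a triangular matrix with the homotopy off the diagonal. *)
Lemma cone_chain_map (B : forall i, {linear K i -> K i}) :
  (forall i x, d i (B i.+1 x) = B i (d i x)) ->
  (forall x, e (B 0%N (F 0%N x)) = e (F 0%N (B 0%N x))) ->
  exists Bc : forall i, {linear cone K K i -> cone K K i},
    [/\ forall x, Bc 0%N x = B 0%N x,
        forall i x, cone_d d d F i (Bc i.+1 x) = Bc i (cone_d d d F i x) &
        forall i x, (Bc i.+1 x).2 = B i x.2].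
Proof.
move=> BE BF0.
pose H i : {linear K i -> K i} := (B i \o F i) \- (F i \o B i).
have [||s [sE0 sE]] := chain_homotopy Kp (resolution_dd resK) (F := H) resK.
- by move=> x; rewrite /H /= raddfB /= BF0 subrr.
- by move=> i x; rewrite /H /= raddfB /= !(BE, FE).
have BcL i : linear (fun x : cone K K i.+1 =>
    (B i.+1 x.1 + s i x.2, B i x.2) : cone K K i.+1).
  move=> a x y /=.
  rewrite (linearP (B i.+1)) (linearP (s i)) (linearP (B i)).
  by rewrite addrACA -scalerDr.
exists (fun i => if i is j.+1 return {linear cone K K i -> cone K K i}
                 then mk_linear (BcL j) else B 0%N).
split=> // -[|i] x /=.
  rewrite !raddfD /= BE -addrA; congr (_ + _).
  by rewrite -sE0 /H /= subrK.
congr (_, _); last by rewrite BE raddfN.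
rewrite !raddfD /= BE -!addrA; congr (_ + _).
have := sE i x.2; rewrite /H /= raddfN /= => /(canRL (subrK _)) ->.
by rewrite [RHS]addrAC addrK.
Qed.

End SelfCone.
End LowerBound.

Lemma projective_regular (A : nzRingType) : projective (A^o : lmodType A).
Proof.
move=> M N p f ps; have [m mE] := ps (f 1).
have gL : linear (fun a : A^o => a *: m : M).
  by move=> a x y; rewrite scalerDl scalerA.
exists (mk_linear gL) => x /=.
by rewrite linearZ /= mE -linearZ /= -[x *: 1]/(x * 1) mulr1.
Qed.

Lemma projective_trivial (A : nzRingType) (P : lmodType A) :
  (forall x : P, x = 0) -> projective P.
Proof.
move=> P0 M N p f ps.
exists \0 => x /=; rewrite (P0 x) !raddf0 //.
Qed.

(** * A module of projective dimension four *)

Section NormalSequence.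
Variables (A : nzRingType) (k : comNzRingType).
Variables (pi : {rmorphism A -> {poly {poly k}}}) (chi : {rmorphism A -> k}).
Variables (c u a b : A).
Hypothesis pi_surj : forall p, exists x, pi x = p.
Hypothesis pi_ker : forall x, pi x = 0 <-> exists y : A * A, x = y.1 * c + y.2 * u.
Hypotheses (pi_a : pi a = 'X) (pi_b : pi b = ('X)%:P).
Hypothesis cu : c * u = u * c.
Hypothesis c_reg : forall x, x * c = 0 -> x = 0.
Hypothesis u_reg : forall x y, x * u = y * c -> exists z, x = z * c.

(** Moving [x] across [c] and then across [u], in either order, produces the same element [x2].
    This is what right multiplication by [x] needs to extend to the complex [koszul], on whose
    last term it acts as right multiplication by [x2]. *)
Definition passes (x x2 : A) : Prop := exists xc xu,
  [/\ c * x = xc * c, u * x = xu * u, u * xc = x2 * u & c * xu = x2 * c].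

Variables (a2 b2 : A).
Hypotheses (pass_a : passes a a2) (pass_b : passes b b2).
Hypotheses (chi_c : chi c = 0) (chi_u : chi u = 0).
Hypotheses (chi_a2 : chi a2 = 0) (chi_b2 : chi b2 = 0).

Definition koszul i : lmodType A :=
  match i with
  | 0 => A^o : lmodType A
  | 1 => (A^o * A^o)%type : lmodType A
  | 2 => A^o : lmodType A
  | _ => 'rV[A]_0 : lmodType A
  end.

Fact koszul_d0_linear : linear (fun y : koszul 1 => y.1 * c + y.2 * u : koszul 0).
Proof. by move=> x [y1 y2] [z1 z2] /=; rewrite !mulrDl scalerDr addrACA !scalerAl. Qed.

Fact koszul_d1_linear : linear (fun x : koszul 2 => (x * u, - (x * c)) : koszul 1).
Proof.
move=> x y z /=; rewrite -[RHS]/(_, _) /= -[x *: y]/(x * y).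
by rewrite -[_ *: (y * u)]/(_ * _) -[_ *: - _]/(_ * _) !mulrDl opprD mulrN !mulrA.
Qed.

Definition koszul_d i : {linear koszul i.+1 -> koszul i} :=
  match i with
  | 0 => mk_linear koszul_d0_linear
  | 1 => mk_linear koszul_d1_linear
  | _ => \0
  end.

Local Notation B := {poly {poly k}}.
Let M2 : lmodType A := restr (B^o : lmodType B) pi.

Fact koszul_e_linear : linear (fun x : koszul 0 => pi x : M2).
Proof. by move=> x y z; rewrite rmorphD rmorphM. Qed.

Definition koszul_e : {linear koszul 0 -> M2} := mk_linear koszul_e_linear.

(** The sequence 0 -> A -> A^2 -> A is exact with cokernel [A / (A c + A u)], by regularity. *)
Lemma koszul_resolution : is_resolution koszul_d koszul_e.
Proof.
split.
- by move=> y; have [x xE] := pi_surj y; exists x.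
- by move=> x; split=> [/pi_ker [y ->]|[y <-]]; [exists y|apply/pi_ker; exists y].
- case=> [|[|i]].
  + move=> [x y]; split=> /= [E|[z [<- <-]]].
      have [z zE] : exists z, y = z * c.
        by apply: (@u_reg _ (- x)); rewrite mulNr; apply/eqP; rewrite -addr_eq0 addrC E.
      exists (- z); rewrite /= !mulNr opprK zE; congr (_, _).
      have : (z * u + x) * c = 0.
        by rewrite mulrDl -mulrA -cu mulrA -zE addrC.
      by move/c_reg/eqP; rewrite addrC addr_eq0 => /eqP.
    by rewrite mulNr -!mulrA cu subrr.
  + move=> x; split=> [[_ /eqP]|[y <-]]; last by rewrite /= !mul0r oppr0.
    by rewrite oppr_eq0 => /eqP/c_reg xE; exists 0; rewrite /= xE.
  + by move=> x; split=> // _; exists 0; rewrite [RHS]thinmx0.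
Qed.

Lemma koszul_projective i : projective (koszul i).
Proof.
case: i => [|[|[|i]]] /=; try exact: projective_regular.
  by apply: projective_pair; apply: projective_regular.
by apply: projective_trivial => x; apply: thinmx0.
Qed.

Lemma koszul_chain_map x x2 : passes x x2 ->
  exists F : forall i, {linear koszul i -> koszul i},
    [/\ forall y, F 0%N y = y * x,
        forall i y, koszul_d i (F i.+1 y) = F i (koszul_d i y) &
        forall y, F 2%N y = y * x2].
Proof.
move=> [xc [xu [E1 E2 E3 E4]]].
have F0L : linear (fun y : koszul 0 => y * x : koszul 0).
  by move=> s y z /=; rewrite mulrDl -scalerAl.
have F1L : linear (fun y : koszul 1 => (y.1 * xc, y.2 * xu) : koszul 1).
  by move=> s y z /=; rewrite !mulrDl -!scalerAl.
have F2L : linear (fun y : koszul 2 => y * x2 : koszul 2).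
  by move=> s y z /=; rewrite mulrDl -scalerAl.
exists (fun i => match i return {linear koszul i -> koszul i} with
  | 0 => mk_linear F0L | 1 => mk_linear F1L | 2 => mk_linear F2L | _ => \0 end).
split=> // -[|[|i]] y /=.
- by rewrite mulrDl -!mulrA E1 E2.
- by rewrite mulNr -!mulrA E3 E4.
- by rewrite ?raddf0.
Qed.

Let ev0 (S : comNzRingType) : {rmorphism {poly S} -> S} := horner_eval (0 : S).
Let pi3 : {rmorphism A -> {poly k}} := @ev0 _ \o pi.
Let pi4 : {rmorphism A -> k} := @ev0 _ \o pi3.
Let M3 : lmodType A := restr ({poly k}^o : lmodType {poly k}) pi3.
Let M4 : lmodType A := restr (k^o : lmodType k) pi4.
Let N : lmodType A := restr (k^o : lmodType k) chi.

Let hornerX_ker (S : comNzRingType) (p : {poly S}) :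
  p.[0] = 0 <-> exists q, 'X * q = p.
Proof.
split=> [p0|[q <-]]; last by rewrite hornerM hornerX mul0r.
have /factor_theorem [q ->] : root p 0 by apply/rootP.
by exists q; rewrite polyC0 subr0 mulrC.
Qed.

Let hornerX_reg (S : comNzRingType) (p : {poly S}) : 'X * p = 0 -> p = 0.
Proof.
move=> E; apply/polyP => i; have := congr1 (fun q : {poly S} => q`_i.+1) E.
by rewrite coefXM !coef0.
Qed.

(** Two cones, over multiplication by the outer variable of [{poly {poly k}}] and then by the
    inner one, make the resolution of length 2 of the quotient into one of length 4 of [k]. The
    character [chi] on the last term [A] is a cocycle; in degree 2 it is not a coboundary because
    coboundaries are multiples of [chi c] and [chi u], and it survives both cones because the
    chain maps act on it through [chi a2 = 0] and [chi b2 = 0]. *)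
Lemma normal_sequence_length m : has_projective_resolution M4 m -> (4 <= m)%N.
Proof.
have [F [F0 FE F2]] := koszul_chain_map pass_a.
have [G [G0 GE G2]] := koszul_chain_map pass_b.
have phi2L : linear (fun p : M2 => 'X * p : M2).
  by move=> s y z; rewrite mulrDr !restr_regularE mulrCA.
pose phi2 : {linear M2 -> M2} := mk_linear phi2L.
have q2L : linear (fun p : M2 => (p : B).[0] : M3).
  by move=> s y z; rewrite restr_regularE hornerD hornerM.
pose q2 : {linear M2 -> M3} := mk_linear q2L.
pose K3 := cone koszul koszul; pose d3 := cone_d koszul_d koszul_d F.
pose e3 : {linear K3 0%N -> M3} := cone_e koszul koszul_e q2.
have K3p := cone_projective koszul_projective koszul_projective.
have res3 : is_resolution d3 e3.
  apply: (cone_resolution FE koszul_resolution koszul_resolution (phi := phi2)).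
  - by move=> x /hornerX_reg.
  - by move=> y; exists (y%:P); rewrite /= hornerC.
  - exact: hornerX_ker.
  - by move=> x; rewrite F0 /= rmorphM pi_a mulrC.
have [G3 [G30 G3E G32]] : exists G3 : forall i, {linear K3 i -> K3 i},
    [/\ forall x, G3 0%N x = G 0%N x,
        forall i x, d3 i (G3 i.+1 x) = G3 i (d3 i x) &
        forall i x, (G3 i.+1 x).2 = G i x.2].
  apply: (cone_chain_map koszul_projective koszul_resolution FE GE).
  by move=> x; rewrite !F0 !G0 /= !rmorphM /= mulrAC.
pose theta2 : {linear koszul 2 -> N} :=
  mk_linear (ltac:(by move=> s y z; rewrite rmorphD rmorphM) :
    linear (fun x : koszul 2 => chi x : N)).
have Nlin (psi : {linear A^o -> N}) (x : A) : psi x = chi x * psi 1.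
  by rewrite -[x in LHS]mulr1 -[x * 1]/(x *: (1 : A^o)) linearZ.
have theta2_ncob : ~ coboundary koszul_d theta2.
  move=> [psi psiE].
  have := psiE 1; rewrite /= rmorph1 mul1r => E.
  have iL : linear (fun x : A^o => (x, 0) : koszul 1) := @inl_linear _ _ _.
  have jL : linear (fun x : A^o => (0, x) : koszul 1) := @inr_linear _ _ _.
  have psi1 : psi (u, 0) = 0.
    by have /= -> := Nlin (psi \o mk_linear iL) u; rewrite chi_u mul0r.
  have psi2 : psi (0, - (1 * c)) = 0.
    by have /= -> := Nlin (psi \o mk_linear jL) (- (1 * c));
       rewrite mul1r rmorphN chi_c oppr0 mul0r.
  have : psi ((u, 0) + (0, - (1 * c))) = 0 by rewrite raddfD /= psi1 psi2 addr0.
  rewrite -[(u, 0) + _]/(_, _) /= addr0 add0r -E => /eqP.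
  by rewrite oner_eq0.
pose theta3 : {linear K3 3 -> N} :=
  theta2 \o (snd : {linear (koszul 3 * koszul 2)%type -> koszul 2}).
have theta3_ncob : ~ coboundary d3 theta3.
  apply: cone_not_coboundary => // psi; exists \0 => x /=.
  by rewrite F2 Nlin rmorphM chi_a2 mulr0 mul0r.
have phi3L : linear (fun p : M3 => 'X * p : M3).
  by move=> s y z; rewrite mulrDr !restr_regularE mulrCA.
pose phi3 : {linear M3 -> M3} := mk_linear phi3L.
have q3L : linear (fun p : M3 => (p : {poly k}).[0] : M4).
  by move=> s y z; rewrite restr_regularE hornerD hornerM.
pose q3 : {linear M3 -> M4} := mk_linear q3L.
have res4 : is_resolution (cone_d d3 d3 G3) (cone_e K3 e3 q3).
  apply: (cone_resolution G3E res3 res3 (phi := phi3)).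
  - by move=> x /hornerX_reg.
  - by move=> y; exists (y%:P); rewrite /= hornerC.
  - exact: hornerX_ker.
  - move=> x; rewrite G30 G0 /= rmorphM pi_b hornerM hornerC mulrC //.
have K4p := cone_projective K3p K3p.
have theta4_ncob : ~ coboundary (cone_d d3 d3 G3)
    (theta3 \o (snd : {linear (K3 4 * K3 3)%type -> K3 3})).
  apply: cone_not_coboundary => // psi; exists \0 => -[x y] /=.
  have iL : linear (fun x : A^o => (0, x) : K3 3) := @inr_linear _ _ _.
  have -> : G3 3 (x, y) = (0, y * b2).
    rewrite [LHS]surjective_pairing G32 G2; congr (_, _).
    exact: thinmx0.
  have /= -> := Nlin (psi \o mk_linear iL) (y * b2).
  by rewrite rmorphM chi_b2 mulr0 mul0r.
apply: (resolution_length_gt K4p res4 _ theta4_ncob) => -[[x y] [z t]].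
have z0 (v : 'rV[A]_0) : v = 0 := thinmx0 v.
by rewrite /= [x]z0 [y]z0 [z]z0 [t]z0.
Qed.

End NormalSequence.

(** * Ore extensions *)

Section OreExtension.
Variables (R A : nzRingType) (i : {rmorphism R -> A}) (x : A).

Definition oev (p : {poly R}) : A := (map_poly i p).[x].

Lemma oevD p q : oev (p + q) = oev p + oev q.
Proof. by rewrite /oev rmorphD hornerD. Qed.
Lemma oevN p : oev (- p) = - oev p.
Proof. by rewrite /oev rmorphN hornerN. Qed.
Lemma oev0 : oev 0 = 0.
Proof. by rewrite /oev rmorph0 horner0. Qed.
Lemma oevC r : oev r%:P = i r.
Proof. by rewrite /oev map_polyC hornerC. Qed.
Lemma oevMX p : oev (p * 'X) = oev p * x.
Proof. by rewrite /oev rmorphM /= map_polyX hornerMX. Qed.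
Lemma oevCM r p : oev (r%:P * p) = i r * oev p.
Proof. by rewrite /oev rmorphM /= map_polyC hornerCM. Qed.
Lemma oevMXn p n : oev (p * 'X^n) = oev p * x ^+ n.
Proof.
elim: n => [|n IHn]; first by rewrite !expr0 !mulr1.
by rewrite !exprSr !mulrA oevMX IHn.
Qed.

(** An Ore extension presented intrinsically: [A] is left free over [R] on the powers of [x]. The
    relation and the freeness make [s] a ring morphism and [d] a skew derivation. *)
Record ore_ext (s d : R -> R) : Prop := OreExt {
  ore_rel : forall r, x * i r = i (s r) * x + i (d r);
  ore_bij : bijective s;
  ore_span : forall w, exists p, w = oev p;
  ore_inj : forall p, oev p = 0 -> p = 0 }.

(** The degree filtration, with [odeg n] meaning degree less than [n]. *)
Definition odeg (n : nat) (w : A) : Prop := exists2 p : {poly R}, (size p <= n)%N & w = oev p.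

Lemma odegD n v w : odeg n v -> odeg n w -> odeg n (v + w).
Proof.
move=> [p pn ->] [q qn ->]; exists (p + q); last by rewrite oevD.
by rewrite (leq_trans (size_polyD p q)) // geq_max pn qn.
Qed.
Lemma odegN n v : odeg n v -> odeg n (- v).
Proof. by move=> [p pn ->]; exists (- p); rewrite ?size_polyN ?oevN. Qed.
Lemma odeg0 n : odeg n 0.
Proof. by exists 0; rewrite ?size_poly0 ?oev0. Qed.
Lemma odegW n m v : (n <= m)%N -> odeg n v -> odeg m v.
Proof. by move=> nm [p pn ->]; exists p => //; apply: leq_trans nm. Qed.
Lemma odegMl n r v : odeg n v -> odeg n (i r * v).
Proof.
move=> [p pn ->]; exists (r%:P * p); last by rewrite oevCM.
by rewrite mul_polyC (leq_trans (size_scale_leq _ _)).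
Qed.
Lemma odegX n r : odeg n.+1 (i r * x ^+ n).
Proof.
exists (r%:P * 'X^n); last by rewrite oevMXn oevC.
by rewrite mul_polyC (leq_trans (size_scale_leq _ _)) // size_polyXn.
Qed.
Lemma odegS_inv n v : odeg n.+1 v -> exists r, odeg n (v - i r * x ^+ n).
Proof.
move=> [p pn ->]; exists p`_n, (p - (p`_n)%:P * 'X^n).
  apply/leq_sizeP => j nj; rewrite coefB mul_polyC coefZ coefXn.
  have [->|jn] := eqVneq j n; first by rewrite mulr1 subrr.
  by rewrite mulr0 subr0 nth_default // (leq_trans pn) // ltn_neqAle eq_sym jn.
by rewrite oevD oevN oevMXn oevC.
Qed.
Lemma odeg0_eq v : odeg 0 v -> v = 0.
Proof. by move=> [p]; rewrite leqn0 size_poly_eq0 => /eqP -> ->; rewrite oev0. Qed.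

Variables (s d : R -> R).
Hypothesis ore : ore_ext s d.

Lemma odeg_ex w : exists n, odeg n w.
Proof. by have [p ->] := ore_span ore w; exists (size p), p. Qed.

(** This is where freeness enters: an element has one leading coefficient only. *)
Lemma odeg_lead n r : odeg n (i r * x ^+ n) -> r = 0.
Proof.
move=> [p pn E]; have := ore_inj ore (p := r%:P * 'X^n - p).
rewrite oevD oevN oevMXn oevC E subrr => /(_ erefl) H.
have := congr1 (fun q : {poly R} => q`_n) H.
by rewrite coefB mul_polyC coefZ coefXn eqxx mulr1 coef0 nth_default // subr0.
Qed.

Lemma ore_s0 : s 0 = 0.
Proof.
have := ore_rel ore 0; rewrite rmorph0 mulr0 => E.
apply: (@odeg_lead 1); rewrite expr1; exists (- (d 0)%:P).
  by rewrite size_polyN size_polyC_leq1.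
by rewrite oevN oevC; apply/eqP; rewrite -addr_eq0 -E.
Qed.

Lemma ore_iter_eq0 n r : iter n s r = 0 -> r = 0.
Proof.
elim: n r => //= n IHn r; rewrite -[in X in _ = X -> _]ore_s0.
by move/(bij_inj (ore_bij ore))/IHn.
Qed.

Lemma ore_iter_surj n r : exists r', iter n s r' = r.
Proof.
elim: n r => [|n IHn] r; first by exists r.
have [t _ ts] := ore_bij ore; have [r' r'E] := IHn (t r).
by exists r'; rewrite /= r'E ts.
Qed.

Lemma odegMx n v : odeg n v -> odeg n.+1 (x * v).
Proof.
elim: n v => [|n IHn] v; first by move/odeg0_eq ->; rewrite mulr0; apply: odeg0.
move=> /odegS_inv [r /IHn H]; rewrite -[v](subrK (i r * x ^+ n)) mulrDr.
apply: odegD; first by apply: odegW H.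
rewrite mulrA (ore_rel ore) mulrDl -mulrA -exprS.
by apply: odegD; [apply: odegX|apply: odegW (odegX _ _)].
Qed.

Lemma odegMxn m n v : odeg n v -> odeg (m + n) (x ^+ m * v).
Proof.
elim: m => [|m IHm] vn; first by rewrite mul1r.
by rewrite exprS -mulrA addSn; apply/odegMx/IHm.
Qed.

(** Moving a coefficient across [x ^+ n] twists it by [s ^ n] up to lower degree. *)
Lemma odeg_comm n r : odeg n (x ^+ n * i r - i (iter n s r) * x ^+ n).
Proof.
elim: n => [|n IHn]; first by rewrite mul1r mulr1 subrr; apply: odeg0.
have := odegMx IHn; rewrite mulrBr mulrA -exprS => H.
rewrite -(subrK (x * (i (iter n s r) * x ^+ n)) (x ^+ n.+1 * i r)) -addrA.
apply: odegD => //; rewrite mulrA (ore_rel ore) mulrDl -mulrA -exprS addrC addKr.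
exact: odegX.
Qed.

Lemma odegXr n r : odeg n.+1 (x ^+ n * i r).
Proof.
rewrite -(subrK (i (iter n s r) * x ^+ n) (x ^+ n * i r)).
by apply: odegD; [apply: odegW (odeg_comm _ _)|apply: odegX].
Qed.

Lemma odegMr n v r : odeg n v -> odeg n (v * i r).
Proof.
elim: n v => [|n IHn] v; first by move/odeg0_eq ->; rewrite mul0r; apply: odeg0.
move=> /odegS_inv [r' /IHn H]; rewrite -[v](subrK (i r' * x ^+ n)) mulrDl.
apply: odegD; first by apply: odegW H.
by rewrite -mulrA; apply/odegMl/odegXr.
Qed.

Lemma odegM m n v w : odeg m.+1 v -> odeg n w -> odeg (m + n) (v * w).
Proof.
elim: m v => [|m IHm] v /odegS_inv [r vr] wn.
  move/odeg0_eq/eqP: vr; rewrite subr_eq0 mulr1 => /eqP ->; exact: odegMl.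
rewrite -[v](subrK (i r * x ^+ m.+1)) mulrDl; apply: odegD.
  by apply: odegW (IHm _ vr wn); rewrite leq_add2r.
by rewrite -mulrA; apply/odegMl/odegMxn.
Qed.

(** The leading coefficient of a product is [r * s ^ n t], for [r], [t] those of the factors. *)
Lemma ore_domain : is_domain R -> is_domain A.
Proof.
move=> Rdom v w vw; have [//|v0] := pselect (v = 0); first by left.
right; apply: contrapT => w0.
have lead u : u <> 0 -> exists n r, r <> 0 /\ odeg n (u - i r * x ^+ n).
  move=> u0; have [n] := odeg_ex u; elim: n => [/odeg0_eq //|n IHn].
  move=> un; have [r ur] := odegS_inv un.
  have [r0|r0] := pselect (r = 0); last by exists n, r.
  by apply: IHn; move: ur; rewrite r0 rmorph0 mul0r subr0.
have [n [r [r0 vr]]] := lead v v0; have [m [t [t0 wt]]] := lead w w0.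
have : odeg (n + m) (i (r * iter n s t) * x ^+ (n + m)).
  have -> : i (r * iter n s t) * x ^+ (n + m) =
      - ((v - i r * x ^+ n) * w + i r * (x ^+ n * (w - i t * x ^+ m))
         + i r * ((x ^+ n * i t - i (iter n s t) * x ^+ n) * x ^+ m)).
    rewrite rmorphM exprD mulrBl vw sub0r mulrBr mulrBr -!mulrA.
    rewrite mulrBl mulrBr -!mulrA addKr addrA addNr sub0r opprK //.
  apply: odegN; apply: odegD; first apply: odegD.
  - case: n vr => [|n] vr; first by rewrite (odeg0_eq vr) mul0r; apply: odeg0.
    have wm : odeg m.+1 w.
      rewrite -[w](subrK (i t * x ^+ m)); apply: odegD; last exact: odegX.
      exact: odegW wt.
    by rewrite addSnnS; apply: odegM.
  - by apply/odegMl/odegMxn.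
  - apply: odegMl; case: n vr => [|n] vr.
      by rewrite !expr0 /= mul1r mulr1 subrr mul0r; apply: odeg0.
    rewrite addSnnS; apply: odegM; first exact: odeg_comm.
    by rewrite -[x ^+ m]mul1r -(rmorph1 i); apply: odegX.
move/odeg_lead/Rdom => [//|/ore_iter_eq0 //].
Qed.

End OreExtension.

(** * The converse of an Ore extension and the basis theorem *)

Section ConverseMorphism.
Variables (R A : nzRingType) (f : {rmorphism R -> A}).

Definition conv_fun : R^c -> A^c := f.

Fact conv_fun_zmod : zmod_morphism conv_fun.
Proof. exact: (rmorphB f). Qed.
Fact conv_fun_monoid : monoid_morphism conv_fun.
Proof. by split=> [|x y]; [apply: (rmorph1 f)|apply: (rmorphM f)]. Qed.

HB.instance Definition _ := GRing.isZmodMorphism.Build R^c A^c conv_fun conv_fun_zmod.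
HB.instance Definition _ := GRing.isMonoidMorphism.Build R^c A^c conv_fun conv_fun_monoid.

Definition conv_morph : {rmorphism R^c -> A^c} := conv_fun.

End ConverseMorphism.

Lemma exprc (A : nzRingType) (x : A) n : (x : A^c) ^+ n = x ^+ n.
Proof. by elim: n => [|n IHn] //; rewrite exprS IHn [RHS]exprSr. Qed.

Section OreConverse.
Variables (R A : nzRingType) (i : {rmorphism R -> A}) (x : A) (s d : R -> R).
Hypothesis ore : ore_ext i x s d.
Local Notation ic := (conv_morph i).
Local Notation odegc := (@odeg _ _ ic x).

Lemma odegc_odeg n w : odegc n w -> odeg i x n w.
Proof.
elim: n w => [|n IHn] w; first by move/odeg0_eq ->; apply: odeg0.
move=> /odegS_inv [r /IHn wr].
rewrite -[w](subrK ((ic r : A^c) * (x : A^c) ^+ n)); apply: odegD.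
  exact: odegW wr.
by rewrite exprc; apply: (odegXr ore).
Qed.

Lemma odeg_odegc n w : odeg i x n w -> odegc n w.
Proof.
elim: n w => [|n IHn] w; first by move/odeg0_eq ->; apply: odeg0.
move=> /odegS_inv [r wr]; have [t tr] := ore_iter_surj ore n r.
have /IHn H : odeg i x n (w - x ^+ n * i t).
  rewrite -(subrK (i r * x ^+ n) w) -addrA; apply: odegD => //.
  by rewrite -opprB -tr; apply: odegN; apply: (odeg_comm ore).
have K := odegD (odegW (leqnSn n) H) (@odegX _ _ ic x n t).
suff -> : w = (w - x ^+ n * i t) + ((ic t : A^c) * (x : A^c) ^+ n) :> A^c by [].
by rewrite exprc; exact/esym/subrK.
Qed.

(** As [s] is bijective, the degree filtration is the same whether coefficients are written on the
    left or on the right, so the powers of [x] are also a basis on the other side. *)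
Lemma ore_conv : exists s' d', ore_ext ic x s' d'.
Proof.
have [t st ts] := ore_bij ore; exists t, (fun r => - d (t r)); split.
- move=> r; change (i r * x = x * i (t r) + i (- d (t r))).
  by rewrite (ore_rel ore) ts rmorphN -addrA subrr addr0.
- by exists s.
- move=> w; have [n /odeg_odegc [p _ pE]] := odeg_ex ore w.
  by exists p.
- move=> p p0; have H : odegc (size p) (oev ic (x : A^c) p) by exists p.
  case E: (size p) => [|n]; first by apply/eqP; rewrite -size_poly_eq0 E.
  have lead : odegc n ((x ^+ n * i p`_n) : A^c).
    exists (- (p - (p`_n)%:P * 'X^n)).
      rewrite size_polyN; apply/leq_sizeP => j nj.
      rewrite coefB mul_polyC coefZ coefXn.
      have [->|jn] := eqVneq j n; first by rewrite mulr1 subrr.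
      by rewrite mulr0 subr0 nth_default // E ltn_neqAle eq_sym jn.
    rewrite oevN oevD oevN p0 oevMXn oevC exprc sub0r opprK //.
  have /odeg_lead H2 : odeg i x n (i (iter n s p`_n) * x ^+ n).
    rewrite -[i (iter n s p`_n) * x ^+ n](subrK (x ^+ n * i p`_n)).
    apply: odegD; last exact: odegc_odeg.
    by rewrite -opprB; apply: odegN; apply: (odeg_comm ore).
  have /(ore_iter_eq0 ore) pn0 := H2 _ _ ore.
  by apply/eqP; rewrite -lead_coef_eq0 lead_coefE E pn0.
Qed.

Lemma odegSr_inv n w : odeg i x n.+1 w -> exists r, odeg i x n (w - x ^+ n * i r).
Proof.
move=> /odeg_odegc /odegS_inv [r]; rewrite exprc => /odegc_odeg H; by exists r.
Qed.

Lemma left_ideal_opp (I : set A) v : is_left_ideal I -> I v -> I (- v).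
Proof. by move=> [_ _ H] /(H (-1)); rewrite mulN1r. Qed.

(** Hilbert's basis theorem. Leading coefficients are taken on the right, [w = x ^+ n * i r +
    ...], so that multiplication by [x] preserves them and the leading coefficients in degree [n]
    of a left ideal form a left ideal of [R], increasing with [n]. The bi-indexed family of these
    ideals for a chain of left ideals is stationary. *)
Lemma ore_left_noetherian : left_noetherian R -> left_noetherian A.
Proof.
move=> Rn J Jid Jasc.
have Jmono m m' w : (m <= m')%N -> J m w -> J m' w.
  elim: m' => [|m' IH]; first by rewrite leqn0 => /eqP ->.
  by rewrite leq_eqVlt => /orP [/eqP -> //|/IH H] /H; apply: Jasc.
pose I n m : set R := fun r =>
  exists2 w, J m w & odeg i x n (w - x ^+ n * i r).
have Iid n m : is_left_ideal (I n m).
  have [J0 JD JM] := Jid m; split.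
  - by exists 0 => //; rewrite rmorph0 mulr0 subr0; apply: odeg0.
  - move=> r r' [w Jw wr] [w' Jw' wr']; exists (w + w'); first exact: JD.
    by rewrite rmorphD mulrDr opprD addrACA; apply: odegD.
  - move=> r' r [w Jw wr]; exists (i (iter n s r') * w); first exact: JM.
    rewrite -(subrK (i (iter n s r') * (x ^+ n * i r)) (i (iter n s r') * w)).
    rewrite -mulrBr -addrA; apply: odegD; first exact: odegMl.
    rewrite rmorphM !mulrA -mulrBl -opprB mulNr; apply/odegN.
    by apply: (odegMr ore); apply: (odeg_comm ore).
have Iascn n m : I n m `<=` I n.+1 m.
  move=> r [w Jw wr]; exists (x * w); first by have [_ _] := Jid m; apply.
  by rewrite exprS -mulrA -mulrBr; apply: (odegMx ore).
have Iascm n m : I n m `<=` I n m.+1.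
  by move=> r [w Jw wr]; exists w => //; apply: Jasc.
have Imonom n m m' : (m <= m')%N -> I n m `<=` I n m'.
  by move=> mm r [w Jw wr]; exists w => //; apply: Jmono Jw.
have Imonon n n' m : (n <= n')%N -> I n m `<=` I n' m.
  elim: n' => [|n' IH]; first by rewrite leqn0 => /eqP ->.
  by rewrite leq_eqVlt => /orP [/eqP -> //|/IH H] r /H; apply: Iascn.
have [N NE] := Rn (fun n => I n n) (fun n => Iid n n)
  (fun n => subset_trans (@Iascn n n) (@Iascm n.+1 n)).
have big n m : (N <= n)%N -> (N <= m)%N -> I n m `<=` I N N.
  move=> Nn Nm; rewrite -(NE (maxn n m)) ?leq_max ?Nn //.
  apply: subset_trans (@Imonom _ _ _ (leq_maxr n m)).
  exact: Imonon (leq_maxl n m).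
have /choice [M0 M0E] n : exists M, forall m, (M <= m)%N -> I n m = I n M.
  exact: Rn (I n) (Iid n) (Iascm n).
pose M := maxn N (\max_(n < N) M0 n).
have stable n m : (M <= m)%N -> I n m `<=` I n M.
  move=> Mm; have NM : (N <= M)%N := leq_maxl _ _.
  have [nN|Nn] := ltnP n N.
    have nM : (M0 n <= M)%N.
      apply: leq_trans (leq_maxr N _).
      exact: (leq_bigmax (F := fun n : 'I_N => M0 n) (Ordinal nN)).
    by rewrite (M0E n m (leq_trans nM Mm)) (M0E n M nM).
  apply: subset_trans (big n m Nn (leq_trans NM Mm)) _.
  by apply: subset_trans (@Imonon _ _ _ Nn) _; apply: Imonom.
exists M => m Mm; apply/seteqP; split; last by move=> w; apply: Jmono.
have [J0 JD JM] := Jid M; have [_ JDm _] := Jid m.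
move=> w; have [n] := odeg_ex ore w; elim: n w => [|n IHn] w.
  by move/odeg0_eq ->.
move=> /odegSr_inv [r wr] Jw.
have /(stable n m Mm) [v Jv vr] : I n m r by exists w.
rewrite -[w](subrK v); apply: JD => //; apply: IHn.
  rewrite -[w](subrK (x ^+ n * i r)) -addrA; apply: odegD => //.
  by rewrite -opprB; apply: odegN.
apply: JDm => //; apply: left_ideal_opp (Jid m) _.
exact: Jmono Jv.
Qed.

End OreConverse.

(** * Induced modules *)

Section FiniteSequences.
Variable M : zmodType.

Definition fseq_pred : {pred nat -> M} := fun f =>
  `[< exists N, forall j, (N <= j)%N -> f j = 0 >].

Fact fseq_zmod_closed : zmod_closed fseq_pred.
Proof.
split=> [|f g /asboolP [N fN] /asboolP [N' gN]]; apply/asboolP.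
  by exists 0%N.
exists (maxn N N') => j; rewrite geq_max => /andP [Nj Nj'].
rewrite -[LHS]/(f j - g j).
by rewrite fN // gN // subr0.
Qed.

HB.instance Definition _ := GRing.isZmodClosed.Build (nat -> M) fseq_pred fseq_zmod_closed.

Record fseq := FSeq { fseq_val :> nat -> M; _ : fseq_val \in fseq_pred }.
HB.instance Definition _ := [isSub for fseq_val].
HB.instance Definition _ := [Choice of fseq by <:].
HB.instance Definition _ := [SubChoice_isSubZmodule of fseq by <:].

Lemma fseqP (f g : fseq) : (forall j, f j = g j) -> f = g.
Proof. by move=> fg; apply: val_inj; apply: funext. Qed.

Lemma fseqD (f g : fseq) j : (f + g) j = f j + g j.
Proof. by []. Qed.
Lemma fseqN (f : fseq) j : (- f) j = - f j.
Proof. by []. Qed.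
Lemma fseq0 j : (0 : fseq) j = 0.
Proof. by []. Qed.
Lemma fseq_sum I (r : seq I) (P : pred I) (F : I -> fseq) j :
  (\sum_(l <- r | P l) F l) j = \sum_(l <- r | P l) F l j.
Proof. by elim/big_rec2: _ => //= l y1 y2 _ <-. Qed.

Definition fbounded (f : nat -> M) N := forall j, (N <= j)%N -> f j = 0.

Lemma fboundedW f N N' : (N <= N')%N -> fbounded f N -> fbounded f N'.
Proof. by move=> NN fN j Nj; exact: fN (leq_trans NN Nj). Qed.

Lemma fseq_bounded (f : fseq) : exists N, fbounded (fseq_val f) N.
Proof. by case: f => f0 /= /asboolP. Qed.

Definition mk_fseq (f : nat -> M) N (fN : fbounded f N) : fseq :=
  FSeq (introT (asboolP _) (ex_intro _ N fN)).

Definition fbound (f : fseq) : nat := sval (cid (fseq_bounded f)).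
Lemma fboundP (f : fseq) : fbounded (fseq_val f) (fbound f).
Proof. exact: svalP (cid (fseq_bounded f)). Qed.

Lemma sum_fbounded (V : zmodType) (G : nat -> M -> V) (f : nat -> M) N N' :
  (forall j, G j 0 = 0) -> fbounded f N -> fbounded f N' ->
  \sum_(j < N) G j (f j) = \sum_(j < N') G j (f j).
Proof.
move=> G0; wlog NN : N N' / (N <= N')%N => [H fN fN'|fN _].
  by have [/H->|/ltnW/H->] := leqP N N'.
rewrite -(subnKC NN) big_split_ord /= [X in _ + X]big1 ?addr0 // => j _.
by rewrite fN ?G0 // leq_addr.
Qed.

End FiniteSequences.

Section RightCoefficients.
Variables (R A : nzRingType) (i : {rmorphism R -> A}) (x : A).

(** The induced module of [M] consists of formal sums of [x ^+ j] tensor [m], which requires [A]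
    to be free as a right module over [R] on the powers of [x]. *)
Definition right_basis : Prop :=
  (forall w, exists (c : nat -> R) N, fbounded c N /\ w = \sum_(j < N) x ^+ j * i (c j)) /\
  (forall (c : nat -> R) N, \sum_(j < N) x ^+ j * i (c j) = 0 -> forall j, (j < N)%N -> c j = 0).

Hypothesis xb : right_basis.

Definition rcoefs (w : A) : nat -> R := sval (cid (xb.1 w)).
Definition rcoef j w : R := rcoefs w j.

Lemma rcoef_bounded w : exists N, fbounded (rcoef^~ w) N.
Proof. by have [N [cN _]] := svalP (cid (xb.1 w)); exists N. Qed.

Lemma rcoef_sum w N : fbounded (rcoef^~ w) N -> \sum_(j < N) x ^+ j * i (rcoef j w) = w.
Proof.
move=> wN; have [N' [wN' E]] := svalP (cid (xb.1 w)).
rewrite [RHS]E; apply: (sum_fbounded (G := fun j r => x ^+ j * i r)) => // j.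
by rewrite rmorph0 mulr0.
Qed.

Lemma rcoefE w (c : nat -> R) N : fbounded c N -> w = \sum_(j < N) x ^+ j * i (c j) ->
  forall j, rcoef j w = c j.
Proof.
move=> cN wE j; have [N' wN'] := rcoef_bounded w.
pose m := maxn j.+1 (maxn N N').
have E : \sum_(j < m) x ^+ j * i (rcoef j w - c j) = 0.
  under eq_bigr do rewrite rmorphB mulrBr.
  rewrite sumrB (_ : \sum_(j < m) _ = w).
    apply/eqP; rewrite subr_eq0 wE; apply/eqP.
    apply: (sum_fbounded (G := fun j r => x ^+ j * i r)) => //.
    - by move=> l; rewrite rmorph0 mulr0.
    - by move=> l; rewrite !geq_max => /and3P [_ ? _]; apply: cN.
  by apply: rcoef_sum => l; rewrite !geq_max => /and3P [_ _ ?]; apply: wN'.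
apply/eqP; rewrite -subr_eq0; apply/eqP.
by apply: (xb.2 (fun j => rcoef j w - c j) m E); rewrite leq_max ltnSn.
Qed.

Lemma rcoefD j v w : rcoef j (v + w) = rcoef j v + rcoef j w.
Proof.
have [N vN] := rcoef_bounded v; have [N' wN'] := rcoef_bounded w.
apply: (rcoefE (c := fun j => rcoef j v + rcoef j w) (N := maxn N N')).
  by move=> l; rewrite geq_max => /andP [? ?]; rewrite vN // wN' // addr0.
under eq_bigr do rewrite rmorphD mulrDr.
rewrite big_split /= !rcoef_sum // => l; rewrite geq_max => /andP [? ?]; last exact: vN.
exact: wN'.
Qed.

Lemma rcoefMr j w r : rcoef j (w * i r) = rcoef j w * r.
Proof.
have [N wN] := rcoef_bounded w.
apply: (rcoefE (c := fun j => rcoef j w * r) (N := N)).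
  by move=> l Nl; rewrite wN // mul0r.
by under eq_bigr do rewrite rmorphM mulrA; rewrite -mulr_suml rcoef_sum.
Qed.

Lemma rcoef0 j : rcoef j 0 = 0.
Proof. by apply: (addIr (rcoef j 0)); rewrite -rcoefD !add0r. Qed.

Lemma rcoef_summ j I (r : seq I) (F : I -> A) :
  rcoef j (\sum_(l <- r) F l) = \sum_(l <- r) rcoef j (F l).
Proof. exact: (big_morph (rcoef j) (rcoefD j) (rcoef0 j)). Qed.

Lemma rcoefXn j n : rcoef j (x ^+ n) = (j == n)%:R.
Proof.
apply: (rcoefE (c := fun j => (j == n)%:R) (N := n.+1)).
  by move=> l nl; rewrite gtn_eqF.
rewrite big_ord_recr /= eqxx rmorph1 mulr1 big1 ?add0r // => l _.
by rewrite (ltn_eqF (ltn_ord l)) rmorph0 mulr0.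
Qed.

Section Induced.
Variable M : lmodType R.

(** The tensor product of [A] with [M] over [R]: finite sequences in [M], the term of index [j]
    standing for the coefficient of [x ^+ j]. *)
Definition induced & right_basis : Type := fseq M.
Local Notation Ind := (induced xb).
HB.instance Definition _ := GRing.Zmodule.on Ind.

(** The element [p * x ^+ l] is expanded in the right basis to act on [x ^+ l] tensor [f l]. *)
Definition iscale_fun (p : A) (f : nat -> M) N j : M :=
  \sum_(l < N) rcoef j (p * x ^+ l) *: f l.

Fact iscale_fun_bounded p f N : exists N', fbounded (iscale_fun p f N) N'.
Proof.
elim: N => [|N [N' IH]]; first by exists 0%N => j _; rewrite /iscale_fun big_ord0.
have [N'' H] := rcoef_bounded (p * x ^+ N).
exists (maxn N' N'') => j; rewrite geq_max => /andP [j1 j2].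
by rewrite /iscale_fun big_ord_recr /= -/(iscale_fun p f N j) IH // H // scale0r addr0.
Qed.

Definition iscale (p : A) (f : Ind) : Ind :=
  mk_fseq (svalP (cid (iscale_fun_bounded p f (fbound f)))).

Lemma iscaleE p (f : Ind) N j : fbounded f N -> iscale p f j = iscale_fun p f N j.
Proof.
move=> fN; apply: (sum_fbounded (G := fun l m => rcoef j (p * x ^+ l) *: m)) => //.
  by move=> l; rewrite scaler0.
exact: fboundP.
Qed.

Fact iscaleA p q f : iscale p (iscale q f) = iscale (p * q) f.
Proof.
have [N fN] := fseq_bounded f; have [N' gN'] := fseq_bounded (iscale q f).
have /choice [B BP] : forall l, exists N, fbounded (rcoef^~ (q * x ^+ l)) N.
  by move=> l; apply: rcoef_bounded.
pose m := maxn N' (\max_(l < N) B l).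
have gm : fbounded (iscale q f) m := fboundedW (leq_maxl _ _) gN'.
apply: fseqP => j; rewrite (iscaleE p j gm) (iscaleE _ j fN) /iscale_fun.
under eq_bigr do rewrite (iscaleE q _ fN) /iscale_fun scaler_sumr.
rewrite exchange_big /=; apply: eq_bigr => l _.
under eq_bigr do rewrite scalerA -rcoefMr -mulrA.
rewrite -scaler_suml -rcoef_summ -mulr_sumr rcoef_sum ?mulrA // => t mt.
apply: BP; apply: leq_trans mt; apply: leq_trans (leq_maxr _ _).
exact: (leq_bigmax (F := fun l : 'I_N => B l)).
Qed.

Fact iscale1 : left_id 1 iscale.
Proof.
move=> f; have [N fN] := fseq_bounded f; apply: fseqP => j.
have fN' : fbounded f (maxn N j.+1) := fboundedW (leq_maxl _ _) fN.
rewrite (iscaleE _ j fN') /iscale_fun.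
under eq_bigr do rewrite mul1r rcoefXn.
have jN : (j < maxn N j.+1)%N by rewrite leq_max ltnSn orbT.
rewrite (bigD1 (Ordinal jN)) //= eqxx scale1r big1 ?addr0 // => l lj.
by rewrite eq_sym (_ : (_ == _) = false) ?scale0r //; apply/negbTE.
Qed.

Fact iscaleDr : right_distributive iscale +%R.
Proof.
move=> p f g; have [N fN] := fseq_bounded f; have [N' gN'] := fseq_bounded g.
have fm : fbounded f (maxn N N') := fboundedW (leq_maxl _ _) fN.
have gm : fbounded g (maxn N N') := fboundedW (leq_maxr _ _) gN'.
have fgm : fbounded (f + g) (maxn N N') by move=> l ml; rewrite fseqD fm // gm // addr0.
apply: fseqP => j; rewrite fseqD (iscaleE _ _ fgm) (iscaleE _ _ fm) (iscaleE _ _ gm).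
rewrite /iscale_fun -big_split /=; apply: eq_bigr => l _.
by rewrite -scalerDr.
Qed.

Fact iscaleDl f : {morph iscale^~ f : p q / p + q}.
Proof.
move=> p q; have [N fN] := fseq_bounded f; apply: fseqP => j.
rewrite fseqD !(iscaleE _ _ fN) /iscale_fun -big_split /=; apply: eq_bigr => l _.
by rewrite mulrDl rcoefD scalerDl.
Qed.

HB.instance Definition _ := GRing.Zmodule_isLmodule.Build A Ind
  iscaleA iscale1 iscaleDr iscaleDl.

Lemma inducedD (f f' : Ind) j : (f + f' : Ind) j = f j + f' j.
Proof. by []. Qed.

Lemma induced_scaleE p (f : Ind) N j : fbounded f N ->
  (p *: f : Ind) j = \sum_(l < N) rcoef j (p * x ^+ l) *: f l.
Proof. exact: iscaleE. Qed.

Definition idelta_fun (n : nat) (m : M) (j : nat) : M := if j == n then m else 0.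
Fact idelta_bounded n m : fbounded (idelta_fun n m) n.+1.
Proof. by move=> j nj; rewrite /idelta_fun gtn_eqF. Qed.
(** The pure tensor of [x ^+ n] and [m]. *)
Definition idelta n m : Ind := mk_fseq (@idelta_bounded n m).

Lemma ideltaE n m j : idelta n m j = if j == n then m else 0.
Proof. by []. Qed.

Lemma scale_delta p n m j : (p *: idelta n m : Ind) j = rcoef j (p * x ^+ n) *: m.
Proof.
rewrite (@induced_scaleE p (idelta n m) n.+1 j (@idelta_bounded n m)) big_ord_recr /=
  /idelta_fun eqxx.
rewrite big1 ?add0r // => l _.
by rewrite (ltn_eqF (ltn_ord l)) scaler0.
Qed.

Lemma scaleXn_delta n m : x ^+ n *: idelta 0 m = idelta n m.
Proof.
apply: fseqP => j; rewrite scale_delta mulr1 rcoefXn ideltaE.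
by case: eqP; rewrite ?scale1r ?scale0r.
Qed.

Lemma scalei_delta r m : i r *: idelta 0 m = idelta 0 (r *: m).
Proof.
apply: fseqP => j; rewrite scale_delta mulr1 -[i r]mul1r rcoefMr.
rewrite -[1](expr0 x) rcoefXn ideltaE.
by case: eqP; rewrite ?mul1r ?mul0r ?scale0r.
Qed.

Lemma ideltaD n m m' : idelta n (m + m') = idelta n m + idelta n m'.
Proof. by apply: fseqP => j; rewrite fseqD !ideltaE; case: eqP; rewrite ?addr0. Qed.

Lemma induced_sum (f : Ind) N : fbounded f N -> f = \sum_(j < N) x ^+ j *: idelta 0 (f j).
Proof.
move=> fN; apply: fseqP => j; rewrite fseq_sum.
under eq_bigr do rewrite scaleXn_delta ideltaE.
have [jN|Nj] := ltnP j N.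
  rewrite (bigD1 (Ordinal jN)) //= eqxx big1 ?addr0 // => l lj.
  by rewrite eq_sym (_ : (_ == _) = false) //; apply/negbTE.
rewrite fN // big1 // => l _.
by rewrite gtn_eqF // (leq_trans (ltn_ord l)).
Qed.

Variable N : lmodType A.
Variable g : {linear M -> restr N i}.

(** The adjunction between induction and restriction. *)
Definition extend (f : Ind) : N := \sum_(j < fbound f) x ^+ j *: (g (f j) : N).

Lemma extendE (f : Ind) B : fbounded f B -> extend f = \sum_(j < B) x ^+ j *: (g (f j) : N).
Proof.
move=> fB; apply: (sum_fbounded (G := fun l m => x ^+ l *: (g m : N))) => //.
  by move=> l; rewrite raddf0 -[X in _ *: X]/(0 : N) scaler0.
exact: fboundP.
Qed.

Fact extendD f f' : extend (f + f') = extend f + extend f'.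
Proof.
have [B fB] := fseq_bounded f; have [B' fB'] := fseq_bounded f'.
have fm : fbounded f (maxn B B') := fboundedW (leq_maxl _ _) fB.
have gm : fbounded f' (maxn B B') := fboundedW (leq_maxr _ _) fB'.
have fgm : fbounded (f + f' : Ind) (maxn B B').
  by move=> l ml; rewrite inducedD fm // gm // addr0.
rewrite (extendE fm) (extendE gm) (extendE fgm) -big_split.
by apply: eq_bigr => l _; rewrite inducedD raddfD -[X in _ *: X]/(_ + _) scalerDr.
Qed.

Fact extend_linear : linear extend.
Proof.
move=> p f f'; rewrite extendD; congr (_ + _).
have [B fB] := fseq_bounded f; have [B' fB'] := fseq_bounded (p *: f).
have /choice [C CP] : forall l, exists N, fbounded (rcoef^~ (p * x ^+ l)) N.
  by move=> l; apply: rcoef_bounded.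
pose m := maxn B' (\max_(l < B) C l).
have gm : fbounded (p *: f : Ind) m := fboundedW (leq_maxl _ _) fB'.
rewrite (extendE gm) (extendE fB) scaler_sumr.
under eq_bigr do rewrite (induced_scaleE _ _ fB) raddf_sum scaler_sumr.
rewrite exchange_big /=; apply: eq_bigr => l _.
under eq_bigr do rewrite linearZZ restr_scaleE scalerA.
rewrite -scaler_suml rcoef_sum ?scalerA // => t mt.
apply: CP; apply: leq_trans mt; apply: leq_trans (leq_maxr _ _).
exact: (leq_bigmax (F := fun l : 'I_B => C l)).
Qed.

Lemma extend_delta n m : extend (idelta n m) = x ^+ n *: (g m : N).
Proof.
rewrite (@extendE (idelta n m) n.+1 (@idelta_bounded n m)) big_ord_recr /=
  /idelta_fun eqxx.
rewrite big1 ?add0r // => l _.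
by rewrite (ltn_eqF (ltn_ord l)) raddf0 -[X in _ *: X]/(0 : N) scaler0.
Qed.

End Induced.
End RightCoefficients.

Lemma oev_sum (R A : nzRingType) (i : {rmorphism R -> A}) (x : A) (p : {poly R}) n :
  (size p <= n)%N -> oev i x p = \sum_(j < n) i p`_j * x ^+ j.
Proof.
move=> pn; rewrite /oev (@horner_coef_wide _ n).
  by apply: eq_bigr => j _; rewrite coef_map.
exact: leq_trans (size_poly _ _) pn.
Qed.

(** * Projective dimension over an Ore extension *)

Section OreInduction.
Variables (R A : nzRingType) (i : {rmorphism R -> A}) (x : A) (s d : R -> R).
Hypothesis ore : ore_ext i x s d.

Lemma ore_right_basis : right_basis i x.
Proof.
have [s' [d' orec]] := ore_conv ore; split.
- move=> w; have [p pE] := ore_span orec w.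
  exists (fun j => p`_j), (size p); split; first by move=> j; apply: nth_default.
  rewrite pE (oev_sum _ _ (leqnn _)); apply: eq_bigr => j _.
  by rewrite exprc.
- move=> c N E j jN; pose p : {poly R^c} := \poly_(j < N) (c j : R^c).
  have pN : (size p <= N)%N := size_poly _ _.
  have : p = 0.
    apply: (ore_inj orec); rewrite (oev_sum _ _ pN) -[RHS]E; apply: eq_bigr => l _.
    by rewrite exprc coef_poly ltn_ord.
  by move/(congr1 (fun q : {poly R^c} => q`_j)); rewrite coef_poly jN coef0.
Qed.

Lemma ore_lin_inj a b a' b' : i a * x + i b = i a' * x + i b' -> a = a'.
Proof.
move/eqP; rewrite -subr_eq0 opprD addrACA -mulrBl -!rmorphB => /eqP E.
apply/eqP; rewrite -subr_eq0; apply/eqP; apply: (odeg_lead ore (n := 1)).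
rewrite expr1; have /eqP := E; rewrite addr_eq0 => /eqP ->; apply: odegN.
by have := @odegX _ _ i x 0 (b - b'); rewrite mulr1.
Qed.

Lemma ore_sB : zmod_morphism s.
Proof.
move=> r r'; apply: (@ore_lin_inj _ (d (r - r')) _ (d r - d r')).
by rewrite -(ore_rel ore) !rmorphB mulrBl mulrBr !(ore_rel ore) opprD addrACA.
Qed.

Lemma ore_sM : monoid_morphism s.
Proof.
split=> [|r r'].
  apply: (@ore_lin_inj _ (d 1) _ 0).
  by rewrite -(ore_rel ore) rmorph1 rmorph0 mulr1 mul1r addr0.
apply: (@ore_lin_inj _ (d (r * r')) _ (s r * d r' + d r * r')).
rewrite -(ore_rel ore) rmorphD !rmorphM mulrA (ore_rel ore) mulrDl.
by rewrite -mulrA (ore_rel ore) mulrDr !mulrA addrA.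
Qed.

(** The inverse of the twist is a ring morphism, and moving coefficients to the right is governed
    by it. *)
Lemma ore_inverse : exists t : {rmorphism R -> R},
  forall r, i r * x = x * i (t r) - i (d (t r)).
Proof.
have [t st ts] := ore_bij ore; have s_inj := can_inj st.
have tB : zmod_morphism t by move=> r r'; apply: s_inj; rewrite ore_sB !ts.
have tM : monoid_morphism t.
  by split=> [|r r']; apply: s_inj; rewrite ?ore_sM.1 ?ore_sM.2 !ts.
pose ta := GRing.isZmodMorphism.Build R R t tB.
pose tm := GRing.isMonoidMorphism.Build R R t tM.
exists (HB.pack t ta tm : {rmorphism R -> R}) => r /=.
by rewrite (ore_rel ore) ts addrK.
Qed.

Let xb := ore_right_basis.
Local Notation Ind M := (induced M xb : lmodType A).

(** Induction is left adjoint to restriction, which preserves surjections. *)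
Lemma projective_induced (P : lmodType R) : projective P -> projective (Ind P).
Proof.
move=> Pp M N p f ps.
have pL : linear (fun m : restr M i => p m : restr N i).
  by move=> r m m'; rewrite restr_scaleE linearP.
have fL : linear (fun m : P => f (idelta xb 0 m) : restr N i).
  by move=> r m m'; rewrite ideltaD -scalei_delta linearP.
have [g gE] := Pp _ _ (mk_linear pL) (mk_linear fL) ps.
exists (mk_linear (@extend_linear _ _ _ _ xb _ _ g)) => v /=.
have [B vB] := fseq_bounded v; rewrite (extendE _ vB).
rewrite [in RHS](induced_sum vB) !raddf_sum; apply: eq_bigr => j _.
transitivity (x ^+ j *: p (g (v j))); first exact: (linearZZ p).
transitivity (x ^+ j *: f (idelta xb 0 (v j))); last exact/esym/(linearZZ f).
by congr (_ *: _); apply: gE.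
Qed.

Fact induced_map_bounded (M N : lmodType R) (h : {linear M -> N}) (f : Ind M) :
  fbounded (fun j => h (f j)) (fbound f).
Proof. by move=> j jB; rewrite (@fboundP _ (f : fseq M) j jB) raddf0. Qed.

Definition induced_map (M N : lmodType R) (h : {linear M -> N}) (f : Ind M) : Ind N :=
  mk_fseq (@induced_map_bounded M N h f).

Lemma induced_mapE (M N : lmodType R) (h : {linear M -> N}) (f : Ind M) j :
  induced_map h f j = h (f j).
Proof. by []. Qed.

Lemma induced_map_linear (M N : lmodType R) (h : {linear M -> N}) :
  linear (induced_map h).
Proof.
move=> p f f'; apply: fseqP => j.
rewrite inducedD !induced_mapE inducedD raddfD; congr (_ + _).
have [B fB] := fseq_bounded f; rewrite (induced_scaleE _ _ fB).
have hB : fbounded (induced_map h f) B by move=> l Bl; rewrite /= fB // raddf0.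
rewrite (induced_scaleE _ _ hB) raddf_sum; apply: eq_bigr => l _.
exact: (linearZZ h).
Qed.

Lemma induced_image (M N : lmodType R) (h : {linear M -> N}) (f : Ind N) :
  (forall j, exists y, h y = f j) -> exists f' : Ind M, induced_map h f' = f.
Proof.
move=> H; have [B fB] := fseq_bounded f.
have /choice [y yE] : forall j, exists y, h y = f j /\ ((B <= j)%N -> y = 0).
  move=> j; have [jB|Bj] := ltnP j B.
    by have [y yE] := H j; exists y; rewrite yE.
  by exists 0; rewrite raddf0 fB.
have yB : fbounded y B by move=> j /(yE j).2.
by exists (mk_fseq yB); apply: fseqP => j; have [] := yE j.
Qed.

Lemma induced_resolution (M : lmodType R) n :
  has_projective_resolution M n -> has_projective_resolution (Ind M) n.
Proof.
move=> [P [dP [eP [Pp Pn P1 P2 P3]]]].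
exists (fun j => Ind (P j)), (fun j => mk_linear (induced_map_linear (dP j))),
  (mk_linear (induced_map_linear eP)).
have eq_at (N : lmodType R) (f f' : Ind N) : f = f' -> forall j, f j = f' j.
  by move=> ->.
split.
- by move=> j; apply: projective_induced.
- by move=> j jn f; apply: fseqP => l; rewrite (Pn j jn (f l)).
- by move=> f; apply: induced_image.
- move=> f; split=> [/eq_at f0|[g <-]].
    by apply: induced_image => j; apply/P2; have := f0 j.
  by apply: fseqP => j; apply/P2; exists (g j).
- move=> l f; split=> [/eq_at f0|[g <-]].
    by apply: induced_image => j; apply/P3; have := f0 j.
  by apply: fseqP => j; apply/P3; exists (g j).
Qed.

(** For a module [M] over [A] there is an exact sequence 0 -> Ind M1 -> Ind M0 -> M -> 0, where
    [M0] is the restriction of [M] and [M1] is that restriction twisted by the inverse of [s]; the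
    first map sends 1 tensor [m] to [x] tensor [m] minus 1 tensor [x m], and the twist is what
    makes it linear. Induction is exact, so both outer terms have resolutions of length [n]. *)
Lemma ore_projective_resolution n :
  (forall M : lmodType R, has_projective_resolution M n) ->
  forall M : lmodType A, has_projective_resolution M n.+1.
Proof.
move=> Rn M; have [t tE] := ore_inverse.
pose M0 : lmodType R := restr M i.
pose M1 : lmodType R := restr M (i \o t).
have gL : linear (fun m : M1 => x *: idelta xb 0 (m : M0) - idelta xb 0 (x *: (m : M) : M0)
                    : restr (Ind M0) i).
  move=> r m m'; rewrite !restr_scaleE /=.
  rewrite [i r *: _]scalerBr scalerA tE.
  rewrite ideltaD scalerDr [x *: (_ + _)]scalerDr ideltaD opprD addrACA; congr (_ + _).
  rewrite scalerBl -!scalerA.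
  have -> : idelta xb 0 (i (t r) *: (m : M) : M0) = i (t r) *: idelta xb 0 (m : M0).
    by rewrite scalei_delta.
  have -> : idelta xb 0 (x *: (i (t r) *: (m : M)) : M0) =
      i r *: idelta xb 0 (x *: (m : M) : M0) + i (d (t r)) *: idelta xb 0 (m : M0).
    rewrite !scalei_delta -ideltaD; congr idelta.
    rewrite -[RHS]/(i r *: (x *: (m : M)) + i (d (t r)) *: (m : M)).
    by rewrite !scalerA -scalerDl tE subrK.
  by rewrite opprD addrA addrAC.
pose phi : {linear Ind M1 -> Ind M0} := mk_linear (extend_linear (mk_linear gL)).
have idL : linear (fun m : M0 => m : restr M i) by [].
pose mu : {linear Ind M0 -> M} := mk_linear (extend_linear (mk_linear idL)).
have phiE (f : Ind M1) N : fbounded f N -> phi f =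
    \sum_(j < N) (idelta xb j.+1 (f j : M0) - idelta xb j (x *: (f j : M) : M0)).
  move=> fN; rewrite /phi /= (extendE _ fN); apply: eq_bigr => j _ /=.
  by rewrite scalerBr scalerA -exprSr !scaleXn_delta.
have phi0 (f : Ind M1) : phi f 0%N = - (x *: (f 0%N : M)) :> M.
  have [N fN] := fseq_bounded f.
  have fN' : fbounded f N.+1 by move=> l Nl; apply: fN; apply: leq_trans Nl.
  rewrite (phiE f _ fN') fseq_sum big_ord_recl /= big1 => [|j _].
    by rewrite addr0; apply: (@sub0r M).
  exact: (@subrr M 0).
have phiS (f : Ind M1) j : phi f j.+1 = (f j : M) - x *: (f j.+1 : M) :> M.
  have [N fN] := fseq_bounded f.
  have fN' : fbounded f (maxn N j.+2).
    by move=> l; rewrite geq_max => /andP [? _]; apply: fN.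
  have j1 : (j.+1 < maxn N j.+2)%N by rewrite leq_max ltnSn orbT.
  have j0 : (j < maxn N j.+2)%N by apply: ltnW.
  rewrite (phiE f _ fN') sumrB -[LHS]/((_ : Ind M0) j.+1 + (- (_ : Ind M0)) j.+1).
  rewrite fseqN !fseq_sum; congr (_ - _).
    rewrite (bigD1 (Ordinal j0)) // ideltaE eqxx big1 => [|l lj]; first exact: (@addr0 M).
    by rewrite ideltaE eqSS eq_sym (_ : (_ == _) = false) //; apply/negbTE.
  rewrite (bigD1 (Ordinal j1)) // ideltaE eqxx big1 => [|l lj]; first exact: (@addr0 M).
  by rewrite ideltaE eq_sym (_ : (_ == _) = false) //; apply/negbTE.
have muE (f : Ind M0) N : fbounded f N -> mu f = \sum_(j < N) x ^+ j *: (f j : M).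
  by move=> fN; rewrite /mu /= (extendE _ fN).
apply: (@has_projective_resolution_coker A (Ind M0) (Ind M1) M phi mu).
- move=> f f0; have [N fN] := fseq_bounded f.
  have H j : f j = x *: (f j.+1 : M) :> M.
    apply/eqP; rewrite -subr_eq0; apply/eqP.
    by rewrite -phiS f0.
  apply: fseqP => j; rewrite fseq0.
  have : fbounded f 0.
    elim: N fN => // N IHN fN; apply: IHN => l.
    rewrite leq_eqVlt => /orP [/eqP <-|]; last exact: fN.
    by rewrite H fN // -[X in _ *: X]/(0 : M) scaler0.
  by apply.
- move=> m; exists (idelta xb 0 (m : M0)).
  by rewrite /mu /= extend_delta scale1r.
- move=> f; split=> [f0|[e <-]].
    have [N fN] := fseq_bounded f.
    pose e j : M1 := \sum_(l < N | (j < l)%N) x ^+ (l - j.+1) *: (f l : M).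
    have eN : fbounded e N.
      move=> j Nj; rewrite /e big1 // => l jl.
      by have := leq_trans (leq_trans jl (ltnW (ltn_ord l))) Nj; rewrite ltnn.
    exists (mk_fseq eN); apply: fseqP => -[|j].
      rewrite phi0 /= /e scaler_sumr.
      have := muE f N fN; rewrite f0.
      case: N fN e eN => [fN _ _ _|N fN e eN].
        by rewrite big_ord0 oppr0 fN.
      rewrite big_ord_recl expr0 scale1r => /esym/eqP.
      rewrite addr_eq0 => /eqP ->; congr (- _).
      rewrite big_mkcond big_ord_recl /= add0r; apply: eq_bigr => l _.
      by rewrite scalerA -exprS /bump /= add1n subn1.
    rewrite phiS /= /e scaler_sumr.
    have [jN|Nj] := ltnP j.+1 N; last first.
      rewrite fN // !big1 ?subrr // => l jl.
        by have := leq_trans (ltn_ord l) Nj; rewrite ltnNge (ltnW jl).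
      by have := leq_trans (ltn_ord l) Nj; rewrite ltnNge jl.
    rewrite (bigD1 (Ordinal jN)) //= subnn scale1r -addrA.
    rewrite [X in _ + X](_ : _ = 0); first exact: (@addr0 M).
    apply/eqP; rewrite subr_eq0; apply/eqP.
    apply: eq_big => [l|l /andP [jl lj]].
      by rewrite [RHS]ltn_neqAle andbC eq_sym.
    rewrite scalerA -exprS -subSn // ltn_neqAle jl andbT eq_sym //.
  have [N eN] := fseq_bounded e.
  rewrite (phiE e N eN) raddf_sum big1 // => j _.
  rewrite raddfB /mu /= !extend_delta /= exprSr -scalerA subrr //.
- exact/induced_resolution/Rn.
- exact/induced_resolution/Rn.
Qed.

End OreInduction.

(** * Division rings *)

Section DivisionRing.
Variable D : nzRingType.
Hypothesis Dinv : forall a : D, a != 0 -> exists b, b * a = 1.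

Section Lift.
Variables (P M N : lmodType D) (p : {linear M -> N}) (f : {linear P -> N}).
Hypothesis ps : forall y, exists x, p x = y.

(** Graphs of linear maps from subspaces of [P] that lift [f]; Zorn's lemma applies to them, and a
    maximal one is defined everywhere, as a vector outside its domain could be added to it,
    nonzero scalars being invertible. *)
Definition partial_lift : set (set (P * M)) := [set G |
  [/\ forall a v w, G v -> G w -> G (a *: v + w),
      forall v, G v -> p v.2 = f v.1 &
      forall v, G v -> v.1 = 0 -> v.2 = 0]].

Lemma maximal_partial_lift :
  exists A, partial_lift A /\ forall B, A `<` B -> ~ partial_lift B.
Proof.
apply: Zorn_bigcup => F FP Ftot; split.
- move=> a v w [X FX Xv] [Y FY Yw].
  have [XY|YX] := Ftot _ _ FX FY.
    by exists Y => //; have [H _ _] := FP _ FY; apply: H => //; apply: XY.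
  by exists X => //; have [H _ _] := FP _ FX; apply: H => //; apply: YX.
- by move=> v [X FX Xv]; have [_ H _] := FP _ FX; apply: H.
- by move=> v [X FX Xv]; have [_ _ H] := FP _ FX; apply: H.
Qed.

Lemma linear_lift_exists : exists f' : {linear P -> M}, forall x, p (f' x) = f x.
Proof.
have [A [[Alin Acomp Afun] Amax]] := maximal_partial_lift.
have A00 : A (0, 0).
  apply: contrapT => A0; apply: (Amax [set (0, 0)]).
    split; last by move=> H; apply: A0; apply: H.
    move=> v Av; case: A0; have := Alin (-1) v v Av Av.
    by rewrite scaleN1r addNr.
  split.
  - by move=> a v w -> ->; rewrite scaler0 addr0.
  - by move=> v ->; rewrite !raddf0.
  - by move=> v ->.
have AZ a v : A v -> A (a *: v) by move=> Av; rewrite -[_ *: _]addr0; apply: Alin.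
have AD v w : A v -> A w -> A (v + w).
  by move=> Av Aw; rewrite -[v]scale1r; apply: Alin.
have total x : exists m, A (x, m).
  apply: contrapT => xA; have [m mE] := ps (f x).
  pose B : set (P * M) := [set v | exists2 w, A w & exists b : D, v = w + b *: (x, m)].
  apply: (Amax B).
    split; last first.
      move=> /(_ (x, m)) BA; apply: xA; exists m; apply: BA.
      by exists (0, 0) => //; exists 1; rewrite scale1r -[RHS]/(_, _) /= !add0r.
    by move=> v Av; exists v => //; exists 0; rewrite scale0r addr0.
  split.
  - move=> a _ _ [v Av [b ->]] [w Aw [c ->]]; exists (a *: v + w); first exact: Alin.
    by exists (a * b + c); rewrite scalerDr scalerDl scalerA addrACA.
  - move=> _ [w Aw [b ->]] /=.
    rewrite -[LHS]/(p (w.2 + b *: m)) -[RHS]/(f (w.1 + b *: x)).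
    by rewrite !raddfD /= !linearZ /= mE (Acomp _ Aw).
  - move=> _ [w Aw [b ->]] /= E.
    have b0 : b = 0.
      apply/eqP; apply: contrapT => /negP b0; have [c cb] := Dinv b0.
      apply: xA; exists (- c *: w.2).
      have := AZ (- c) w Aw; congr A; rewrite [LHS]surjective_pairing /=.
      congr (_, _); move/eqP: E; rewrite addr_eq0 => /eqP ->.
      by rewrite scalerN scaleNr opprK scalerA cb scale1r.
    move: E; rewrite b0 !scale0r !addr0; exact: Afun.
have /choice [g gA] := total.
have guniq x m : A (x, m) -> m = g x.
  move=> Axm; apply/eqP; rewrite -subr_eq0; apply/eqP.
  apply: (Afun ((x, m) - (x, g x))); last by rewrite /= subrr.
  by apply: AD => //; rewrite -scaleN1r; apply: AZ.
have gL : linear g.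
  by move=> a x y; apply/esym/guniq; apply: (Alin a (x, g x) (y, g y)).
by exists (mk_linear gL) => x /=; rewrite (Acomp _ (gA x)).
Qed.

End Lift.

Lemma division_ring_projective (P : lmodType D) : projective P.
Proof. by move=> M N p f ps; apply: linear_lift_exists. Qed.

Lemma division_ring_resolution (M : lmodType D) : has_projective_resolution M 0.
Proof.
exists (fun i => if i is 0 then M else ('rV[D]_0 : lmodType D)).
exists (fun i => \0), idfun.
have z (v : 'rV[D]_0) : v = 0 := thinmx0 v.
split.
- by move=> i; apply: division_ring_projective.
- by move=> [|i] // _ x; apply: z.
- by move=> y; exists y.
- by move=> x; split=> [/= ->|[y <-]//]; exists 0.
- by move=> [|i] x; split=> // _; exists 0; rewrite [RHS]z.
Qed.

Lemma division_ring_left_noetherian : left_noetherian D.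
Proof.
move=> I Iid Iasc.
have Imono m m' w : (m <= m')%N -> I m w -> I m' w.
  elim: m' => [|m' IH]; first by rewrite leqn0 => /eqP ->.
  by rewrite leq_eqVlt => /orP [/eqP -> //|/IH H] /H; apply: Iasc.
have [[N [a [Ia a0]]]|H] := pselect (exists N a, I N a /\ a != 0).
  exists N => n Nn; have [b ba] := Dinv a0.
  have full m x : (N <= m)%N -> I m x.
    move=> Nm; rewrite -[x]mulr1 -ba mulrA; have [_ _ IM] := Iid m.
    by apply: IM; apply: Imono Ia.
  by apply/seteqP; split=> x _; apply: full.
exists 0%N => n _; apply/seteqP; split=> x Ix.
  have -> : x = 0.
    by apply/eqP; apply: contrapT => /negP x0; apply: H; exists n, x.
  by have [] := Iid 0%N.
by apply: Imono Ix.
Qed.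

Lemma division_ring_domain : is_domain D.
Proof.
move=> x y xy; have [x0|x0] := eqVneq x 0; first by left.
by right; have [b bx] := Dinv x0; rewrite -[y]mul1r -bx -mulrA xy mulr0.
Qed.

End DivisionRing.

(** * Skew polynomial rings *)

Record skew_data (R : nzRingType) := SkewData {
  sk_s : {rmorphism R -> R};
  sk_d : {additive R -> R};
  sk_dM : forall r r', sk_d (r * r') = sk_s r * sk_d r' + sk_d r * r' }.

Section SkewPolynomials.
Variables (R : nzRingType) (D : skew_data R).
Local Notation s := (sk_s D).
Local Notation d := (sk_d D).
Implicit Types p q w : {poly R}.

(** Left multiplication by the variable, as the additive operator that the relation [x r = s r x +
    d r] forces on ordinary polynomials; products are then built from its iterates. *)
Definition skew_X p : {poly R} := map_poly s p * 'X + map_poly d p.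

Definition skew_mul p q : {poly R} := \sum_(j < size p) p`_j *: iter j skew_X q.

Lemma skew_XD p q : skew_X (p + q) = skew_X p + skew_X q.
Proof. by rewrite /skew_X !raddfD /= mulrDl addrACA. Qed.

Lemma skew_X0 : skew_X 0 = 0.
Proof. by rewrite /skew_X !raddf0 mul0r addr0. Qed.

Lemma skew_XZ r p : skew_X (r *: p) = s r *: skew_X p + d r *: p.
Proof.
apply/polyP => j; rewrite /skew_X !(coefD, coefZ, coefMX, coef_map).
case: j => [|j] /=; first by rewrite sk_dM add0r mulrDr mulr0 add0r.
by rewrite sk_dM rmorphM mulrDr addrA.
Qed.

Lemma iter_skew_XD n p q : iter n skew_X (p + q) = iter n skew_X p + iter n skew_X q.
Proof. by elim: n => //= n ->; rewrite skew_XD. Qed.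

Lemma sk_d1 : d 1 = 0.
Proof.
have := sk_dM D 1 1; rewrite mulr1 rmorph1 mul1r mulr1 => /eqP.
by rewrite -subr_eq subrr eq_sym => /eqP.
Qed.

Lemma iter_skew_X1 n : iter n skew_X 1 = 'X^n.
Proof.
elim: n => [|n IHn]; first by rewrite expr0.
rewrite /= IHn /skew_X exprSr map_polyXn; apply/polyP => j.
rewrite coefD coef_map coefXn /=.
by case: (_ == _); rewrite ?mulr1n ?mulr0n ?sk_d1 ?raddf0 addr0.
Qed.

Lemma skew_mul_wide n p q : (size p <= n)%N ->
  skew_mul p q = \sum_(j < n) p`_j *: iter j skew_X q.
Proof.
move=> pn; rewrite /skew_mul (big_ord_widen _ (fun j => p`_j *: iter j skew_X q) pn).
rewrite big_mkcond; apply: eq_bigr => j _; case: ltnP => // pj.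
by rewrite nth_default // scale0r.
Qed.

Lemma skew_mulDl p p' q : skew_mul (p + p') q = skew_mul p q + skew_mul p' q.
Proof.
pose n := maxn (size p) (size p').
rewrite !(@skew_mul_wide n) ?leq_maxl ?leq_maxr ?size_polyD //.
by rewrite -big_split; apply: eq_bigr => j _; rewrite coefD scalerDl.
Qed.

Lemma skew_mul0l q : skew_mul 0 q = 0.
Proof. by rewrite /skew_mul size_poly0 big_ord0. Qed.

Lemma skew_mulDr p q q' : skew_mul p (q + q') = skew_mul p q + skew_mul p q'.
Proof.
by rewrite -big_split; apply: eq_bigr => j _; rewrite iter_skew_XD scalerDr.
Qed.

Lemma skew_mulZl r p q : skew_mul (r *: p) q = r *: skew_mul p q.
Proof.
rewrite (skew_mul_wide _ (size_scale_leq _ _)) scaler_sumr.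
by apply: eq_bigr => j _; rewrite coefZ scalerA.
Qed.

Lemma skew_mulXn n q : skew_mul 'X^n q = iter n skew_X q.
Proof.
rewrite /skew_mul size_polyXn big_ord_recr /= coefXn eqxx scale1r.
rewrite big1 ?add0r // => j _.
by rewrite coefXn (ltn_eqF (ltn_ord j)) scale0r.
Qed.

Lemma skew_mul_suml n (F : 'I_n -> {poly R}) q :
  skew_mul (\sum_(j < n) F j) q = \sum_(j < n) skew_mul (F j) q.
Proof. exact: (big_morph (skew_mul^~ q) (fun p p' => skew_mulDl p p' q) (skew_mul0l q)). Qed.

Lemma skew_X_sum n (F : 'I_n -> {poly R}) :
  skew_X (\sum_(j < n) F j) = \sum_(j < n) skew_X (F j).
Proof. exact: (big_morph _ skew_XD skew_X0). Qed.

Lemma polyE p : p = \sum_(j < size p) p`_j *: 'X^j.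
Proof. by rewrite -poly_def coefK. Qed.

(** Left multiplication by the variable commutes with right multiplications, which is the heart of
    associativity. *)
Lemma skew_mul_X p q : skew_mul (skew_X p) q = skew_X (skew_mul p q).
Proof.
rewrite [p in LHS]polyE skew_X_sum skew_mul_suml skew_X_sum; apply: eq_bigr => j _.
rewrite !skew_XZ skew_mulDl !skew_mulZl skew_mulXn; congr (_ *: _ + _).
by rewrite -iter_skew_X1 -iterS iter_skew_X1 skew_mulXn.
Qed.

Lemma skew_mul_iter n p q : skew_mul (iter n skew_X p) q = iter n skew_X (skew_mul p q).
Proof. by elim: n => //= n IHn; rewrite skew_mul_X IHn. Qed.

Lemma skew_mulA p q w : skew_mul p (skew_mul q w) = skew_mul (skew_mul p q) w.
Proof.
rewrite [skew_mul p q]/skew_mul skew_mul_suml; apply: eq_bigr => j _.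
by rewrite skew_mulZl skew_mul_iter.
Qed.

Lemma skew_mul1l q : skew_mul 1 q = q.
Proof. by rewrite -[1](expr0 'X) skew_mulXn. Qed.

Lemma skew_mul1r p : skew_mul p 1 = p.
Proof.
by rewrite [RHS]polyE; apply: eq_bigr => j _; rewrite iter_skew_X1.
Qed.

Definition skewpoly & skew_data R : Type := {poly R}.
Local Notation S := (skewpoly D).
HB.instance Definition _ := GRing.Zmodule.on S.

Fact skew_oner_neq0 : (1 : {poly R}) != 0 :> S.
Proof. exact: oner_neq0. Qed.

HB.instance Definition _ := GRing.Zmodule_isNzRing.Build S
  (skew_mulA : associative (skew_mul : S -> S -> S)) skew_mul1l skew_mul1r
  (fun p q w => skew_mulDl p q w) (fun p q w => skew_mulDr p q w) skew_oner_neq0.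

Definition skew_const (r : R) : S := r%:P.
Definition skew_var : S := 'X.

Lemma skew_constE r p : skew_const r * (p : S) = r *: p.
Proof.
rewrite -[LHS]/(skew_mul r%:P p) -[r%:P]mulr1 mul_polyC skew_mulZl.
by rewrite skew_mul1l.
Qed.

Lemma skew_varE p : skew_var * (p : S) = skew_X p.
Proof. by rewrite -[LHS]/(skew_mul 'X p) -['X]expr1 skew_mulXn. Qed.

Fact skew_const_zmod : zmod_morphism skew_const.
Proof. by move=> r r'; rewrite /skew_const polyCB. Qed.
Fact skew_const_monoid : monoid_morphism skew_const.
Proof.
split=> // r r'; rewrite skew_constE -mul_polyC -polyCM //.
Qed.
HB.instance Definition _ := GRing.isZmodMorphism.Build R S skew_const skew_const_zmod.
HB.instance Definition _ := GRing.isMonoidMorphism.Build R S skew_const skew_const_monoid.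

Lemma skew_rel r : skew_var * skew_const r = skew_const (s r) * skew_var + skew_const (d r).
Proof.
rewrite skew_varE skew_constE /skew_X !map_polyC /= mul_polyC //.
Qed.

Lemma skew_varXn n : skew_var ^+ n = 'X^n :> {poly R}.
Proof.
elim: n => [|n IHn]; first by rewrite !expr0.
by rewrite exprS skew_varE IHn -iter_skew_X1 -iterS iter_skew_X1.
Qed.

Lemma skew_oev (p : {poly R}) : oev skew_const skew_var p = p.
Proof.
elim/poly_ind: p => [|p r IHp]; first by rewrite oev0.
rewrite oevD oevMX oevC IHp; congr (_ + _).
rewrite -[LHS]/(skew_mul p 'X) /skew_mul [in RHS](polyE p) mulr_suml.
apply: eq_bigr => j _.
rewrite -scalerAl -exprSr; congr (_ *: _).
by rewrite -[in LHS](expr1 'X) -iter_skew_X1 -iterD addn1 iter_skew_X1.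
Qed.

Lemma skew_ore : bijective s -> ore_ext skew_const skew_var s d.
Proof.
move=> s_bij; split=> //.
- exact: skew_rel.
- by move=> w; exists w; rewrite skew_oev.
- by move=> p; rewrite skew_oev.
Qed.

(** Universal property: a morphism on coefficients and an image of the variable that satisfies the
    commutation relation extend to skew polynomials. *)
Section Universal.
Variables (B : nzRingType) (phi : {rmorphism R -> B}) (y : B).
Hypothesis phi_rel : forall r, y * phi r = phi (s r) * y + phi (d r).

Definition skew_lift (p : S) : B := oev phi y p.

Lemma skew_liftZ r p : oev phi y (r *: p) = phi r * oev phi y p.
Proof. by rewrite -mul_polyC oevCM. Qed.

Lemma skew_lift_X p : oev phi y (skew_X p) = y * oev phi y p.
Proof.
elim/poly_ind: p => [|p r IHp]; first by rewrite skew_X0 !oev0 mulr0.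
rewrite skew_XD oevD [in RHS]oevD mulrDr; congr (_ + _).
  rewrite [in RHS]oevMX mulrA -IHp -oevMX; congr (oev _ _ _).
  rewrite /skew_X mulrDl rmorphM /= map_polyX; congr (_ + _); apply/polyP => -[|j].
    by rewrite coef_map !coefMX raddf0.
  by rewrite coef_map !coefMX coef_map.
rewrite /skew_X !map_polyC /= oevD oevMX !oevC phi_rel //.
Qed.

Fact skew_lift_zmod : zmod_morphism skew_lift.
Proof. by move=> p q; rewrite /skew_lift oevD oevN. Qed.

Fact skew_lift_monoid : monoid_morphism skew_lift.
Proof.
split=> [|p q]; first by rewrite /skew_lift -[1]/(1%:P) oevC rmorph1.
rewrite /skew_lift -[p * q]/(skew_mul p q) /skew_mul.
rewrite (big_morph (oev phi y) (oevD phi y) (oev0 phi y)).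
rewrite [in RHS](polyE p) (big_morph (oev phi y) (oevD phi y) (oev0 phi y)).
rewrite mulr_suml; apply: eq_bigr => j _; rewrite !skew_liftZ -mulrA; congr (_ * _).
rewrite -[X in oev _ _ X * _]mul1r oevMXn -[1]/(1%:P) oevC rmorph1 mul1r.
elim: (nat_of_ord j) => [|n IHn]; first by rewrite expr0 mul1r.
by rewrite /= skew_lift_X IHn exprS mulrA.
Qed.

HB.instance Definition _ := GRing.isZmodMorphism.Build S B skew_lift skew_lift_zmod.
HB.instance Definition _ := GRing.isMonoidMorphism.Build S B skew_lift skew_lift_monoid.

Definition skew_morph : {rmorphism S -> B} := skew_lift.

Lemma skew_morph_const r : skew_morph (skew_const r) = phi r.
Proof. exact: oevC. Qed.

Lemma skew_morph_var : skew_morph skew_var = y.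
Proof. by rewrite -[LHS]/(oev phi y 'X) -['X]mul1r oevMX -[1]/(1%:P) oevC rmorph1 mul1r. Qed.

End Universal.
End SkewPolynomials.

Section SkewExt.
Variables (R : nzRingType) (D : skew_data R) (B : nzRingType).

Lemma skew_ext (F G : {rmorphism skewpoly D -> B}) :
  (forall r, F (skew_const D r) = G (skew_const D r)) ->
  F (skew_var D) = G (skew_var D) -> F =1 G.
Proof.
move=> FGc FGv p; rewrite -[p]skew_oev /oev horner_coef !rmorph_sum.
apply: eq_bigr => j _; rewrite !rmorphM !rmorphXn FGv; congr (_ * _).
by rewrite coef_map FGc.
Qed.

End SkewExt.

(** Pairs multiply like the triangular matrices with rows [(s p, q)] and [(0, p)]. A ring morphism
    with first component the identity has for second component a skew derivation, so that the
    universal property of skew polynomials can be used to construct skew derivations. *)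
Section TwistedPairs.
Variables (P : nzRingType) (s : {rmorphism P -> P}).

Definition tpair & {rmorphism P -> P} : Type := (P * P)%type.
Local Notation T := (tpair s).
HB.instance Definition _ := GRing.Zmodule.on T.

Definition tmul (x y : T) : T := (x.1 * y.1, s x.1 * y.2 + x.2 * y.1).
Definition tone : T := (1, 0).

Fact tmulA : associative tmul.
Proof.
move=> x y z; rewrite /tmul /= !mulrA rmorphM; congr (_, _).
by rewrite mulrDr mulrDl !mulrA addrA.
Qed.
Fact tmul1 : left_id tone tmul.
Proof. by move=> [x y]; rewrite /tmul /= rmorph1 !mul1r mul0r addr0. Qed.
Fact tmulr1 : right_id tone tmul.
Proof. by move=> [x y]; rewrite /tmul /= !mulr1 mulr0 add0r. Qed.
Fact tmulDl : left_distributive tmul +%R.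
Proof.
move=> x y z; rewrite /tmul -[RHS]/(_, _) /= !mulrDl rmorphD !mulrDl.
by rewrite [X in (_, X)]addrACA.
Qed.
Fact tmulDr : right_distributive tmul +%R.
Proof.
move=> x y z; rewrite /tmul -[RHS]/(_, _) /= !mulrDr.
by rewrite [X in (_, X)]addrACA.
Qed.
Fact tone_neq0 : tone != 0.
Proof. by apply/eqP => -[] /eqP; rewrite oner_eq0. Qed.

HB.instance Definition _ := GRing.Zmodule_isNzRing.Build T
  tmulA tmul1 tmulr1 tmulDl tmulDr tone_neq0.

Lemma tmulE (x y : T) : x * y = (x.1 * y.1, s x.1 * y.2 + x.2 * y.1).
Proof. by []. Qed.

Definition tfst (x : T) : P := x.1.
Fact tfst_zmod : zmod_morphism tfst. Proof. by []. Qed.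
Fact tfst_monoid : monoid_morphism tfst. Proof. by []. Qed.
HB.instance Definition _ := GRing.isZmodMorphism.Build T P tfst tfst_zmod.
HB.instance Definition _ := GRing.isMonoidMorphism.Build T P tfst tfst_monoid.

Definition tsnd (x : T) : P := x.2.
Fact tsnd_zmod : zmod_morphism tsnd. Proof. by []. Qed.
HB.instance Definition _ := GRing.isZmodMorphism.Build T P tsnd tsnd_zmod.

End TwistedPairs.

(** * The model of the algebra *)

Section Euler.
Variable k : comNzRingType.
Local Notation R1 := {poly k}.
Local Notation R2 := {poly {poly k}}.

Definition euler1 (p : R1) : R1 := 'X * p^`().
Fact euler1_zmod : zmod_morphism euler1.
Proof. by move=> p q; rewrite /euler1 derivB mulrBr. Qed.
HB.instance Definition _ := GRing.isZmodMorphism.Build R1 R1 euler1 euler1_zmod.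

Lemma euler1M p q : euler1 (p * q) = p * euler1 q + euler1 p * q.
Proof. by rewrite /euler1 derivM; ring. Qed.

(** $c\partial_c+u\partial_u$, where [u] is the outer and [c] the inner variable. *)
Definition euler (p : R2) : R2 := 'X * p^`() + map_poly euler1 p.
Fact euler_zmod : zmod_morphism euler.
Proof. by move=> p q; rewrite /euler derivB raddfB mulrBr opprD addrACA. Qed.
HB.instance Definition _ := GRing.isZmodMorphism.Build R2 R2 euler euler_zmod.

Lemma map_derivationM (S : comNzRingType) (e : {additive S -> S}) :
  (forall x y, e (x * y) = x * e y + e x * y) ->
  forall p q : {poly S}, map_poly e (p * q) = p * map_poly e q + map_poly e p * q.
Proof.
move=> eM p q; apply/polyP => j; rewrite coefD coef_map !coefM /= raddf_sum -big_split.
by apply: eq_bigr => l _; rewrite eM !coef_map.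
Qed.

Lemma eulerM p q : euler (p * q) = p * euler q + euler p * q.
Proof. by rewrite /euler derivM (map_derivationM euler1M); ring. Qed.

Lemma eulerC (p : R1) : euler p%:P = (euler1 p)%:P.
Proof. by rewrite /euler derivC mulr0 add0r map_polyC. Qed.

Lemma eulerD p q : euler (p + q) = euler p + euler q.
Proof. exact: raddfD. Qed.

Lemma eulerN p : euler (- p) = - euler p.
Proof. exact: raddfN. Qed.
Lemma euler0 : euler 0 = 0.
Proof. exact: raddf0. Qed.

Lemma euler1_0 : euler1 1 = 0. Proof. by rewrite /euler1 derivC mulr0. Qed.

Lemma eulerX : euler 'X = 'X.
Proof.
rewrite /euler derivX mulr1; apply/polyP => j.
rewrite coefD coef_map coefX /=; case: (_ == _); rewrite ?euler1_0 ?raddf0 ?addr0 //.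
Qed.

Lemma euler1X : euler1 'X = 'X. Proof. by rewrite /euler1 derivX mulr1. Qed.

End Euler.

(** On $\Bbbk[c,u]$ the skew derivation $\delta$ has the form $\delta(r)=\delta_0(r)+\delta_1(r)a$
    with $\delta_1=2E$ and $\delta_0=(h+u)E+g(E^2-E)$; this is what $\delta(c)=c\gamma$,
    $\delta(u)=u\gamma$ and the twisted Leibniz rule force, the term in $E^2-E$ coming from $a$
    moving past a second factor. *)
Section DerivationIdentities.
Variables (S : comPzRingType) (e : S -> S) (g h u : S).
Hypothesis eD : forall x y, e (x + y) = e x + e y.
Hypothesis eN : forall x, e (- x) = - e x.
Hypothesis eM : forall x y, e (x * y) = x * e y + e x * y.
Hypotheses (eg : e g = h) (eu : e u = u).

Definition delta0 (r : S) : S := e r * (h + u) + g * (e (e r) - e r).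
Definition delta1 (r : S) : S := e r + e r.

Lemma delta0B r r' : delta0 (r - r') = delta0 r - delta0 r'.
Proof. by rewrite /delta0 !(eD, eN); ring. Qed.

Lemma delta1B r r' : delta1 (r - r') = delta1 r - delta1 r'.
Proof. by rewrite /delta1 !(eD, eN); ring. Qed.

Lemma delta0M r r' :
  delta0 (r * r') = r * delta0 r' + (delta0 r * r' + delta1 r * (g * e r')).
Proof. by rewrite /delta0 /delta1 !(eD, eM); ring. Qed.

Lemma delta1M r r' : delta1 (r * r') = r * delta1 r' + delta1 r * r'.
Proof. by rewrite /delta1 !(eD, eM); ring. Qed.

(** The compatibility of $\delta$ with $ar=ra+D(r)$, coefficient of $a^0$. *)
Lemma delta0_der r :
  delta0 (g * e r) = g * e (delta0 r) + h * delta0 r + (h - u) * (g * e r).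
Proof. by rewrite /delta0 !(eD, eN, eM) eg eu; ring. Qed.

(** The same compatibility, coefficient of $a^1$. *)
Lemma delta1_der r : delta1 (g * e r) = g * e (delta1 r) + h * delta1 r.
Proof. by rewrite /delta1 !(eD, eM) eg; ring. Qed.

End DerivationIdentities.

Section Model.
Variables (k : fieldType) (g : {poly k}).
Local Notation R2 := {poly {poly k}}.
Local Notation E := (@euler k).
Local Notation g2 := (g%:P : R2).
Definition h2 : R2 := (('X * g^`())%:P).
Local Notation u2 := ('X : R2).

Lemma euler_g : E g2 = h2. Proof. by rewrite eulerC. Qed.

Definition Dder (r : R2) : R2 := g2 * E r.
Fact Dder_zmod : zmod_morphism Dder.
Proof. by move=> p q; rewrite /Dder raddfB mulrBr. Qed.
HB.instance Definition _ := GRing.isZmodMorphism.Build R2 R2 Dder Dder_zmod.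
Fact DderM (r r' : R2) : Dder (r * r') = idfun r * Dder r' + Dder r * r'.
Proof. by rewrite /Dder eulerM /=; ring. Qed.

Definition Pdata : skew_data R2 := SkewData DderM.
Definition Palg : nzRingType := skewpoly Pdata.
Local Notation i2 := (skew_const Pdata : {rmorphism R2 -> Palg}).
Local Notation a2 := (skew_var Pdata : Palg).

Lemma Palg_rel (r : R2) : a2 * i2 r = i2 r * a2 + i2 (Dder r).
Proof. exact: skew_rel. Qed.

Fact shift_rel (t r : R2) :
  (a2 + i2 t) * i2 r = i2 (idfun r) * (a2 + i2 t) + i2 (Dder r).
Proof. by rewrite mulrDl mulrDr Palg_rel -!rmorphM mulrC addrAC. Qed.

(** The automorphism $a\mapsto a+t$; it exists because $\Bbbk[c,u]$ is commutative. *)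
Definition shift (t : R2) : {rmorphism Palg -> Palg} :=
  skew_morph (D := Pdata) (phi := i2) (shift_rel t).

Lemma shift_const t r : shift t (i2 r) = i2 r.
Proof. exact: skew_morph_const. Qed.
Lemma shift_var t : shift t a2 = a2 + i2 t.
Proof. exact: skew_morph_var. Qed.

Lemma shiftK t : cancel (shift t) (shift (- t)).
Proof.
move=> p; apply: (skew_ext (F := shift (- t) \o shift t) (G := idfun)) => [r|] /=.
  by rewrite !shift_const.
rewrite -[LHS]/(shift (- t) (shift t a2)) shift_var rmorphD /= shift_var shift_const.
by rewrite rmorphN addrNK.
Qed.

Definition sigma := shift h2.

Lemma sigma_bij : bijective sigma.
Proof.
exists (shift (- h2)); first exact: shiftK.
by move=> p; have := shiftK (- h2) p; rewrite opprK.
Qed.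

Definition d0 : R2 -> R2 := delta0 E g2 h2 u2.
Definition d1 : R2 -> R2 := delta1 E.

(** Degree 2 in [a] is as much as occurs in the verification of the relation for [delta]. *)
Definition quad (x y z : R2) : Palg := i2 x + i2 y * a2 + i2 z * a2 * a2.

Lemma quadD x y z x' y' z' :
  quad x y z + quad x' y' z' = quad (x + x') (y + y') (z + z').
Proof. by rewrite /quad !rmorphD !mulrDl addrACA; congr (_ + _); rewrite addrACA. Qed.

Lemma quadB x y z x' y' z' :
  quad x y z - quad x' y' z' = quad (x - x') (y - y') (z - z').
Proof.
rewrite -quadD; congr (_ + _).
by rewrite /quad !rmorphN !mulNr !opprD.
Qed.

Lemma quad0 : quad 0 0 0 = 0.
Proof. by rewrite /quad rmorph0 !mul0r !addr0. Qed.

Lemma quadMl r x y z : i2 r * quad x y z = quad (r * x) (r * y) (r * z).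
Proof. by rewrite /quad !mulrDr !rmorphM !mulrA. Qed.

Lemma quadMa x y : quad x y 0 * a2 = quad 0 x y.
Proof. by rewrite /quad rmorph0 !mul0r addr0 add0r mulrDl. Qed.

Lemma quadaM x y : a2 * quad x y 0 = quad (Dder x) (x + Dder y) y.
Proof.
rewrite /quad rmorph0 !mul0r addr0 mulrDr mulrA !Palg_rel rmorphD !mulrDl.
by rewrite [LHS](AC (2*2) (2*(1*4)*3)).
Qed.

Lemma quadMr x y r : quad x y 0 * i2 r = quad (x * r + y * Dder r) (y * r) 0.
Proof.
rewrite /quad rmorph0 !mul0r !addr0 mulrDl -mulrA Palg_rel mulrDr rmorphD !rmorphM !mulrA.
by rewrite [LHS](AC (1*2) (1*3*2)).
Qed.

Definition delta_const (r : R2) : tpair sigma := (i2 r, quad (d0 r) (d1 r) 0).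

Fact delta_const_zmod : zmod_morphism delta_const.
Proof.
move=> r r'; rewrite /delta_const -[RHS]/(_, _) /= rmorphB quadB subr0.
by rewrite /d0 (delta0B _ _ _ (@eulerD k) (@eulerN k)) /d1 (delta1B (@eulerD k) (@eulerN k)).
Qed.

Fact delta_const_monoid : monoid_morphism delta_const.
Proof.
have E1 : E 1 = 0 by rewrite -[1]/(1%:P) eulerC euler1_0 polyC0.
split=> [|r r'].
  rewrite /delta_const /d0 /d1 /delta0 /delta1 E1 euler0 mul0r subrr mulr0 !addr0.
  by rewrite /quad !rmorph0 !mul0r !addr0 rmorph1.
rewrite tmulE /delta_const /= rmorphM shift_const quadMl quadMr quadD.
congr (_, quad _ _ _); last by rewrite mulr0 addr0.
  exact: (delta0M _ _ _ (@eulerD k) (@eulerM k)).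
exact: (delta1M (@eulerM k)).
Qed.

HB.instance Definition _ := GRing.isZmodMorphism.Build R2 (tpair sigma)
  delta_const delta_const_zmod.
HB.instance Definition _ := GRing.isMonoidMorphism.Build R2 (tpair sigma)
  delta_const delta_const_monoid.

Definition delta_var : tpair sigma := (a2, quad 0 (h2 - u2) 0).

(** The one condition for $\delta$ to be well defined on $P$. *)
Fact delta_rel (r : R2) : delta_var * delta_const r =
  delta_const (idfun r) * delta_var + delta_const (Dder r).
Proof.
rewrite !tmulE /delta_const /delta_var -[RHS]/(_, _) /=.
rewrite shift_const shift_var mulrDl quadaM !quadMl !quadMr quadMa !quadD.
congr (_, quad _ _ _).
- exact: Palg_rel.
- have e : d0 (Dder r) = Dder (d0 r) + h2 * d0 r + (h2 - u2) * Dder r :=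
    delta0_der (@eulerD k) (@eulerN k) (@eulerM k) euler_g (eulerX k) r.
  by rewrite e mulr0 mul0r !add0r.
- have e : d1 (Dder r) = Dder (d1 r) + h2 * d1 r :=
    delta1_der (@eulerD k) (@eulerM k) euler_g r.
  by rewrite e; move: (d0 r) (Dder (d1 r)) (d1 r) h2 u2 => *; ring.
- by rewrite !mulr0 !addr0 add0r.
Qed.

Definition delta_morph : {rmorphism Palg -> tpair sigma} :=
  skew_morph (D := Pdata) (phi := delta_const : {rmorphism R2 -> tpair sigma}) delta_rel.

Lemma delta_morph_const r : delta_morph (i2 r) = delta_const r.
Proof. exact: skew_morph_const. Qed.
Lemma delta_morph_var : delta_morph a2 = delta_var.
Proof. exact: skew_morph_var. Qed.

Lemma delta_morph1 p : (delta_morph p).1 = p.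
Proof.
apply: (skew_ext (F := (@tfst _ sigma) \o delta_morph) (G := idfun)) => [r|].
  by rewrite -[LHS]/(delta_morph (i2 r)).1 delta_morph_const.
by rewrite -[LHS]/(delta_morph a2).1 delta_morph_var.
Qed.

Definition delta (p : Palg) : Palg := (delta_morph p).2.

Fact delta_zmod : zmod_morphism delta.
Proof. by move=> p q; rewrite /delta rmorphB. Qed.
HB.instance Definition _ := GRing.isZmodMorphism.Build Palg Palg delta delta_zmod.

Fact deltaM p q : delta (p * q) = sigma p * delta q + delta p * q.
Proof. by rewrite /delta rmorphM tmulE /= !delta_morph1. Qed.

Lemma delta_constE r : delta (i2 r) = quad (d0 r) (d1 r) 0.
Proof. by rewrite /delta delta_morph_const. Qed.

Lemma delta_varE : delta a2 = i2 (h2 - u2) * a2.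
Proof.
by rewrite /delta delta_morph_var /= /quad !rmorph0 !mul0r add0r addr0.
Qed.

Definition Tdata : skew_data Palg := SkewData deltaM.
Definition Talg : nzRingType := skewpoly Tdata.

End Model.

(** * The presentation is the model *)

Section QuotientMorphisms.
Variables (k : comNzRingType) (A : algType k) (S : seq A).
Hypothesis Sp : 1 \notin ideal_gen S.
Local Notation Q := (alg_quot Sp).
Local Notation pr := (qproj Sp).

Fact qproj_zmod : zmod_morphism pr.
Proof.
by move=> x y; apply: (addIr (pr y)); rewrite -qprojD !subrK.
Qed.
Fact qproj_monoid : monoid_morphism (pr : A -> Q).
Proof. by split=> // x y; rewrite qprojM. Qed.
Fact qproj_scalable : scalable (pr : A -> Q).
Proof. by move=> a x; rewrite qprojZ. Qed.
HB.instance Definition _ := GRing.isZmodMorphism.Build A Q pr qproj_zmod.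
HB.instance Definition _ := GRing.isMonoidMorphism.Build A Q pr qproj_monoid.
HB.instance Definition _ := GRing.isScalable.Build k A Q *:%R pr qproj_scalable.

Lemma qproj0 (x : A) : x \in S -> pr x = 0 :> Q.
Proof.
move=> xS; rewrite -(rmorph0 pr); apply/qproj_eq; rewrite subr0.
exact: ideal_gen_mem.
Qed.

Lemma qproj_horner_alg (x : A) p : pr (horner_alg x p) = horner_alg (pr x : Q) p.
Proof.
elim/poly_ind: p => [|p t IHp]; first by rewrite !rmorph0.
rewrite !(rmorphD, rmorphM) /= !horner_algX IHp !horner_algC; congr (_ + _).
by rewrite linearZ /= rmorph1.
Qed.

Variables (B : nzRingType) (F : {rmorphism A -> B}).
Hypothesis FS : forall x, x \in S -> F x = 0.

Definition qlift (x : Q) : B := F (repr x).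

Lemma qliftE (x : A) : qlift (pr x) = F x.
Proof.
apply/eqP; rewrite -subr_eq0 -rmorphB; apply/eqP.
have /qproj_eq/asboolP [n [l [s [r [sS ->]]]]] : pr (repr (pr x)) = pr x by rewrite qprojK.
by rewrite rmorph_sum big1 // => j _; rewrite !rmorphM (FS (sS j)) mulr0 mul0r.
Qed.

Fact qlift_zmod : zmod_morphism qlift.
Proof.
by move=> x y; rewrite -[x]qprojK -[y]qprojK -rmorphB !qliftE rmorphB.
Qed.
Fact qlift_monoid : monoid_morphism qlift.
Proof.
split=> [|x y]; first by rewrite -(rmorph1 pr) qliftE rmorph1.
by rewrite -[x]qprojK -[y]qprojK -rmorphM !qliftE rmorphM.
Qed.
HB.instance Definition _ := GRing.isZmodMorphism.Build Q B qlift qlift_zmod.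
HB.instance Definition _ := GRing.isMonoidMorphism.Build Q B qlift qlift_monoid.
Definition qlift_morph : {rmorphism Q -> B} := qlift.

End QuotientMorphisms.

Section FreeLift.
Variables (k : fieldType) (B : nzRingType) (f : {rmorphism k -> B}) (v : 'I_4 -> B).
Hypothesis fv : forall t i, f t * v i = v i * f t.

Definition word_eval (m : fmonom 'I_4) : B := \prod_(i <- (m : seq 'I_4)) v i.
Lemma word_eval_nil : word_eval (FMonom [::]) = 1.
Proof. exact: big_nil. Qed.
Lemma word_eval_cons i s : word_eval (FMonom (i :: s)) = v i * word_eval (FMonom s).
Proof. exact: big_cons. Qed.

Fact word_eval_mmorphism : mmorphism word_eval.
Proof.
split=> [m m'|]; last by rewrite /word_eval fm1 big_nil.
by rewrite /word_eval fmM big_cat.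
Qed.
HB.instance Definition _ := isMultiplicative.Build (fmonom 'I_4) B word_eval
  word_eval_mmorphism.

(** A morphism from the free algebra exists as soon as the scalars commute with the images of the
    generators. *)
Definition free_lift (x : free4 k) : B := mmap f word_eval x.

Fact free_lift_zmod : zmod_morphism free_lift.
Proof. by move=> x y; apply: (mmapB (f := f) (h := word_eval)). Qed.

Fact free_lift_monoid : monoid_morphism free_lift.
Proof.
have C t s : f t * word_eval (FMonom s) = word_eval (FMonom s) * f t.
  elim: s => [|i s IHs]; first by rewrite word_eval_nil mulr1 mul1r.
  by rewrite word_eval_cons mulrA fv -!mulrA IHs.
have [|M1 M2] := @commr_mmap_is_multiplicative (fmonom 'I_4) k B f word_eval.
  by move=> x m [s]; apply: C.
by split.
Qed.
HB.instance Definition _ := GRing.isZmodMorphism.Build (free4 k) B free_lift free_lift_zmod.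
HB.instance Definition _ := GRing.isMonoidMorphism.Build (free4 k) B free_lift free_lift_monoid.
Definition free_morph : {rmorphism free4 k -> B} := free_lift.

Lemma free_morph_gen i : free_morph (free4_gen k i) = v i.
Proof.
transitivity (f 1 * word_eval (fmu i)); first exact: mmapU.
by rewrite rmorph1 mul1r fmuE word_eval_cons word_eval_nil mulr1.
Qed.

Lemma free_morph_scalar t : free_morph t%:A = f t.
Proof.
transitivity (f t * mmap f word_eval (1 : malg (fmonom 'I_4) k)).
  exact: mmapZ.
by rewrite mmap1 mulr1.
Qed.

Lemma free_ind (V : free4 k -> Prop) :
  V 0 -> (forall x y, V x -> V y -> V (x + y)) -> V 1 ->
  (forall t x, V x -> V (t *: x)) ->
  (forall i x, V x -> V (free4_gen k i * x)) -> forall x, V x.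
Proof.
move=> V0 VD V1 VZ VM x.
have Vm (m : fmonom 'I_4) : V (mkmalgU m 1).
  case: m => s; elim: s => [|i s IHs]; first by rewrite -fmoneE.
  have -> : mkmalgU (FMonom (i :: s)) (1 : k) = free4_gen k i * (mkmalgU (FMonom s) 1 : free4 k).
    rewrite -[RHS]/((mkmalgU (fmu i) 1 : malg (fmonom 'I_4) k) * mkmalgU (FMonom s) 1).
    by rewrite malgM_def fgmulUU mulr1 -[mmul _ _]/(fmmul _ _) fmmulE fmuE.
  exact: VM.
rewrite (monalgE x); elim/big_ind: _ => // m _.
have -> : mkmalgU m (mcoeff m x) = (mcoeff m x) *: (mkmalgU m 1 : free4 k).
  rewrite -[RHS]/((mcoeff m x) *: (mkmalgU m 1 : malg (fmonom 'I_4) k)).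
  by apply/malgP => m'; rewrite mcoeffZ !mcoeffU mulrnAr mulr1.
by apply: VZ.
Qed.

End FreeLift.

Section TwistedRelation.
Variables (R B : nzRingType) (F : {rmorphism R -> B}) (D : skew_data R) (y : B).
Let Z r := y * F r = F (sk_s D r) * y + F (sk_d D r).

Lemma twisted_relD r r' : Z r -> Z r' -> Z (r + r').
Proof. by rewrite /Z !raddfD /= mulrDr mulrDl => -> ->; rewrite addrACA. Qed.

Lemma twisted_relM r r' : Z r -> Z r' -> Z (r * r').
Proof.
rewrite /Z sk_dM rmorphD !rmorphM mulrA => -> zr'.
by rewrite mulrDl -mulrA zr' mulrDr !mulrA addrA.
Qed.

End TwistedRelation.

Lemma poly2_ind (k : comNzRingType) (V : {poly {poly k}} -> Prop) :
  (forall p q, V p -> V q -> V (p + q)) -> (forall p q, V p -> V q -> V (p * q)) ->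
  (forall t, V (t%:P%:P)) -> V ('X%:P) -> V 'X -> forall p, V p.
Proof.
move=> VD VM Vt Vc Vu.
have V1 (p : {poly k}) : V p%:P.
  elim/poly_ind: p => [|p t IHp]; first by apply: (Vt 0).
  by rewrite polyCD polyCM; apply: VD => //; apply: VM.
elim/poly_ind => [|p t IHp]; first by apply: (Vt 0).
by apply: VD => //; apply: VM.
Qed.

Lemma poly2_ext (k : comNzRingType) (B : nzRingType) (F G : {rmorphism {poly {poly k}} -> B}) :
  (forall t, F t%:P%:P = G t%:P%:P) -> F 'X%:P = G 'X%:P -> F 'X = G 'X -> F =1 G.
Proof.
move=> Ft Fc Fu; elim/poly2_ind => // p q E1 E2; first by rewrite !rmorphD E1 E2.
by rewrite !rmorphM E1 E2.
Qed.

Lemma skewpoly_ind (R : nzRingType) (D : skew_data R) (V : skewpoly D -> Prop) :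
  (forall p q, V p -> V q -> V (p + q)) -> (forall p q, V p -> V q -> V (p * q)) ->
  (forall r, V (skew_const D r)) -> V (skew_var D) -> forall p, V p.
Proof.
move=> VD VM Vr Vx p; rewrite -[p]skew_oev.
elim/poly_ind: (p : {poly R}) => [|q r IHq]; first by rewrite oev0; have := Vr 0; rewrite rmorph0.
by rewrite oevD oevMX oevC; apply: VD; [apply: VM|apply: Vr].
Qed.

(** The defining relations in an arbitrary algebra. Most of what follows is proved for any algebra
    with these relations that is an Ore extension in the prescribed way, and is applied to the
    quotient of the free algebra only at the end. *)
Record Gf_relations (k : fieldType) (g : {poly k}) (B : algType k) (a b c u : B) : Prop :=
  GfRelations {
    rel_ac : a * c = c * a + c * horner_alg c g;
    rel_au : a * u = u * a + u * horner_alg c g;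
    rel_cu : c * u = u * c;
    rel_bc : b * c = c * b + c * (horner_alg c ('X * g^`()) + u + a *+ 2);
    rel_bu : b * u = u * b + u * (horner_alg c ('X * g^`()) + u + a *+ 2);
    rel_ba : b * a = (a + horner_alg c ('X * g^`())) * b
                       + (horner_alg c ('X * g^`()) - u) * a }.

Section Presented.
Variables (k : fieldType) (g : {poly k}) (G : algType k) (a b c u : G).
Hypothesis rel : Gf_relations g a b c u.
Local Notation R2 := {poly {poly k}}.
Local Notation i2 := (skew_const (Pdata g)).
Local Notation a2 := (skew_var (Pdata g)).
Local Notation iT := (skew_const (Tdata g)).
Local Notation bT := (skew_var (Tdata g)).

Lemma rel_comm_u (p : {poly k}) : GRing.comm u (horner_alg c p).
Proof.
rewrite /GRing.comm; elim/poly_ind: p => [|p t IHp]; first by rewrite rmorph0 mulr0 mul0r.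
rewrite rmorphD rmorphM /= horner_algX horner_algC mulrDr mulrDl.
by rewrite mulrA IHp -!mulrA (rel_cu rel) -scalerAr -scalerAl mulr1 mul1r.
Qed.

(** Evaluation of a polynomial in two variables at the commuting elements [c] and [u]. *)
Definition phi2 : {rmorphism R2 -> G} := horner_morph rel_comm_u.

Lemma phi2_const (p : {poly k}) : phi2 p%:P = horner_alg c p.
Proof. exact: horner_morphC. Qed.
Lemma phi2_u : phi2 'X = u.
Proof. exact: horner_morphX. Qed.
Lemma phi2_c : phi2 'X%:P = c.
Proof. by rewrite phi2_const horner_algX. Qed.
Lemma phi2_scalar t : phi2 t%:P%:P = t%:A.
Proof. by rewrite phi2_const horner_algC. Qed.

Lemma scalar_comm (t : k) (x : G) : x * t%:A = t%:A * x.
Proof. by rewrite -scalerAr -scalerAl mulr1 mul1r. Qed.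

Lemma euler_scalar (t : k) : euler t%:P%:P = 0 :> R2.
Proof. by rewrite eulerC /euler1 derivC mulr0. Qed.
Lemma euler_c : euler ('X%:P : R2) = 'X%:P.
Proof. by rewrite eulerC euler1X. Qed.

Lemma phi2_rel r : a * phi2 r = phi2 (idfun r) * a + phi2 (Dder g r).
Proof.
elim/poly2_ind: r => [p q|p q|t||].
- exact: (twisted_relD (D := Pdata g)).
- exact: (twisted_relM (D := Pdata g)).
- by rewrite /Dder euler_scalar mulr0 rmorph0 addr0 /= phi2_scalar scalar_comm.
- by rewrite /Dder euler_c mulrC rmorphM /= phi2_c phi2_const (rel_ac rel).
- by rewrite /Dder eulerX mulrC rmorphM /= phi2_u phi2_const (rel_au rel).
Qed.

Definition psiP : {rmorphism Palg g -> G} := skew_morph (D := Pdata g) phi2_rel.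

Lemma psiP_const r : psiP (i2 r) = phi2 r.
Proof. exact: skew_morph_const. Qed.
Lemma psiP_var : psiP a2 = a.
Proof. exact: skew_morph_var. Qed.

Lemma psiP_quad x y z : psiP (quad g x y z) = phi2 x + phi2 y * a + phi2 z * a * a.
Proof. by rewrite /quad !(rmorphD, rmorphM) /= !psiP_const psiP_var. Qed.

Lemma d0_scalar t : d0 g t%:P%:P = 0.
Proof. by rewrite /d0 /delta0 euler_scalar euler0 mul0r subrr mulr0 addr0. Qed.
Lemma d1_scalar t : d1 (t%:P%:P : R2) = 0.
Proof. by rewrite /d1 /delta1 euler_scalar addr0. Qed.
Lemma d0_c : d0 g 'X%:P = 'X%:P * (h2 g + 'X).
Proof. by rewrite /d0 /delta0 !euler_c subrr mulr0 addr0. Qed.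
Lemma d0_u : d0 g 'X = 'X * (h2 g + 'X).
Proof. by rewrite /d0 /delta0 !eulerX subrr mulr0 addr0. Qed.
Lemma d1_c : d1 ('X%:P : R2) = 'X%:P + 'X%:P.
Proof. by rewrite /d1 /delta1 !euler_c. Qed.
Lemma d1_u : d1 ('X : R2) = 'X + 'X.
Proof. by rewrite /d1 /delta1 !eulerX. Qed.

Lemma sigma_const r : sigma g (i2 r) = i2 r.
Proof. exact: shift_const. Qed.
Lemma sigma_var : sigma g a2 = a2 + i2 (h2 g).
Proof. exact: shift_var. Qed.

Lemma psiP_rel p : b * psiP p = psiP (sigma g p) * b + psiP (delta p).
Proof.
elim/skewpoly_ind: p => [p q|p q|r|].
- exact: (twisted_relD (D := Tdata g)).
- exact: (twisted_relM (D := Tdata g)).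
- elim/poly2_ind: r => [p q|p q|t||].
  + by rewrite rmorphD; apply: (twisted_relD (D := Tdata g)).
  + by rewrite rmorphM; apply: (twisted_relM (D := Tdata g)).
  + rewrite sigma_const delta_constE psiP_quad psiP_const d0_scalar d1_scalar.
    by rewrite !rmorph0 !mul0r !addr0 phi2_scalar scalar_comm.
  + rewrite sigma_const delta_constE psiP_quad psiP_const d0_c d1_c rmorph0 !mul0r addr0.
    rewrite -mulr2n rmorphMn rmorphM rmorphD /= !phi2_c phi2_u phi2_const (rel_bc rel).
    by rewrite mulrnAl -mulrnAr [c * (_ + _ + _)]mulrDr.
  + rewrite sigma_const delta_constE psiP_quad psiP_const d0_u d1_u rmorph0 !mul0r addr0.
    rewrite -mulr2n rmorphMn rmorphM rmorphD /= !phi2_u phi2_const (rel_bu rel).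
    by rewrite mulrnAl -mulrnAr [u * (_ + _ + _)]mulrDr.
- rewrite sigma_var delta_varE rmorphM rmorphD !psiP_const psiP_var rmorphB phi2_u.
  by rewrite !phi2_const (rel_ba rel).
Qed.

Definition psi : {rmorphism Talg g -> G} := skew_morph (D := Tdata g) psiP_rel.

Lemma psi_const p : psi (iT p) = psiP p.
Proof. exact: skew_morph_const. Qed.
Lemma psi_var : psi bT = b.
Proof. exact: skew_morph_var. Qed.

End Presented.

Lemma Gf_relators_map (k : fieldType) (g : {poly k}) (B C : algType k)
    (F : {rmorphism B -> C}) (a b c u : B) :
  (forall x p, F (horner_alg x p) = horner_alg (F x) p) ->
  map F (Gf_relators g a b c u) = Gf_relators g (F a) (F b) (F c) (F u).
Proof.
move=> FH; rewrite /Gf_relators /=.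
by rewrite !(rmorphB, rmorphD, rmorphM, rmorphN, rmorphMn) /= !FH.
Qed.

Lemma horner_alg_MXaddC (k : comNzRingType) (B : algType k) (x : B) p t :
  horner_alg x (p * 'X + t%:P) = horner_alg x p * x + t%:A.
Proof. by rewrite rmorphD rmorphM /= horner_algX horner_algC. Qed.

(** To map the presented algebra to a ring it suffices to verify the six relations between the
    images, with [ch] the image of the polynomials in [c]. *)
Lemma Gf_relators_kill (k : fieldType) (g : {poly k}) (B : algType k) (C : nzRingType)
    (F : {rmorphism B -> C}) (ch : {poly k} -> C) (a b c u : B) (a' b' c' u' : C) :
  (forall p, F (horner_alg c p) = ch p) ->
  F a = a' -> F b = b' -> F c = c' -> F u = u' ->
  let gam := ch ('X * g^`()) + u' + a' *+ 2 in
  a' * c' = c' * a' + ch ('X * g) -> a' * u' = u' * a' + u' * ch g ->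
  c' * u' = u' * c' -> b' * c' = c' * b' + c' * gam -> b' * u' = u' * b' + u' * gam ->
  b' * a' = (a' + ch ('X * g^`())) * b' + (ch ('X * g^`()) - u') * a' ->
  forall x, x \in Gf_relators g a b c u -> F x = 0.
Proof.
move=> FH <- <- <- <- gam E1 E2 E3 E4 E5 E6 x; rewrite /Gf_relators !inE.
have E := (rmorphB F, rmorphD F, rmorphM F, rmorphN F, rmorphMn F, FH).
do ![case/orP] => /eqP ->; rewrite !E ?E1 ?E2 ?E3 ?E4 ?E5 ?E6 subrr //.
Qed.

Section ModelImage.
Variables (k : fieldType) (g : {poly k}).
Local Notation R2 := {poly {poly k}}.
Local Notation i2 := (skew_const (Pdata g)).
Local Notation a2 := (skew_var (Pdata g)).
Local Notation iT := (skew_const (Tdata g)).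
Local Notation bT := (skew_var (Tdata g)).

Definition gensT (i : 'I_4) : Talg g :=
  nth 0 [:: iT a2; bT; iT (i2 'X%:P); iT (i2 'X)] i.

Definition scalT : {rmorphism k -> Talg g} := iT \o (i2 \o (polyC \o polyC)).

Lemma a2_scalar t : a2 * i2 t%:P%:P = i2 t%:P%:P * a2.
Proof. by rewrite Palg_rel /Dder euler_scalar mulr0 rmorph0 addr0. Qed.

Lemma bT_rel p : bT * iT p = iT (sigma g p) * bT + iT (delta p).
Proof. exact: (skew_rel (Tdata g)). Qed.

Lemma bT_scalar t : bT * iT (i2 t%:P%:P) = iT (i2 t%:P%:P) * bT.
Proof.
have E : delta (i2 t%:P%:P) = 0 :> Palg g by rewrite delta_constE d0_scalar d1_scalar quad0.
by rewrite bT_rel sigma_const (etrans (congr1 iT E) (rmorph0 iT)) addr0.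
Qed.

Lemma scalT_comm t i : scalT t * gensT i = gensT i * scalT t.
Proof.
have i2C r : iT (i2 t%:P%:P) * iT (i2 r) = iT (i2 r) * iT (i2 t%:P%:P).
  by rewrite -(rmorphM iT) -(rmorphM i2) mulrC (rmorphM i2) (rmorphM iT).
have i2a : iT (i2 t%:P%:P) * iT a2 = iT a2 * iT (i2 t%:P%:P).
  by rewrite -(rmorphM iT) -a2_scalar (rmorphM iT).
case: i => -[|[|[|[|i]]]] i4.
- exact: i2a.
- exact/esym/bT_scalar.
- exact: i2C.
- exact: i2C.
- by [].
Qed.

Definition Phi_free : {rmorphism free4 k -> Talg g} := free_morph scalT_comm.

Lemma Phi_free_gen n : (n < 4)%N ->
  Phi_free (free4_gen k (inord n)) = nth 0 [:: iT a2; bT; iT (i2 'X%:P); iT (i2 'X)] n.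
Proof. by move=> n4; rewrite /Phi_free free_morph_gen /gensT inordK. Qed.

Lemma Phi_free_horner p :
  Phi_free (horner_alg (free4_gen k (inord 2)) p) = iT (i2 p%:P).
Proof.
elim/poly_ind: p => [|p t IHp].
  by rewrite rmorph0 (rmorph0 Phi_free) polyC0 (rmorph0 i2) (rmorph0 iT).
rewrite horner_alg_MXaddC (rmorphD Phi_free) (rmorphM Phi_free).
rewrite IHp Phi_free_gen // free_morph_scalar.
by rewrite polyCD polyCM (rmorphD i2) (rmorphM i2) (rmorphD iT) (rmorphM iT).
Qed.

Lemma Phi_free_relators x : x \in Gf_free_relators g -> Phi_free x = 0.
Proof.
have P0 : Phi_free (free4_gen k (inord 0)) = iT a2 := @Phi_free_gen 0 isT.
have P1 : Phi_free (free4_gen k (inord 1)) = bT := @Phi_free_gen 1 isT.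
have P2 : Phi_free (free4_gen k (inord 2)) = iT (i2 'X%:P) := @Phi_free_gen 2 isT.
have P3 : Phi_free (free4_gen k (inord 3)) = iT (i2 'X) := @Phi_free_gen 3 isT.
have gam r : iT (quad g (r * (h2 g + 'X)) (r + r) 0) =
    iT (i2 r) * (iT (i2 (h2 g)) + iT (i2 'X) + iT a2 *+ 2).
  rewrite /quad (rmorph0 i2) !mul0r addr0 -mulr2n (rmorphMn i2) (rmorphM i2) (rmorphD i2).
  rewrite (rmorphD iT) (rmorphM iT) (rmorphM iT) (rmorphD iT) (rmorphMn iT).
  by rewrite [RHS]mulrDr mulrnAl mulrnAr.
apply: (Gf_relators_kill Phi_free_horner P0 P1 P2 P3).
- have Dc : Dder g 'X%:P = ('X * g)%:P by rewrite /Dder euler_c -polyCM mulrC.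
  by rewrite -(rmorphM iT) Palg_rel Dc (rmorphD iT) (rmorphM iT).
- have Du : Dder g 'X = 'X * g%:P by rewrite /Dder eulerX mulrC.
  by rewrite -(rmorphM iT) Palg_rel Du (rmorphM i2) (rmorphD iT) !(rmorphM iT).
- have cu : 'X%:P * 'X = 'X * 'X%:P :> R2 by rewrite mulrC.
  by rewrite -!(rmorphM iT) -!(rmorphM i2) cu.
- by rewrite bT_rel sigma_const delta_constE d0_c d1_c gam.
- by rewrite bT_rel sigma_const delta_constE d0_u d1_u gam.
- rewrite bT_rel sigma_var delta_varE (rmorphD iT) (rmorphM iT) (rmorphB i2).
  by rewrite (rmorphB iT).
Qed.

Definition Phi : {rmorphism Gf g -> Talg g} := qlift_morph (Gf_proper g) Phi_free_relators.

Local Notation pr := (qproj (Gf_proper g)).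
Local Notation a := (Gf_a g).
Local Notation b := (Gf_b g).
Local Notation c := (Gf_c g).
Local Notation u := (Gf_u g).

Lemma Gf_relators_proj : map pr (Gf_free_relators g) = Gf_relators g a b c u.
Proof. exact/Gf_relators_map/qproj_horner_alg. Qed.

Lemma Gf_relators_nth j : (j < 6)%N -> nth 0 (Gf_relators g a b c u) j = 0.
Proof.
move=> j6; have : nth 0 (map pr (Gf_free_relators g)) j \in map pr (Gf_free_relators g).
  exact: mem_nth.
by rewrite -Gf_relators_proj => /mapP [y yS ->]; apply: qproj0.
Qed.

Lemma Gf_rel : Gf_relations g a b c u.
Proof.
split.
- have E : a * c = c * a + horner_alg c ('X * g) :=
    subr0_eq (Gf_relators_nth (isT : (0 < 6)%N)).
  by rewrite E rmorphM /= horner_algX.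
- exact: subr0_eq (Gf_relators_nth (isT : (1 < 6)%N)).
- exact: subr0_eq (Gf_relators_nth (isT : (2 < 6)%N)).
- exact: subr0_eq (Gf_relators_nth (isT : (3 < 6)%N)).
- exact: subr0_eq (Gf_relators_nth (isT : (4 < 6)%N)).
- exact: subr0_eq (Gf_relators_nth (isT : (5 < 6)%N)).
Qed.

Lemma Phi_proj x : Phi (pr x) = Phi_free x.
Proof. by rewrite /Phi; apply: (@qliftE _ _ _ (Gf_proper g) _ _ Phi_free_relators). Qed.

Lemma Phi_a : Phi a = iT a2.
Proof. exact: etrans (Phi_proj _) (@Phi_free_gen 0 isT). Qed.
Lemma Phi_b : Phi b = bT.
Proof. exact: etrans (Phi_proj _) (@Phi_free_gen 1 isT). Qed.
Lemma Phi_c : Phi c = iT (i2 'X%:P).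
Proof. exact: etrans (Phi_proj _) (@Phi_free_gen 2 isT). Qed.
Lemma Phi_u : Phi u = iT (i2 'X).
Proof. exact: etrans (Phi_proj _) (@Phi_free_gen 3 isT). Qed.

Lemma Gf_scalar t : t%:A = pr t%:A :> Gf g.
Proof. by rewrite linearZ /= rmorph1. Qed.

Lemma Phi_scalar t : Phi t%:A = iT (i2 t%:P%:P).
Proof. by rewrite Gf_scalar Phi_proj /Phi_free free_morph_scalar. Qed.

Lemma Phi_phi2 r : Phi (phi2 Gf_rel r) = iT (i2 r).
Proof.
apply: (poly2_ext (F := Phi \o phi2 Gf_rel) (G := iT \o i2)) => [t||].
- by rewrite -[LHS]/(Phi (phi2 Gf_rel t%:P%:P)) phi2_scalar Phi_scalar.
- by rewrite -[LHS]/(Phi (phi2 Gf_rel 'X%:P)) phi2_c Phi_c.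
- by rewrite -[LHS]/(Phi (phi2 Gf_rel 'X)) phi2_u Phi_u.
Qed.

Lemma Phi_psiP p : Phi (psiP Gf_rel p) = iT p.
Proof.
apply: (skew_ext (F := Phi \o psiP Gf_rel) (G := iT)) => [r|].
  by rewrite -[LHS]/(Phi (psiP Gf_rel (i2 r))) psiP_const Phi_phi2.
by rewrite -[LHS]/(Phi (psiP Gf_rel a2)) psiP_var Phi_a.
Qed.

Lemma Phi_psi y : Phi (psi Gf_rel y) = y.
Proof.
apply: (skew_ext (F := Phi \o psi Gf_rel) (G := idfun)) => [p|].
  by rewrite -[LHS]/(Phi (psi Gf_rel (iT p))) psi_const Phi_psiP.
by rewrite -[LHS]/(Phi (psi Gf_rel bT)) psi_var Phi_b.
Qed.

Lemma psi_surj x : exists y, x = psi Gf_rel y.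
Proof.
rewrite -[x]qprojK; move: (repr x) => w.
have psi_phi2 r : psi Gf_rel (iT (i2 r)) = phi2 Gf_rel r by rewrite psi_const psiP_const.
have prD v v' : pr (v + v') = pr v + pr v' := rmorphD pr v v'.
have prM v v' : pr (v * v') = pr v * pr v' := rmorphM pr v v'.
have prZ t v : pr (t *: v) = t *: pr v := qproj_scalable (Gf_proper g) t v.
elim/(@free_ind k): w => [|v w [y yE] [y' y'E]||t w [y yE]|i w [y yE]].
- by exists 0; rewrite (rmorph0 pr) rmorph0.
- by exists (y + y'); rewrite prD yE y'E rmorphD.
- by exists 1; rewrite (rmorph1 pr) rmorph1.
- exists (iT (i2 t%:P%:P) * y).
  by rewrite prZ yE rmorphM psi_phi2 phi2_scalar -scalerAl mul1r.
- suff [y' y'E] : exists y', pr (free4_gen k i) = psi Gf_rel y'.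
    by exists (y' * y); rewrite prM y'E yE rmorphM.
  have iE : i = inord i by rewrite inord_val.
  case: i iE => -[|[|[|[|i]]]] i4 -> //=.
  + by exists (iT a2); rewrite psi_const psiP_var.
  + by exists bT; rewrite psi_var.
  + by exists (iT (i2 'X%:P)); rewrite psi_phi2 phi2_c.
  + by exists (iT (i2 'X)); rewrite psi_phi2 phi2_u.
Qed.

(** [psi] has the left inverse [Phi] and its image contains the generators. *)
Theorem Gf_ore : ore_ext (psiP Gf_rel) b (sigma g) (@delta k g).
Proof.
split.
- by move=> p; exact: psiP_rel.
- exact: sigma_bij.
- by move=> x; have [y ->] := psi_surj x; exists y.
- move=> p p0; have : psi Gf_rel p = 0 by exact: p0.
  by move/(congr1 Phi); rewrite Phi_psi (rmorph0 Phi).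
Qed.

End ModelImage.

(** * Noetherianity, zero divisors and global dimension *)

Lemma poly_ore (S : comNzRingType) :
  ore_ext (polyC : {rmorphism S -> {poly S}}) 'X idfun (fun=> 0).
Proof.
have oevX (p : {poly S}) : oev polyC 'X p = p by exact: comp_polyXr.
split.
- by move=> r; rewrite rmorph0 addr0 mulrC.
- by exists idfun.
- by move=> w; exists w; rewrite oevX.
- by move=> p; rewrite oevX.
Qed.

Section Tower.
Variables (k : fieldType) (g : {poly k}).

Lemma Palg_ore : ore_ext (skew_const (Pdata g)) (skew_var (Pdata g)) idfun (Dder g).
Proof. by apply: (skew_ore (D := Pdata g)); exists (@idfun {poly {poly k}}). Qed.

(** Whatever passes to Ore extensions ascends the tower from the field. *)
Lemma Gf_tower (Q : nat -> nzRingType -> Prop) :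
  (forall (R A : nzRingType) (i : {rmorphism R -> A}) x s d n,
     ore_ext i x s d -> Q n R -> Q n.+1 A) -> Q 0%N k -> Q 4%N (Gf g).
Proof.
move=> step /(step _ _ _ _ _ _ _ (poly_ore k)) /(step _ _ _ _ _ _ _ (poly_ore _)).
by move=> /(step _ _ _ _ _ _ _ Palg_ore) /(step _ _ _ _ _ _ _ (Gf_ore g)).
Qed.

(** Converses of Ore extensions being Ore extensions, the tower can be turned over. *)
Lemma Gf_conv_tower (Q : nat -> nzRingType -> Prop) :
  (forall (R A : nzRingType) (i : {rmorphism R -> A}) x s d n,
     ore_ext i x s d -> Q n R -> Q n.+1 A) -> Q 0%N k^c -> Q 4%N (Gf g)^c.
Proof.
move=> step; apply: (Gf_tower (Q := fun n (A : nzRingType) => Q n A^c)).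
by move=> R A i x s d n /ore_conv [s' [d' H]]; apply: step H.
Qed.

Lemma field_div (a : k) : a != 0 -> exists b, b * a = 1.
Proof. by move=> a0; exists a^-1; rewrite mulVf. Qed.
Lemma field_conv_div (a : k^c) : a != 0 -> exists b, b * a = 1.
Proof. by move=> a0; exists (a : k)^-1; apply: mulfV. Qed.

Lemma Gf_noetherian : noetherian (Gf g).
Proof.
pose Q (n : nat) := left_noetherian.
split; [apply: (Gf_tower (Q := Q))|apply: (Gf_conv_tower (Q := Q))].
- by move=> R A i x s d n /ore_left_noetherian.
- exact: division_ring_left_noetherian field_div.
- by move=> R A i x s d n /ore_left_noetherian.
- exact: division_ring_left_noetherian field_conv_div.
Qed.

Lemma Gf_domain : is_domain (Gf g).
Proof.
apply: (Gf_tower (Q := fun n => is_domain)); first by move=> R A i x s d n /ore_domain.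
exact: division_ring_domain field_div.
Qed.

Let resolved n (A : nzRingType) := forall M : lmodType A, has_projective_resolution M n.

Lemma Gf_resolution : resolved 4 (Gf g).
Proof.
apply: (Gf_tower (Q := resolved)); last exact: division_ring_resolution field_div.
by move=> R A i x s d n /ore_projective_resolution; apply.
Qed.

Lemma Gf_conv_resolution : resolved 4 (Gf g)^c.
Proof.
apply: (Gf_conv_tower (Q := resolved)); last exact: division_ring_resolution field_conv_div.
by move=> R A i x s d n /ore_projective_resolution; apply.
Qed.

End Tower.

Lemma left_gldim_eq (A : nzRingType) (R : realType) n :
  (forall M : lmodType A, has_projective_resolution M n) ->
  (exists M : lmodType A, forall m, has_projective_resolution M m -> (n <= m)%N) ->
  left_gldim A R = (n%:R)%:E.
Proof.
move=> up [M low]; apply/eqP; rewrite eq_le; apply/andP; split.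
- apply: ge_ereal_sup => _ [N ->]; apply: ereal_inf_lbound.
  by exists n => //; apply: up.
- apply: (@le_trans _ _ (projective_dim R M)); last first.
    by apply: ereal_sup_ubound; exists M.
  apply: le_ereal_inf_tmp => _ [m /low nm <-].
  by rewrite lee_fin ler_nat.
Qed.

Section CommutativeTarget.
Variables (A : nzRingType) (B : comNzRingType) (f : {rmorphism A -> B}).
Definition comm_conv_fun : A^c -> B := f.
Fact comm_conv_zmod : zmod_morphism comm_conv_fun.
Proof. exact: (rmorphB f). Qed.
Fact comm_conv_monoid : monoid_morphism comm_conv_fun.
Proof. by split=> [|x y]; [apply: (rmorph1 f)|rewrite mulrC; apply: (rmorphM f)]. Qed.
HB.instance Definition _ := GRing.isZmodMorphism.Build A^c B comm_conv_fun comm_conv_zmod.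
HB.instance Definition _ := GRing.isMonoidMorphism.Build A^c B comm_conv_fun comm_conv_monoid.
Definition comm_conv : {rmorphism A^c -> B} := comm_conv_fun.
End CommutativeTarget.

Section LowerGldim.
Variables (k : fieldType) (g : {poly k}) (A : algType k) (a b c u : A).
Hypothesis rel : Gf_relations g a b c u.
Hypothesis ore : ore_ext (psiP rel) b (sigma g) (@delta k g).
Hypothesis dom : is_domain A.

Local Notation R2 := {poly {poly k}}.
Local Notation i2 := (skew_const (Pdata g)).
Local Notation a2 := (skew_var (Pdata g)).
Local Notation gG := (horner_alg c g).
Local Notation hG := (horner_alg c ('X * g^`())).

(** The four generators and the scalars generate the algebra. *)
Lemma presented_ind (V : A -> Prop) :
  (forall x y, V x -> V y -> V (x + y)) -> (forall x y, V x -> V y -> V (x * y)) ->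
  (forall t, V t%:A) -> V a -> V b -> V c -> V u -> forall x, V x.
Proof.
move=> VD VM Vt Va Vb Vc Vu.
have V2 r : V (phi2 rel r).
  elim/poly2_ind: r => [p q Vp Vq|p q Vp Vq|t||].
  - by rewrite rmorphD; apply: VD.
  - by rewrite rmorphM; apply: VM.
  - by rewrite phi2_scalar.
  - by rewrite phi2_c.
  - by rewrite phi2_u.
have VP p : V (psiP rel p).
  elim/skewpoly_ind: p => [p q Vp Vq|p q Vp Vq|r|].
  - by rewrite rmorphD; apply: VD.
  - by rewrite rmorphM; apply: VM.
  - by rewrite psiP_const.
  - by rewrite psiP_var.
move=> x; have [p ->] := ore_span ore x.
elim/poly_ind: p => [|p r IHp]; first by rewrite oev0 -(scale0r 1).
by rewrite oevD oevMX oevC; apply: VD; [apply: VM|apply: VP].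
Qed.

Lemma c_hornerC p : c * horner_alg c p = horner_alg c p * c.
Proof. by rewrite -{1 4}(horner_algX c) -!rmorphM mulrC. Qed.

Lemma rel_ca : c * a = (a - gG) * c.
Proof. by rewrite mulrBl (rel_ac rel) -c_hornerC addrK. Qed.
Lemma rel_ua : u * a = (a - gG) * u.
Proof. by rewrite mulrBl (rel_au rel) (rel_comm_u rel g) addrK. Qed.

Lemma hu_c : (hG + u) * c = c * (hG + u).
Proof. by rewrite mulrDl mulrDr c_hornerC (rel_cu rel). Qed.
Lemma hu_u : (hG + u) * u = u * (hG + u).
Proof. by rewrite mulrDl mulrDr (rel_comm_u rel). Qed.

Lemma rel_cb : c * b = (b - (hG + u) - (a - gG) *+ 2) * c.
Proof.
rewrite -addrA -opprD mulrBl mulrDl mulrnAl -rel_ca hu_c (rel_bc rel).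
by rewrite [c * (_ + _ + _)]mulrDr mulrnAr addrK.
Qed.
Lemma rel_ub : u * b = (b - (hG + u) - (a - gG) *+ 2) * u.
Proof.
rewrite -addrA -opprD mulrBl mulrDl mulrnAl -rel_ua hu_u (rel_bu rel).
by rewrite [u * (_ + _ + _)]mulrDr mulrnAr addrK.
Qed.

Definition normalizes (w x : A) : Prop := (exists y, x * w = w * y) /\ (exists y, w * x = y * w).

Lemma normal_gens w : normalizes w a -> normalizes w b -> normalizes w c -> normalizes w u ->
  forall x, normalizes w x.
Proof.
move=> wa wb wc wu x; elim/presented_ind: x => // [x y [[x1 X1] [x2 X2]] [[y1 Y1] [y2 Y2]]|
    x y [[x1 X1] [x2 X2]] [[y1 Y1] [y2 Y2]]|t].
- split; first by exists (x1 + y1); rewrite mulrDl mulrDr X1 Y1.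
  by exists (x2 + y2); rewrite mulrDl mulrDr X2 Y2.
- split; first by exists (x1 * y1); rewrite -mulrA Y1 mulrA X1 mulrA.
  by exists (x2 * y2); rewrite mulrA X2 -mulrA Y2 mulrA.
- by split; exists t%:A; rewrite scalar_comm.
Qed.

Lemma c_normal x : normalizes c x.
Proof.
apply: normal_gens.
- split; first by exists (a + gG); rewrite mulrDr (rel_ac rel).
  by exists (a - gG); rewrite rel_ca.
- split; last by eexists; apply: rel_cb.
  by exists (b + (hG + u + a *+ 2)); rewrite mulrDr (rel_bc rel).
- by split; exists c.
- by split; exists u; rewrite (rel_cu rel).
Qed.

Lemma u_normal x : normalizes u x.
Proof.
apply: normal_gens.
- split; first by exists (a + gG); rewrite mulrDr (rel_au rel).
  by exists (a - gG); rewrite rel_ua.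
- split; last by eexists; apply: rel_ub.
  by exists (b + (hG + u + a *+ 2)); rewrite mulrDr (rel_bu rel).
- by split; exists c; rewrite (rel_cu rel).
- by split; exists u.
Qed.

(** Membership in the right ideals generated by [c], or by [c] and [u], is read off the
    coefficients, and the cofactors are chosen coefficient by coefficient. *)
Lemma choose_poly (S T : nzRingType) (r : {poly S}) (V : S -> T -> T -> Prop) :
  V 0 0 0 -> (forall j, exists st : T * T, V r`_j st.1 st.2) ->
  exists s t : {poly T}, forall j, V r`_j s`_j t`_j.
Proof.
move=> V0 /choice [st stV].
exists (\poly_(j < size r) (st j).1), (\poly_(j < size r) (st j).2) => j.
by rewrite !coef_poly; case: ltnP => // rj; rewrite nth_default.
Qed.

Lemma Palg_split (r0 r1 : R2) (p : Palg g) :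
  (forall j, exists st : R2 * R2, (p : {poly R2})`_j = r0 * st.1 + r1 * st.2) ->
  exists q0 q1 : Palg g, p = i2 r0 * q0 + i2 r1 * q1.
Proof.
move=> H; have [|q0 [q1 q01]] := choose_poly (r := (p : {poly R2}))
  (V := fun r s t => r = r0 * s + r1 * t) _ H; first by rewrite !mulr0 addr0.
exists q0, q1; apply/polyP => j; rewrite q01.
by rewrite !skew_constE coefD !coefZ.
Qed.

Lemma oev_split (r0 r1 : R2) (p : {poly Palg g}) :
  (forall l j, exists st : R2 * R2, (p`_l : {poly R2})`_j = r0 * st.1 + r1 * st.2) ->
  exists y0 y1, oev (psiP rel) b p = phi2 rel r0 * y0 + phi2 rel r1 * y1.
Proof.
move=> H; have [||q0 [q1 q01]] := choose_poly (r := p)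
  (V := fun r s t => r = i2 r0 * s + i2 r1 * t).
- by rewrite !mulr0 addr0.
- by move=> l; have [q0 [q1 E]] := Palg_split (H l); exists (q0, q1).
exists (oev (psiP rel) b q0), (oev (psiP rel) b q1).
rewrite -!(psiP_const rel) -!oevCM -oevD; congr oev; apply/polyP => l.
by rewrite q01 coefD !coefCM.
Qed.

(** The value at c = u = 0. *)
Definition ev00 (r : R2) : k := r.[0].[0].

Lemma ev00_split (r : R2) : ev00 r = 0 -> exists st : R2 * R2, r = 'X%:P * st.1 + 'X * st.2.
Proof.
rewrite /ev00 => E.
have [t tE] : exists t, r = r.[0]%:P + 'X * t.
  have /factor_theorem [t tE] : root (r - r.[0]%:P) 0.
    by apply/rootP; rewrite hornerD hornerN hornerC subrr.
  by exists t; rewrite mulrC -['X]subr0 -polyC0 -tE addrC subrK.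
have /factor_theorem [s sE] : root r.[0] 0 by apply/rootP.
exists (s%:P, t); rewrite [LHS]tE /=; congr (_ + _).
by rewrite sE polyC0 subr0 polyCM mulrC.
Qed.

(** Modulo [c], the coefficients are polynomials in [u], where [u] is no zero divisor. *)
Lemma u_regular x y : u * x = c * y -> exists z, x = c * z.
Proof.
have [p ->] := ore_span ore x; have [q ->] := ore_span ore y.
move=> xy; have E : oev (psiP rel) b ((i2 'X)%:P * p) = oev (psiP rel) b ((i2 'X%:P)%:P * q).
  by rewrite !oevCM !psiP_const phi2_u phi2_c.
have {}E : (i2 'X)%:P * p = (i2 'X%:P)%:P * q.
  by apply/eqP; rewrite -subr_eq0; apply/eqP/(ore_inj ore); rewrite oevD oevN E subrr.
have {}E l j : 'X * (p`_l : {poly R2})`_j = 'X%:P * (q`_l : {poly R2})`_j :> R2.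
  have := congr1 (fun w : {poly Palg g} => (w`_l : {poly R2})`_j) E.
  by rewrite !coefCM !skew_constE !coefZ.
have [l j|y0 [y1 ->]] := @oev_split 'X%:P 0 p; last first.
  by exists y0; rewrite phi2_c rmorph0 mul0r addr0.
exists (\poly_(n < size (q`_l : {poly R2})`_j) ((q`_l : {poly R2})`_j)`_n.+1, 0).
rewrite mul0r addr0; apply/polyP => n.
have := congr1 (fun r : R2 => r`_n.+1) (E l j); rewrite coefXM coefCM /= => ->.
rewrite coefCM coef_poly; case: ltnP => // qn.
by rewrite nth_default // (leq_trans qn).
Qed.

Variable pi : {rmorphism A -> {poly {poly k}}}.
Hypotheses (pi_a : pi a = 'X%:P) (pi_b : pi b = 'X) (pi_c : pi c = 0) (pi_u : pi u = 0).
Hypothesis pi_t : forall t, pi t%:A = t%:P%:P.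

Lemma pi_phi2 r : pi (phi2 rel r) = (ev00 r)%:P%:P.
Proof.
apply: (poly2_ext (F := pi \o phi2 rel)
  (G := polyC \o (polyC \o (horner_eval (0 : k) \o horner_eval (0 : {poly k}))))) => [t||] /=.
- by rewrite phi2_scalar pi_t /horner_eval !hornerC.
- by rewrite phi2_c pi_c /horner_eval hornerC hornerX !polyC0.
- by rewrite phi2_u pi_u /horner_eval hornerX horner0 !polyC0.
Qed.

Lemma pi_psiP (p : Palg g) : pi (psiP rel p) = (map_poly ev00 (p : {poly R2}))%:P.
Proof.
have ev0 : ev00 0 = 0 by rewrite /ev00 !horner0.
rewrite -[psiP rel p]/(oev (phi2 rel) a p) (oev_sum _ _ (leqnn _)) rmorph_sum.
rewrite -[map_poly _ _]/(\poly_(j < size (p : {poly R2})) ev00 (p : {poly R2})`_j).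
rewrite poly_def rmorph_sum; apply: eq_bigr => j _.
by rewrite rmorphM rmorphXn pi_phi2 pi_a -mul_polyC -polyC_exp -polyCM.
Qed.

(** The quotient by [c] and [u] evaluates the coefficients at c = u = 0. *)
Lemma pi_coef p l j :
  ((pi (oev (psiP rel) b p))`_l)`_j = ev00 ((p`_l : {poly R2})`_j).
Proof.
have ev0 : ev00 0 = 0 by rewrite /ev00 !horner0.
rewrite (oev_sum _ _ (leqnn _)) rmorph_sum /=.
under eq_bigr do rewrite rmorphM rmorphXn pi_psiP pi_b mul_polyC.
transitivity ((\poly_(i < size p) map_poly ev00 (p`_i : {poly R2}))`_l)`_j.
  by rewrite poly_def.
rewrite coef_poly; case: ltnP => [_|pl].
  rewrite -[map_poly _ _]/(\poly_(n < size (p`_l : {poly R2})) ev00 (p`_l : {poly R2})`_n).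
  by rewrite coef_poly; case: ltnP => // pj; rewrite (nth_default _ pj).
by rewrite coef0 [p`_l]nth_default // -[(_ : {poly R2})`_j]/((0 : {poly R2})`_j) coef0.
Qed.

Lemma pi_kernel x : pi x = 0 -> exists y0 y1, x = c * y0 + u * y1.
Proof.
have [p ->] := ore_span ore x => E.
have [l j|y0 [y1 ->]] := @oev_split 'X%:P 'X p.
  by apply: ev00_split; rewrite -pi_coef E !coef0.
by exists y0, y1; rewrite phi2_c phi2_u.
Qed.

Lemma pi_surj p : exists x, pi x = p.
Proof.
elim/poly2_ind: p => [p q [x <-] [y <-]|p q [x <-] [y <-]|t||].
- by exists (x + y); rewrite rmorphD.
- by exists (x * y); rewrite rmorphM.
- by exists t%:A.
- by exists a.
- by exists b.
Qed.

Lemma phi2_inj r : phi2 rel r = 0 -> r = 0.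
Proof.
move=> r0; have E : oev (psiP rel) b (i2 r)%:P = 0 by rewrite oevC psiP_const.
have {}E : i2 r = 0 := polyC_inj (ore_inj ore E).
exact: (@polyC_inj R2 r 0 E).
Qed.

Lemma c_neq0 : c <> 0.
Proof. by rewrite -(phi2_c rel) => /phi2_inj/eqP; rewrite polyC_eq0 polyX_eq0. Qed.

Lemma u_neq0 : u <> 0.
Proof. by rewrite -(phi2_u rel) => /phi2_inj/eqP; rewrite polyX_eq0. Qed.

Definition chi (al be : k) : {rmorphism A -> k} :=
  horner_eval al \o (horner_eval be%:P \o pi).

Lemma chi_a al be : chi al be a = al.
Proof. by rewrite /chi /= pi_a /horner_eval hornerC hornerX. Qed.
Lemma chi_b al be : chi al be b = be.
Proof. by rewrite /chi /= pi_b /horner_eval hornerX hornerC. Qed.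
Lemma chi_c al be : chi al be c = 0.
Proof. by rewrite /chi /= pi_c /horner_eval !horner0. Qed.
Lemma chi_u al be : chi al be u = 0.
Proof. by rewrite /chi /= pi_u /horner_eval !horner0. Qed.
Lemma chi_poly al be p : chi al be (horner_alg c p) = p.[0].
Proof.
by rewrite /chi /= -(phi2_const rel) pi_phi2 /horner_eval !hornerC /ev00 hornerC.
Qed.

(** Moving [a] across both [c] and [u] gives [a - 2 g], and [b] becomes an element [b2] that
    depends on [a]; the values [al] and [be] of [a] and [b] are chosen for the character to vanish
    on both. *)
Lemma lower_left : exists M : lmodType A,
  forall m, has_projective_resolution M m -> (4 <= m)%N.
Proof.
pose al := g.[0] *+ 2; pose be := g.[0] *+ 2.
pose b1 := b - (hG + u) - (a - gG) *+ 2.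
pose b2 := b1 - (hG + u) - (a - gG *+ 2) *+ 2.
pose a2' := a - gG *+ 2.
have gu := rel_comm_u rel g; have gc := c_hornerC g.
have ca2 : c * (a - gG) = a2' * c.
  by rewrite mulrBr rel_ca gc /a2' -mulrBl -addrA -opprD mulr2n.
have ua2 : u * (a - gG) = a2' * u.
  by rewrite mulrBr rel_ua gu /a2' -mulrBl -addrA -opprD mulr2n.
apply: ex_intro; apply: (@normal_sequence_length A k pi (chi al be) c u b a
  _ _ pi_b pi_a (rel_cu rel) _ _ b2 a2').
- exact: pi_surj.
- move=> x; split=> [/pi_kernel [y0 [y1 ->]]|[y ->]].
    have [_ [y0' ->]] := c_normal y0; have [_ [y1' ->]] := u_normal y1.
    by exists (y0', y1').
  by rewrite rmorphD !rmorphM pi_c pi_u !mulr0 addr0.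
- by move=> x /dom [//|/c_neq0].
- move=> x y xu; have [[x' x'E] _] := u_normal x; have [[y' y'E] _] := c_normal y.
  have [z zE] : exists z, x' = c * z by apply: (@u_regular x' y'); rewrite -x'E -y'E.
  have [_ [z1 z1E]] := u_normal z; have [_ [z2 z2E]] := c_normal z1.
  exists z2; apply/eqP; rewrite -subr_eq0; apply/eqP.
  have /dom [//|/u_neq0//] : (x - z2 * c) * u = 0.
  rewrite mulrBl x'E zE mulrA -(rel_cu rel) -mulrA z1E mulrA z2E subrr //.
- exists b1, b1; split; [exact: rel_cb|exact: rel_ub| |].
  + rewrite {1}/b1 mulrBr mulrBr rel_ub -/b1 mulrnAr ua2 -hu_u.
    by rewrite /b2 /a2' [in RHS]mulrBl [in RHS]mulrBl mulrnAl.
  + rewrite {1}/b1 mulrBr mulrBr rel_cb -/b1 mulrnAr ca2 -hu_c.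
    by rewrite /b2 /a2' [in RHS]mulrBl [in RHS]mulrBl mulrnAl.
- by exists (a - gG), (a - gG); split; [exact: rel_ca|exact: rel_ua|exact: ua2|exact: ca2].
- exact: chi_c.
- exact: chi_u.
- rewrite /b2 /b1 !(rmorphB, rmorphD, rmorphMn, chi_a, chi_b, chi_u, chi_poly).
  by rewrite hornerM hornerX mul0r /al /be; ring.
- by rewrite /a2' rmorphB rmorphMn chi_a chi_poly /al subrr.
Qed.

(** In the converse algebra [a] and [b] move across [c] and [u] in the other direction, which
    changes the values of the character. *)
Lemma lower_right : exists M : lmodType A^c,
  forall m, has_projective_resolution M m -> (4 <= m)%N.
Proof.
pose al := - (g.[0] *+ 2); pose be := g.[0] *+ 6.
pose b1 := b + (hG + u + a *+ 2).
pose b2 := b1 + (hG + u + (a + gG) *+ 2).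
pose a2' := a + gG *+ 2.
have gu := rel_comm_u rel g; have gc := c_hornerC g.
have ac : a * c = c * (a + gG) by rewrite mulrDr (rel_ac rel).
have au : a * u = u * (a + gG) by rewrite mulrDr (rel_au rel).
have bc : b * c = c * b1 by rewrite mulrDr (rel_bc rel).
have bu : b * u = u * b1 by rewrite mulrDr (rel_bu rel).
have ac2 : (a + gG) * c = c * a2'.
  by rewrite mulrDl ac -gc /a2' -mulrDr -addrA mulr2n.
have au2 : (a + gG) * u = u * a2'.
  by rewrite mulrDl au -gu /a2' -mulrDr -addrA mulr2n.
have bc2 : b1 * c = c * b2.
  by rewrite {1}/b1 mulrDl [(_ + a *+ 2) * c]mulrDl mulrnAl bc ac hu_c /b2
    [RHS]mulrDr [c * (_ + _ *+ 2)]mulrDr mulrnAr.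
have bu2 : b1 * u = u * b2.
  by rewrite {1}/b1 mulrDl [(_ + a *+ 2) * u]mulrDl mulrnAl bu au hu_u /b2
    [RHS]mulrDr [u * (_ + _ *+ 2)]mulrDr mulrnAr.
apply: ex_intro; apply: (@normal_sequence_length A^c k (comm_conv pi)
  (comm_conv (chi al be)) c u b a _ _ pi_b pi_a _ _ _ b2 a2').
- exact: pi_surj.
- move=> x; split=> [/pi_kernel [y0 [y1 ->]]|[y ->]]; first by exists (y0, y1).
  change (pi (c * y.1 + u * y.2) = 0).
  by rewrite rmorphD !rmorphM pi_c pi_u !mul0r addr0.
- exact/esym/(rel_cu rel).
- by move=> x /dom [/c_neq0|].
- by move=> x y /u_regular.
- by exists b1, b1; split.
- by exists (a + gG), (a + gG); split.
- exact: chi_c.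
- exact: chi_u.
- change (chi al be b2 = 0).
  rewrite /b2 /b1 !(rmorphB, rmorphD, rmorphMn, chi_a, chi_b, chi_u, chi_poly).
  by rewrite hornerM hornerX mul0r /al /be; ring.
- change (chi al be a2' = 0).
  by rewrite /a2' rmorphD rmorphMn chi_a chi_poly /al addNr.
Qed.

End LowerGldim.

Section GfLower.
Variables (k : fieldType) (g : {poly k}).
Local Notation B := {poly {poly k}}.

Definition pi_scal : {rmorphism k -> B} := polyC \o polyC.
Definition pi_gens (i : 'I_4) : B := nth 0 [:: 'X%:P; 'X; 0; 0] i.

Fact pi_scal_comm t i : pi_scal t * pi_gens i = pi_gens i * pi_scal t.
Proof. exact: mulrC. Qed.

Definition pi_free : {rmorphism free4 k -> B} := free_morph pi_scal_comm.

Lemma pi_free_gen n : (n < 4)%N ->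
  pi_free (free4_gen k (inord n)) = nth 0 [:: 'X%:P; 'X; 0; 0] n.
Proof. by move=> n4; rewrite /pi_free free_morph_gen /pi_gens inordK. Qed.

Lemma pi_free_horner p :
  pi_free (horner_alg (free4_gen k (inord 2)) p) = p.[0]%:P%:P.
Proof.
elim/poly_ind: p => [|p t IHp]; first by rewrite rmorph0 (rmorph0 pi_free) horner0 !polyC0.
rewrite horner_alg_MXaddC (rmorphD pi_free) (rmorphM pi_free) pi_free_gen //.
by rewrite mulr0 add0r /pi_free free_morph_scalar hornerMXaddC mulr0 add0r.
Qed.

Lemma pi_free_relators x : x \in Gf_free_relators g -> pi_free x = 0.
Proof.
have P0 : pi_free (free4_gen k (inord 0)) = 'X%:P := @pi_free_gen 0 isT.
have P1 : pi_free (free4_gen k (inord 1)) = 'X := @pi_free_gen 1 isT.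
have P2 : pi_free (free4_gen k (inord 2)) = 0 := @pi_free_gen 2 isT.
have P3 : pi_free (free4_gen k (inord 3)) = 0 := @pi_free_gen 3 isT.
apply: (Gf_relators_kill pi_free_horner P0 P1 P2 P3);
  by rewrite ?hornerM ?hornerX ?mul0r ?mulr0 ?polyC0 ?polyC0 ?addr0 ?subr0 ?mul0r ?addr0 // mulrC.
Qed.

Definition Gf_pi : {rmorphism Gf g -> B} := qlift_morph (Gf_proper g) pi_free_relators.

Lemma Gf_pi_proj x : Gf_pi (qproj (Gf_proper g) x) = pi_free x.
Proof. by rewrite /Gf_pi; apply: (@qliftE _ _ _ (Gf_proper g) _ _ pi_free_relators). Qed.

Lemma Gf_pi_scalar t : Gf_pi t%:A = t%:P%:P.
Proof. by rewrite Gf_scalar Gf_pi_proj /pi_free free_morph_scalar. Qed.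

Lemma Gf_pi_gen n (n4 : (n < 4)%N) :
  Gf_pi (qproj (Gf_proper g) (free4_gen k (inord n))) = nth 0 [:: 'X%:P; 'X; 0; 0] n.
Proof. exact: etrans (Gf_pi_proj _) (pi_free_gen n4). Qed.

Lemma Gf_lower_left : exists M : lmodType (Gf g),
  forall m, has_projective_resolution M m -> (4 <= m)%N.
Proof.
apply: (lower_left (Gf_ore g) (@Gf_domain k g) (pi := Gf_pi)).
- exact: (@Gf_pi_gen 0).
- exact: (@Gf_pi_gen 1).
- exact: (@Gf_pi_gen 2).
- exact: (@Gf_pi_gen 3).
- exact: Gf_pi_scalar.
Qed.

Lemma Gf_lower_right : exists M : lmodType (Gf g)^c,
  forall m, has_projective_resolution M m -> (4 <= m)%N.
Proof.
apply: (lower_right (Gf_ore g) (@Gf_domain k g) (pi := Gf_pi)).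
- exact: (@Gf_pi_gen 0).
- exact: (@Gf_pi_gen 1).
- exact: (@Gf_pi_gen 2).
- exact: (@Gf_pi_gen 3).
- exact: Gf_pi_scalar.
Qed.

Theorem Gf_gldim (R : realType) :
  left_gldim (Gf g) R = (4%:R)%:E /\ right_gldim (Gf g) R = (4%:R)%:E.
Proof.
split; apply: left_gldim_eq.
- exact: Gf_resolution.
- exact: Gf_lower_left.
- exact: Gf_conv_resolution.
- exact: Gf_lower_right.
Qed.

End GfLower.

(** * The center *)

Lemma coef_euler (k : comNzRingType) (r : {poly {poly k}}) i j :
  (euler r)`_j`_i = r`_j`_i *+ (i + j).
Proof.
rewrite coefD coefXM coef_map /euler1 coefD coefXM coef_deriv.
have -> : (if j == 0%N then 0 else r`_j.-1.+1 *+ j.-1.+1)`_i = r`_j`_i *+ j.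
  by case: j => [|j]; rewrite ?coef0 ?mulr0n ?coefMn.
by rewrite addrC mulrnDr; congr (_ + _); case: i => [|i]; rewrite ?mulr0n //= coef_deriv.
Qed.

Section Weights.
Variables (k : fieldType) (g : {poly k}) (A : algType k) (a b c u : A).
Hypothesis rel : Gf_relations g a b c u.
Hypothesis ore : ore_ext (psiP rel) b (sigma g) (@delta k g).

Local Notation R2 := {poly {poly k}}.
Local Notation phi := (phi2 rel).
Local Notation i2 := (skew_const (Pdata g)).
Local Notation D := (Dder g).

(** The coefficient in [{poly {poly k}}] of [a ^+ n * b ^+ l], coefficients being written on the
    left. *)
Definition kap (n l : nat) (x : A) : R2 := ((sval (cid (ore_span ore x)))`_l : {poly R2})`_n.

Lemma kapE n l p : kap n l (oev (psiP rel) b p) = (p`_l : {poly R2})`_n.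
Proof.
rewrite /kap; case: (cid _) => q /= E; suff -> : p = q by [].
apply/eqP; rewrite -subr_eq0; apply/eqP/(ore_inj ore).
by rewrite oevD oevN E subrr.
Qed.

Lemma kapD n l x y : kap n l (x + y) = kap n l x + kap n l y.
Proof.
have [p ->] := ore_span ore x; have [q ->] := ore_span ore y.
rewrite -oevD !kapE [(p + q)`_l]coefD; exact: (@coefD _ (p`_l : {poly R2}) q`_l n).
Qed.

Fact kap_zmod n l : zmod_morphism (kap n l).
Proof. by move=> x y; apply: (addIr (kap n l y)); rewrite -kapD !subrK. Qed.
HB.instance Definition _ n l := GRing.isZmodMorphism.Build A R2 (kap n l) (kap_zmod n l).

Lemma kap0 n l : kap n l 0 = 0. Proof. exact: raddf0. Qed.
Lemma kapB n l x y : kap n l (x - y) = kap n l x - kap n l y. Proof. exact: raddfB. Qed.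
Lemma kapN n l x : kap n l (- x) = - kap n l x. Proof. exact: raddfN. Qed.

Lemma kapMl n l r x : kap n l (phi r * x) = r * kap n l x.
Proof.
have [p ->] := ore_span ore x.
by rewrite -(psiP_const rel) -oevCM !kapE coefCM skew_constE coefZ.
Qed.

Definition mono (r : R2) (n l : nat) : A := phi r * a ^+ n * b ^+ l.

Lemma kap_mono r n l n' l' :
  kap n l (mono r n' l') = if (n == n') && (l == l') then r else 0.
Proof.
rewrite /mono -mulrA kapMl.
have -> : a ^+ n' * b ^+ l' = oev (psiP rel) b ((skew_var (Pdata g) ^+ n')%:P * 'X^l').
  by rewrite oevMXn oevC rmorphXn psiP_var.
rewrite kapE mul_polyC coefZ coefXn andbC; case: eqP => _ /=; last first.
  by rewrite mulr0 -[(_ : {poly R2})`_n]/((0 : {poly R2})`_n) coef0 mulr0.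
rewrite mulr1 skew_varXn coefXn; case: eqP => _; rewrite ?mulr1 ?mulr0 //.
Qed.

(** Weight less than [m], for [a] of weight 1 and [b] of weight 2. A record, to keep the
    definition from being unfolded by unification. *)
Record W (m : nat) (x : A) : Prop := WProp {
  W_kap : forall n l, (m <= n + l.*2)%N -> kap n l x = 0 }.

Lemma W0 m : W m 0. Proof. by split=> n l _; apply: kap0. Qed.
Lemma WD m x y : W m x -> W m y -> W m (x + y).
Proof. by move=> [wx] [wy]; split=> n l ml; rewrite kapD wx // wy // addr0. Qed.
Lemma WN m x : W m x -> W m (- x).
Proof. by move=> [wx]; split=> n l ml; rewrite kapN wx // oppr0. Qed.
Lemma WB m x y : W m x -> W m y -> W m (x - y).
Proof. by move=> wx wy; apply: WD => //; apply: WN. Qed.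
Lemma Wle m m' x : (m <= m')%N -> W m x -> W m' x.
Proof. by move=> mm [wx]; split=> n l ml; apply: wx; apply: leq_trans ml. Qed.
Lemma WMl m r x : W m x -> W m (phi r * x).
Proof. by move=> [wx]; split=> n l ml; rewrite kapMl wx // mulr0. Qed.
Lemma Wmono r n l m : (n + l.*2 < m)%N -> W m (mono r n l).
Proof.
move=> nl; split=> n' l' ml; rewrite kap_mono; case: eqP => //= En; case: eqP => //= El.
by move: nl; rewrite -En -El ltnNge ml.
Qed.

Lemma W_ex x : exists m, W m x.
Proof.
have [p ->] := ore_span ore x.
pose F (l : 'I_(size p)) := addn (size (p`_l : {poly R2})) l.*2.
exists (\max_l F l)%N; split=> n l H; rewrite kapE.
have [lp|pl] := ltnP l (size p); last first.
  by rewrite [p`_l]nth_default // -[(_ : {poly R2})`_n]/((0 : {poly R2})`_n) coef0.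
apply: nth_default; have := leq_trans (leq_bigmax (F := F) (Ordinal lp)) H.
by rewrite /F /= leq_add2r.
Qed.

(** Additive statements about elements of weight less than [m] need only be checked on monomials.
    *)
Lemma W_ind m (V : A -> Prop) :
  V 0 -> (forall x y, V x -> V y -> V (x + y)) ->
  (forall r n l, (n + l.*2 < m)%N -> V (mono r n l)) -> forall x, W m x -> V x.
Proof.
move=> V0 VD Vm x; have [p ->] := ore_span ore x => -[H].
rewrite (oev_sum _ _ (leqnn _)); elim/big_ind: _ => // l _.
have -> : psiP rel p`_l * b ^+ l =
    \sum_(n < size (p`_l : {poly R2})) mono ((p`_l : {poly R2})`_n) n l.
  rewrite -[psiP rel _]/(oev phi a (p`_l : {poly R2})) (oev_sum _ _ (leqnn _)).
  by rewrite mulr_suml.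
elim/big_ind: _ => // n _; have [/Vm //|ml] := ltnP (n + l.*2) m.
by have := H n l ml; rewrite kapE => ->; rewrite /mono rmorph0 !mul0r.
Qed.

Lemma W_lt0 x : W 0 x -> x = 0.
Proof. by elim/W_ind => // y z -> ->; rewrite addr0. Qed.

Lemma a_phi r : a * phi r = phi r * a + phi (D r).
Proof. exact: (phi2_rel rel). Qed.
Lemma b_phi r : b * phi r = phi r * b + phi (d0 g r) + phi (d1 r) * a.
Proof.
rewrite -!(psiP_const rel) (psiP_rel rel) sigma_const delta_constE psiP_quad.
by rewrite rmorph0 !mul0r addr0 !psiP_const addrA.
Qed.

Lemma a_mono r n l : a * mono r n l = mono r n.+1 l + mono (D r) n l.
Proof. by rewrite /mono !mulrA a_phi !mulrDl -!mulrA exprS !mulrA. Qed.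

Lemma mono_b r n l j : mono r n l * b ^+ j = mono r n (l + j).
Proof. by rewrite /mono -mulrA -exprD. Qed.

Lemma monoMl s r n l : phi s * mono r n l = mono (s * r) n l.
Proof. by rewrite /mono rmorphM !mulrA. Qed.

Lemma monoD r s n l : mono (r + s) n l = mono r n l + mono s n l.
Proof. by rewrite /mono rmorphD !mulrDl. Qed.


Lemma WaM m x : W m x -> W m.+1 (a * x).
Proof.
move=> wx; apply: (W_ind (V := fun x => W m.+1 (a * x)) _ _ _ wx) =>
  [|x1 x2 V1 V2|r n l nl]; first by rewrite mulr0; apply: W0.
  by rewrite mulrDr; apply: WD.
by rewrite a_mono; apply: WD; apply: Wmono; rewrite ?addSn // ltnW.
Qed.


Lemma WMb m x l : W m x -> W (m + l.*2) (x * b ^+ l).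
Proof.
move=> wx; apply: (W_ind (V := fun x => W (m + l.*2) (x * b ^+ l)) _ _ _ wx) =>
  [|x1 x2 V1 V2|r n j nj]; first by rewrite mul0r; apply: W0.
  by rewrite mulrDl; apply: WD.
by rewrite mono_b; apply: Wmono; lia.
Qed.

Lemma ban n : W n.+2 (b * a ^+ n - mono 1 n 1).
Proof.
elim: n => [|n IHn]; first by rewrite /mono rmorph1 !expr0 !mul1r mulr1 expr1 subrr; apply: W0.
have E : b * a ^+ n = mono 1 n 1 + (b * a ^+ n - mono 1 n 1) by rewrite addrC subrK.
have -> : b * a ^+ n.+1 - mono 1 n.+1 1 = a * (b * a ^+ n - mono 1 n 1)
    + mono (D 1) n 1 + phi (h2 g) * (b * a ^+ n) + mono (h2 g - 'X) n.+1 0.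
  have -> : b * a ^+ n.+1 = a * (b * a ^+ n) + phi (h2 g) * (b * a ^+ n)
      + mono (h2 g - 'X) n.+1 0.
    rewrite exprS mulrA (rel_ba rel) mulrDl [(a + _) * b]mulrDl mulrDl -!mulrA.
    rewrite /mono rmorphB phi2_u phi2_const.
    by rewrite expr0 mulr1 exprS.
  by rewrite mulrBr a_mono opprD !addrA addrNK addrAC [X in X + _ = _]addrAC.
have wb : W n.+3 (b * a ^+ n).
  by rewrite E; apply: WD; [apply: Wmono; rewrite /=; lia|apply: Wle IHn].
apply: WD; last by apply: Wmono; rewrite addn0.
apply: WD; last exact: WMl.
by apply: WD; [apply: WaM|apply: Wmono; rewrite /=; lia].
Qed.

(** Left multiplication by [b] is not homogeneous: it also yields terms of weight one more than
    the monomial has, which are below the leading weight. *)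
Lemma b_mono r n l : W (n + l.*2).+2 (b * mono r n l - mono r n l.+1).
Proof.
have -> : b * mono r n l - mono r n l.+1 =
    phi r * ((b * a ^+ n - mono 1 n 1) * b ^+ l) + (mono (d0 g r) n l + mono (d1 r) n.+1 l).
  have -> : b * mono r n l =
      phi r * (b * a ^+ n) * b ^+ l + mono (d0 g r) n l + mono (d1 r) n.+1 l.
    by rewrite /mono !mulrA b_phi !mulrDl exprS !mulrA.
  rewrite [phi r * (_ * b ^+ l)]mulrA mulrBr mulrBl monoMl mulr1 mono_b add1n.
  by rewrite [RHS]addrA [LHS]addrAC [X in X + _ = _]addrAC.
apply: WD; first by rewrite -!addSn; apply/WMl/WMb/ban.
by apply: WD; apply: Wmono; lia.
Qed.

Lemma WbM m x : W m x -> W m.+2 (b * x).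
Proof.
move=> wx; apply: (W_ind (V := fun x => W m.+2 (b * x)) _ _ _ wx) =>
  [|x1 x2 V1 V2|r n l nl]; first by rewrite mulr0; apply: W0.
  by rewrite mulrDr; apply: WD.
rewrite -(subrK (mono r n l.+1) (b * _)); apply: WD; last by apply: Wmono; lia.
by apply: (Wle _ (b_mono r n l)); lia.
Qed.

Lemma WaM_pred m x : W m.-1 x -> W m (a * x).
Proof.
case: m => [/W_lt0 ->|m]; last exact: WaM.
by rewrite mulr0; apply: W0.
Qed.

Local Notation C := ('X%:P : R2).
Local Notation gg := (g%:P : R2).
Local Notation hh := (h2 g).

Lemma D_C : D C = C * gg. Proof. by rewrite /Dder euler_c mulrC. Qed.
Lemma mono0 n l : mono 0 n l = 0. Proof. by rewrite /mono rmorph0 !mul0r. Qed.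
Lemma phi_mono r : phi r = mono r 0 0. Proof. by rewrite /mono !expr0 !mulr1. Qed.
Lemma c_mono : c = mono C 0 0. Proof. by rewrite -phi_mono phi2_c. Qed.

Lemma b_mono0 r l : b * mono r 0 l = mono r 0 l.+1 + (mono (d0 g r) 0 l + mono (d1 r) 1 l).
Proof.
rewrite /mono !expr0 !expr1 !mulr1 mulrA b_phi !mulrDl exprS -!mulrA addrA //.
Qed.

Lemma bl_c l : W l.*2.+1 (b ^+ l.+1 * c - (mono C 0 l.+1 + mono (C *+ l.+1.*2) 1 l)).
Proof.
elim: l => [|l IHl].
  have -> : b ^+ 1 * c = mono C 0 1 + (mono (d0 g C) 0 0 + mono (C + C) 1 0).
    by rewrite expr1 {1}c_mono b_mono0 d1_c.
  rewrite -[C *+ 1.*2]/(C + C) addrCA addrK.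
  exact: Wmono.
rewrite exprS -mulrA; move: IHl; set e := (X in W _ X) => We.
have -> : b ^+ l.+1 * c = e + (mono C 0 l.+1 + mono (C *+ l.+1.*2) 1 l) by rewrite subrK.
clearbody e; rewrite !mulrDr b_mono0 d1_c -mulr2n.
have -> : mono (C *+ l.+2.*2) 1 l.+1 = mono (C *+ l.+1.*2) 1 l.+1 + mono (C *+ 2) 1 l.+1.
  by rewrite -monoD -mulrnDr; congr (mono (_ *+ _) _ _); lia.
have := b_mono (C *+ l.+1.*2) 1 l; set e2 := (X in W _ X) => We2.
rewrite -[b * mono (C *+ l.+1.*2) 1 l](subrK (mono (C *+ l.+1.*2) 1 l.+1)) -/e2.
set M1 := mono C 0 l.+2; set M2 := mono (C *+ l.+1.*2) 1 l.+1.
set M3 := mono (C *+ 2) 1 l.+1; set M4 := mono (d0 g C) 0 l.+1.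
have -> : b * e + (M1 + (M4 + M3) + (e2 + M2)) - (M1 + (M2 + M3)) = b * e + (e2 + M4).
  rewrite -addrA; congr (_ + _); apply/eqP; rewrite subr_eq; apply/eqP.
  by rewrite [LHS](AC ((1*2)*2) ((4*2)*(1*(5*3)))).
apply: WD; first exact: WbM.
by apply: WD; [apply: Wle We2; lia|apply: Wmono; lia].
Qed.
(** Commuting [c] out on the left: each [a] contributes $cg$ and lowers the weight by 1, each [b]
    contributes [2 c a] and also lowers it by 1. *)
Lemma anbl_c n l : W (n + l.*2).-1 (a ^+ n * b ^+ l * c -
  (mono C n l + (mono (C * gg *+ n) n.-1 l + mono (C *+ l.*2) n.+1 l.-1))).
Proof.
elim: n => [|n IHn].
  rewrite expr0 mul1r mulr0n mono0 add0r add0n; case: l => [|l]; last exact: bl_c.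
  by rewrite expr0 mul1r mulr0n mono0 addr0 c_mono subrr; apply: W0.
move: IHn; set e := (X in W _ X) => We.
have E : a ^+ n * b ^+ l * c = e + (mono C n l +
    (mono (C * gg *+ n) n.-1 l + mono (C *+ l.*2) n.+1 l.-1)) by rewrite subrK.
rewrite exprS -!mulrA [a ^+ n * _]mulrA E; clearbody e; rewrite !mulrDr !a_mono.
have -> : mono (C * gg *+ n.+1) n.+1.-1 l = mono (C * gg *+ n) n.-1.+1 l + mono (D C) n l.
  by rewrite D_C mulrSr monoD; case: (n) => [|//]; rewrite mulr0n !mono0.
set P := mono C n.+1 l; set Q := mono (D C) n l; set S := mono _ n.-1.+1 l.
set E1 := mono _ n.-1 l; set T := mono _ n.+2 l.-1; set E2 := mono _ n.+1 l.-1.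
have -> : a * e + (P + Q + (S + E1 + (T + E2))) - (P + (S + Q + T)) = a * e + (E1 + E2).
  rewrite -addrA; congr (_ + _); apply/eqP; rewrite subr_eq; apply/eqP.
  by rewrite [LHS](AC (2*(2*2)) ((4*6)*(1*((3*2)*5)))).
apply: WD; first exact: WaM_pred.
apply: WD; rewrite /E1 /E2.
  case: (n) => [|n']; first by rewrite mulr0n raddf0 mono0; apply: W0.
  by apply: Wmono; lia.
case: (l) => [|l']; first by rewrite mulr0n raddf0 mono0; apply: W0.
by apply: Wmono; lia.
Qed.

Lemma bl_a l : W l.*2 (b ^+ l * a - (mono 1 1 l + mono (hh *+ l) 0 l)).
Proof.
elim: l => [|l IHl].
  by rewrite mulr0n mono0 addr0 /mono rmorph1 !expr0 expr1 !mul1r mulr1 subrr; apply: W0.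
move: IHl; set e := (X in W _ X) => We.
have E : b ^+ l * a = e + (mono 1 1 l + mono (hh *+ l) 0 l) by rewrite subrK.
rewrite exprS -mulrA E; clearbody e; rewrite !mulrDr b_mono0.
have -> : b * mono 1 1 l = mono 1 1 l.+1 + (mono hh 0 l.+1 + mono (hh - 'X) 1 l).
  rewrite /mono rmorph1 !mul1r expr1 mulrA (rel_ba rel) mulrDl [(a + _) * b]mulrDl.
  by rewrite mulrDl -!mulrA rmorphB phi2_u phi2_const expr0 mul1r -exprS addrA.
rewrite mulrSr [mono (hh *+ l + hh) _ _]monoD; set E1 := mono (hh - 'X) 1 l.
set E2 := mono (d0 g _) 0 l; set E3 := mono (d1 _) 1 l;
set P := mono 1 1 _; set Q := mono hh 0 _; set S := mono _ 0 _.
have -> : b * e + (P + (Q + E1) + (S + (E2 + E3))) - (P + (S + Q)) = b * e + (E1 + (E2 + E3)).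
  rewrite -addrA; congr (_ + _); apply/eqP; rewrite subr_eq; apply/eqP.
  by rewrite [LHS](AC ((1*2)*2) ((3*5)*(1*(4*2)))).
apply: WD; first by apply: WbM.
by apply: WD; [|apply: WD]; apply: Wmono; lia.
Qed.

Lemma D1 : D 1 = 0.
Proof. by rewrite -[1]/(1%:P%:P) /Dder euler_scalar mulr0. Qed.

(** Commuting [a] with [b] contributes $h$ at the same power of [b]. *)
Lemma anbl_a n l : W (n + l.*2) (a ^+ n * b ^+ l * a - (mono 1 n.+1 l + mono (hh *+ l) n l)).
Proof.
elim: n => [|n IHn]; first by rewrite expr0 mul1r; apply: bl_a.
move: IHn; set e := (X in W _ X) => We.
have E : a ^+ n * b ^+ l * a = e + (mono 1 n.+1 l + mono (hh *+ l) n l) by rewrite subrK.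
rewrite exprS -!mulrA [a ^+ n * _]mulrA E; clearbody e; rewrite !mulrDr !a_mono D1 mono0 addr0.
set P := mono 1 _ _; set S := mono _ n.+1 l; set E1 := mono _ n l.
have -> : a * e + (P + (S + E1)) - (P + S) = a * e + E1.
  rewrite -addrA; congr (_ + _); apply/eqP; rewrite subr_eq; apply/eqP.
  by rewrite [LHS](AC (1*2) (3*(1*2))).
by apply: WD; [apply: WaM|apply: Wmono; lia].
Qed.

Lemma mono_c r n l : W (n + l.*2).-1 (mono r n l * c - c * mono r n l -
  (mono (r * (C * gg) *+ n) n.-1 l + mono (r * C *+ l.*2) n.+1 l.-1)).
Proof.
have cE : c * mono r n l = mono (r * C) n l.
  by rewrite mulrC -monoMl phi2_c.
have mE : mono r n l * c = phi r * (a ^+ n * b ^+ l * c) by rewrite /mono !mulrA.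
have := WMl r (anbl_c n l); rewrite mulrBr !mulrDr !monoMl -!mulrnAr cE mE.
by rewrite opprD addrA.
Qed.
Lemma mono_a r n l : W (n + l.*2)
  (a * mono r n l - mono r n l * a - (mono (D r) n l - mono (r * hh *+ l) n l)).
Proof.
have mE : mono r n l * a = phi r * (a ^+ n * b ^+ l * a) by rewrite /mono !mulrA.
have H := WN (WMl r (anbl_a n l)).
move: H; rewrite mulrBr mulrDr !monoMl mulr1 -mE a_mono mulrnAr !opprB.
set N := mono r n.+1 l; set V := mono (_ *+ l) n l; set M := mono (D r) n l.
have -> // : N + M - mono r n l * a + (V - M) = N + V - mono r n l * a.
by rewrite [LHS](AC (3*2) ((1*4*3)*(2*5))) /= subrr addr0.
Qed.

Definition zz : A := horner_alg c g * b + (horner_alg c g - u) * a - a ^+ 2.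

(** The leading part of [z] is [g b - a ^+ 2]. *)
Lemma mono_z r n l : W (n + l.*2).+2 (zz * mono r n l - (mono (gg * r) n l.+1 - mono r n.+2 l)).
Proof.
have -> : zz * mono r n l - (mono (gg * r) n l.+1 - mono r n.+2 l) =
    phi gg * (b * mono r n l - mono r n l.+1) + (phi (gg - 'X) * (a * mono r n l)
      - (mono (D r) n.+1 l + a * mono (D r) n l)).
  have -> : zz * mono r n l = phi gg * (b * mono r n l) + phi (gg - 'X) * (a * mono r n l)
      - (mono r n.+2 l + (mono (D r) n.+1 l + a * mono (D r) n l)).
    have aa : a ^+ 2 * mono r n l = mono r n.+2 l + (mono (D r) n.+1 l + a * mono (D r) n l).
      by rewrite expr2 -mulrA a_mono mulrDr a_mono addrA.
    by rewrite /zz [LHS]mulrBl mulrDl aa -!mulrA rmorphB phi2_u phi2_const.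
  rewrite mulrBr monoMl; move: (phi gg * _) (phi (gg - _) * _) (mono (gg * r) _ _) => X Y M.
  move: (mono r n.+2 l) (mono (D r) n.+1 l + _) => N E.
  by rewrite opprB opprD [LHS](AC ((2*2)*2) (((1*6)*(2*4))*(3*5))) /= addNr addr0.
have m1 : W (n + l.*2).+1 (mono r n l) by apply: Wmono.
have m2 : W (n + l.*2).+1 (mono (D r) n l) by apply: Wmono.
apply: WD; first exact/WMl/b_mono.
apply: WB; first exact/WMl/WaM.
by apply: WD; [apply: Wmono; lia|apply: WaM].
Qed.
(** The coefficient of weight [m.-1] of the commutator with [c] involves the leading coefficients
    only; setting it to zero gives the recurrence for the leading term of a central element. *)
Lemma kap_c m x n l : W m.+1 x -> (n + l.*2).+1 = m ->
  kap n l (x * c - c * x) = kap n.+1 l x * (C * gg) *+ n.+1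
    + (if n is n'.+1 then kap n' l.+1 x * C *+ l.+1.*2 else 0).
Proof.
move=> wx nlm; apply: (W_ind (V := fun x => kap n l (x * c - c * x) =
  kap n.+1 l x * (C * gg) *+ n.+1
    + (if n is n'.+1 then kap n' l.+1 x * C *+ l.+1.*2 else 0)) _ _ _ wx).
- rewrite mul0r mulr0 subrr !kap0 mul0r mul0rn add0r; case: (n) => [//|n'].
  by rewrite kap0 mul0r mul0rn.
- move=> x1 x2; cbv beta => E1 E2.
  have -> : (x1 + x2) * c - c * (x1 + x2) = (x1 * c - c * x1) + (x2 * c - c * x2).
    by rewrite mulrDl mulrDr opprD addrACA.
  transitivity (kap n l (x1 * c - c * x1) + kap n l (x2 * c - c * x2)); first by rewrite -kapD.
  rewrite E1 E2 kapD mulrDl mulrnDl addrACA; congr (_ + _).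
  by case: (n) => [|n']; rewrite ?addr0 // kapD mulrDl mulrnDl.
- move=> r n' l' H; have [E] := mono_c r n' l'.
  have {}E : kap n l (mono r n' l' * c - c * mono r n' l' -
     (mono (r * (C * gg) *+ n') n'.-1 l' + mono (r * C *+ l'.*2) n'.+1 l'.-1)) = 0.
    by apply: E; lia.
  move: E; rewrite kapB => /subr0_eq ->; rewrite kapD !kap_mono; congr (_ + _).
    case: n' H => [|n'] H; first by rewrite mulr0n if_same mul0r mul0rn.
    by rewrite eqSS /=; case: (_ && _) / andP => [[/eqP -> _]//|_]; rewrite mul0r mul0rn.
  case: l' H => [|l'] H.
    rewrite mulr0n if_same; case: (n) => [//|n1]; rewrite kap_mono andbF mul0r mul0rn //.
  case: (n) => [//|n1]; rewrite kap_mono !eqSS /=.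
  by case: (_ && _) / andP => [[_ /eqP ->]//|_]; rewrite mul0r mul0rn.
Qed.

(** For [l = 0] the leading coefficient of the commutator with [a] is a derivative. *)
Lemma kap_a m x : W m.+1 x -> kap m 0 (a * x - x * a) = D (kap m 0 x).
Proof.
move=> wx; apply: (W_ind (V := fun x => kap m 0 (a * x - x * a) = D (kap m 0 x)) _ _ _ wx).
- by rewrite mul0r mulr0 subrr kap0 raddf0.
- move=> x1 x2; cbv beta => E1 E2.
  have -> : a * (x1 + x2) - (x1 + x2) * a = (a * x1 - x1 * a) + (a * x2 - x2 * a).
    by rewrite mulrDl mulrDr opprD addrACA.
  transitivity (kap m 0 (a * x1 - x1 * a) + kap m 0 (a * x2 - x2 * a)); first by rewrite -kapD.
  by rewrite E1 E2 kapD raddfD.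
- move=> r n l H; have [E] := mono_a r n l.
  have {}E := E m 0 _; move: E; rewrite kapB => E.
  have {}E := subr0_eq (E ltac:(lia)); rewrite {}E kapB !kap_mono.
  case: eqP => [_|_] /=; last by rewrite subr0 raddf0.
  by case: l H => [|l] H; rewrite /= ?mulr0n subr0 ?raddf0.
Qed.

Lemma kap_z m x : W m.+1 x -> kap m.+2 0 (zz * x) = - kap m 0 x.
Proof.
move=> wx; apply: (W_ind (V := fun x => kap m.+2 0 (zz * x) = - kap m 0 x) _ _ _ wx).
- by rewrite mulr0 !kap0 oppr0.
- by move=> x1 x2; cbv beta => E1 E2; rewrite mulrDr !kapD E1 E2 opprD.
- move=> r n l H; have [E] := mono_z r n l.
  have {}E := E m.+2 0 _; move: E; rewrite kapB => E.
  have {}E := subr0_eq (E ltac:(lia)); rewrite {}E kapB !kap_mono.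
  by rewrite andbF sub0r !eqSS.
Qed.

Lemma WzM m x : W m.+1 x -> W m.+3 (zz * x).
Proof.
move=> wx; apply: (W_ind (V := fun x => W m.+3 (zz * x)) _ _ _ wx).
- by rewrite mulr0; apply: W0.
- by move=> x1 x2 E1 E2; rewrite mulrDr; apply: WD.
- move=> r n l H; rewrite -(subrK (mono (gg * r) n l.+1 - mono r n.+2 l) (zz * _)).
  apply: WD; first by apply: (Wle _ (mono_z r n l)); lia.
  by apply: WB; apply: Wmono; lia.
Qed.

Lemma mono1 : mono 1 0 0 = 1. Proof. by rewrite /mono rmorph1 !expr0 !mulr1. Qed.

Lemma W_zexp n : W n.*2.+1 (zz ^+ n).
Proof.
elim: n => [|n IHn]; first by rewrite expr0 -mono1; apply: Wmono.
by rewrite exprS; apply: WzM.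
Qed.

Lemma kap_zexp n : kap n.*2 0 (zz ^+ n) = (-1) ^+ n.
Proof.
elim: n => [|n IHn]; first by rewrite expr0 -mono1 kap_mono.
by rewrite exprS kap_z ?IHn ?exprS ?mulN1r //; apply: W_zexp.
Qed.



(** A common shape for both sides of the commutation of [z] with the coefficients. *)
Definition quadb (p0 p1 p2 p3 : R2) : A := phi p0 + phi p1 * a + phi p2 * (a * a) + phi p3 * b.

Lemma quadbD p0 p1 p2 p3 q0 q1 q2 q3 :
  quadb p0 p1 p2 p3 + quadb q0 q1 q2 q3 = quadb (p0 + q0) (p1 + q1) (p2 + q2) (p3 + q3).
Proof.
by rewrite /quadb !(rmorphD phi) !mulrDl [LHS](AC (4*4) ((1*5)*(2*6)*(3*7)*(4*8))).
Qed.
Lemma quadbMl s p0 p1 p2 p3 :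
  phi s * quadb p0 p1 p2 p3 = quadb (s * p0) (s * p1) (s * p2) (s * p3).
Proof. by rewrite /quadb !(rmorphM phi) !mulrDr !mulrA. Qed.
Lemma quadbN p0 p1 p2 p3 : - quadb p0 p1 p2 p3 = quadb (- p0) (- p1) (- p2) (- p3).
Proof. by rewrite /quadb !(rmorphN phi) !mulNr !opprD. Qed.

Lemma zz_quadb : zz = quadb 0 (gg - 'X) (-1) gg.
Proof.
rewrite /zz /quadb rmorph0 add0r (rmorphN phi) rmorph1 mulN1r (rmorphB phi) phi2_const phi2_u expr2.
by rewrite [RHS]addrC addrA.
Qed.

(** Both [c] and [u] are homogeneous of degree 1 for the Euler derivation. *)
Lemma zz_homog r : euler r = r -> d0 g r = r * (hh + 'X) -> d1 r = r + r -> zz * phi r = phi r * zz.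
Proof.
move=> Er d0r d1r.
have Dr : D r = gg * r by rewrite /Dder Er.
have DDr : D (gg * r) = gg * (gg * r + hh * r) by rewrite /Dder eulerM Er euler_g.
have -> : zz * phi r = phi gg * quadb (d0 g r) (d1 r) 0 r
    + (phi (gg - 'X) * quadb (D r) r 0 0 - quadb (D (D r)) (D r + D r) r 0).
  rewrite /zz 2!mulrDl mulNr expr2 -!mulrA b_phi a_phi -addrA; congr (_ + (_ - _)).
  - rewrite phi2_const; congr (_ * _);
    by rewrite /quadb rmorph0 mul0r addr0 -!addrA [LHS]addrC -!addrA.
  - rewrite rmorphB phi2_const phi2_u; congr (_ * _).
    by rewrite /quadb rmorph0 !mul0r !addr0 addrC.
  - rewrite mulrDr [a * (_ * a)]mulrA !a_phi [(_ + _) * a]mulrDl -[phi r * a * a]mulrA.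
    rewrite /quadb rmorph0 mul0r addr0 [phi (_ + _)]rmorphD [(_ + _) * a]mulrDl.
    by rewrite [LHS](AC (2*2) (4*(2*3)*1)).
rewrite !quadbMl quadbN !quadbD zz_quadb quadbMl Dr DDr d0r d1r.
by congr quadb; ring.
Qed.

Lemma zz_a : zz * a = a * zz.
Proof.
have Dg : D gg = gg * hh by rewrite /Dder euler_g.
have DX : D 'X = gg * 'X by rewrite /Dder eulerX.
have phi_g : horner_alg c g = phi gg by rewrite phi2_const.
have E1 : a * (phi gg * b) = phi gg * b * a - phi (gg * (hh - 'X)) * a.
  rewrite mulrA a_phi Dg -[phi gg * b * a]mulrA (rel_ba rel) -(phi2_const rel) -[('X * _)%:P]/hh.
  rewrite ![phi (gg * _)](rmorphM phi) [phi (hh - 'X)](rmorphB phi) phi2_u.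
  by move: (phi hh - u) => v; rewrite [phi gg * (_ + _)]mulrDr !mulrA addrK -mulrDr.
have E2 : a * (phi (gg - 'X) * a) = phi (gg - 'X) * a * a + phi (gg * (hh - 'X)) * a.
  by rewrite mulrA a_phi mulrDl; congr (_ + phi _ * _); rewrite raddfB /= Dg DX mulrBr.
have -> : zz = phi gg * b + phi (gg - 'X) * a - a ^+ 2 by rewrite /zz rmorphB phi2_u phi_g.
rewrite mulrBl mulrBr -exprS -exprSr; congr (_ - _).
by rewrite mulrDl mulrDr E1 E2 [RHS](AC (2*2) ((1*3)*(4*2))) /= subrr addr0.
Qed.

Hypothesis dom : is_domain A.
Hypothesis g_neq0 : g != 0.

(** Commutation with [b] follows from the others: [z] commutes with itself and with every term of
    [g b = z - (g - u) a + a ^+ 2] on the right, hence with [g b], and [g] can be cancelled. *)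
Lemma zz_central : is_central zz.
Proof.
have zc : zz * c = c * zz.
  by rewrite -(phi2_c rel); apply: zz_homog; rewrite ?euler_c ?d0_c ?d1_c.
have zu : zz * u = u * zz.
  by rewrite -(phi2_u rel); apply: zz_homog; rewrite ?eulerX ?d0_u ?d1_u.
have zphi r : zz * phi r = phi r * zz.
  move: zz zc zu => z zc zu.
  elim/poly2_ind: r => [p q Vp Vq|p q Vp Vq|t||]; rewrite ?phi2_c ?phi2_u //.
  - by rewrite rmorphD mulrDl mulrDr Vp Vq.
  - by rewrite rmorphM mulrA Vp -!mulrA Vq.
  - by rewrite phi2_scalar scalar_comm.
have zb : zz * b = b * zz.
  apply/eqP; rewrite -subr_eq0; apply/eqP.
  have gb : phi gg * b = zz - phi (gg - 'X) * a + a ^+ 2.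
    by rewrite /zz rmorphB phi2_u phi2_const [_ - a ^+ 2]addrAC addrK subrK.
  have [| |//] := dom (x := phi gg) (y := zz * b - b * zz); last first.
    by move=> /(phi2_inj ore) /eqP; rewrite polyC_eq0 (negPf g_neq0).
  move: zz zphi zz_a gb => z zphi za gb.
  have -> : phi gg * (z * b - b * z) = z * (phi gg * b) - phi gg * b * z.
    by rewrite mulrBr !mulrA zphi.
  have zq : z * (phi (gg - 'X) * a) = phi (gg - 'X) * a * z by rewrite mulrA zphi -!mulrA za.
  have zaa : z * a ^+ 2 = a ^+ 2 * z by rewrite expr2 mulrA za -mulrA za mulrA.
  by rewrite gb mulrDr mulrBr !mulrDl mulNr zq zaa subrr.
move: zz zc zu zb zz_a => z zc zu zb za; elim/(presented_ind ore) => // [x y Hx Hy|x y Hx Hy|t].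
- by rewrite mulrDl mulrDr Hx Hy.
- by rewrite mulrA Hx -!mulrA Hy.
- by rewrite scalar_comm.
Qed.

Hypothesis k_char0 : [pchar k] =i pred0.

Lemma poly2_mulrn_eq0 (r : R2) n : r *+ n.+1 = 0 -> r = 0.
Proof.
rewrite -mulr_natr => /eqP; rewrite mulf_eq0 -!polyC_natr !polyC_eq0 ((pcharf0P k).1 k_char0).
by rewrite orbF => /eqP.
Qed.

Lemma euler_eq0 (r : R2) : euler r = 0 -> exists t : k, r = t%:P%:P.
Proof.
move=> Er; exists r`_0`_0; apply/polyP => j; apply/polyP => i.
have := coef_euler r i j.
rewrite Er !coef0 => /esym/eqP; rewrite -mulr_natr mulf_eq0 ((pcharf0P k).1 k_char0).
rewrite addn_eq0 !coefC; case: j => [|j]; case: i => [|i]; rewrite ?coefC ?coef0 ?andbF ?orbF //=;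
  by move/eqP.
Qed.

Lemma central_kap w m n l : is_central w -> W m.+1 w -> (n + l.*2).+1 = m ->
  kap n.+1 l w * (C * gg) *+ n.+1 + (if n is n'.+1 then kap n' l.+1 w * C *+ l.+1.*2 else 0) = 0.
Proof. by move=> cw ww /(kap_c ww) <-; rewrite cw subrr kap0. Qed.

Lemma C_neq0 : C != 0. Proof. by rewrite polyC_eq0 polyX_eq0. Qed.
Lemma Cg_neq0 : C * gg != 0. Proof. by rewrite mulf_eq0 negb_or C_neq0 polyC_eq0. Qed.

(** By the recurrence from [n.+1] to [n.-1], the leading coefficients vanish with that of [a ^+
    m]. *)
Lemma central_W w m : is_central w -> W m.+1 w -> kap m 0 w = 0 -> W m w.
Proof.
move=> cw ww k0.
have kl l : forall n, (n + l.*2 = m)%N -> kap n l w = 0.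
  elim: l => [n|l IHl n nm]; first by rewrite addn0 => ->.
  have := central_kap (n := n.+1) (l := l) cw ww; rewrite IHl; last by lia.
  rewrite mul0r mul0rn add0r doubleS => /(_ ltac:(lia)) /poly2_mulrn_eq0 /eqP.
  by rewrite mulf_eq0 (negPf C_neq0) orbF => /eqP.
split=> n l; rewrite leq_eqVlt => /orP[/eqP /esym|]; first exact: kl.
by case: ww => ww; apply: ww.
Qed.

(** For odd weight the recurrence starts from the monomial [a * b ^+ l], which has a vanishing
    coefficient, and runs upwards to [a ^+ m]. *)
Lemma central_kap_odd w l : is_central w -> W l.*2.+2 w -> kap l.*2.+1 0 w = 0.
Proof.
move=> cw ww; suff H j : (j <= l)%N -> kap j.*2.+1 (l - j) w = 0.
  by have := H l (leqnn l); rewrite subnn.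
elim: j => [|j IHj] jl.
  have := central_kap (n := 0) (l := l) cw ww erefl; rewrite addr0 mulr1n subn0 => /eqP.
  by rewrite mulf_eq0 (negPf Cg_neq0) orbF => /eqP.
have := central_kap (n := j.*2.+2) (l := l - j.+1) cw ww.
have -> : ((l - j.+1).+1 = l - j)%N by lia.
rewrite IHj; last exact: ltnW.
rewrite mul0r mul0rn addr0 => /(_ ltac:(lia)) /poly2_mulrn_eq0 /eqP.
by rewrite mulf_eq0 (negPf Cg_neq0) orbF => /eqP.
Qed.

(** In characteristic zero the Euler derivation kills the constants only. *)
Lemma central_kap_even w m : is_central w -> W m.+1 w -> exists t : k, kap m 0 w = t%:P%:P.
Proof.
move=> cw /kap_a; rewrite cw subrr kap0 => /esym/eqP; rewrite mulf_eq0 polyC_eq0 (negPf g_neq0).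
by move/eqP/euler_eq0.
Qed.

Lemma centralM (x y : A) : is_central x -> is_central y -> is_central (x * y).
Proof. by move=> cx cy v; rewrite -mulrA cy mulrA cx mulrA. Qed.
Lemma centralD (x y : A) : is_central x -> is_central y -> is_central (x + y).
Proof. by move=> cx cy v; rewrite mulrDl mulrDr cx cy. Qed.

Lemma horner_zz_central p : is_central (horner_alg zz p).
Proof.
elim/poly_ind: p => [|p t IHp]; first by move=> y; rewrite rmorph0 mul0r mulr0.
rewrite horner_alg_MXaddC; apply: centralD; first exact: (centralM IHp zz_central).
by move=> y; rewrite scalar_comm.
Qed.

(** Induction on the weight, subtracting a multiple of a power of [z]. *)
Lemma central_horner_zz w : is_central w -> exists p, w = horner_alg zz p.
Proof.
have [m] := W_ex w; elim: m w => [|m IHm] w ww cw.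
  by exists 0; rewrite rmorph0 (W_lt0 ww).
have [modd|meven] := boolP (odd m).
  apply: IHm => //; apply: central_W => //; move: ww; rewrite -(odd_double_half m) modd.
  by apply: central_kap_odd.
have mE : m = m./2.*2 by rewrite -[LHS]odd_double_half (negPf meven).
have [t kt] := central_kap_even cw ww.
pose q := (t * (-1) ^+ m./2)%:P * 'X^(m./2).
have hq : horner_alg zz q = phi (t * (-1) ^+ m./2)%:P%:P * zz ^+ m./2.
  by rewrite /q (rmorphM (horner_alg zz)) (rmorphXn (horner_alg zz)) /=
    horner_algX horner_algC phi2_scalar.
have cw' : is_central (w - horner_alg zz q).
  by move=> y; rewrite mulrBl mulrBr cw horner_zz_central.
have ww' : W m.+1 (w - horner_alg zz q).
  by apply: WB => //; rewrite hq; apply: WMl; rewrite {1}mE; apply: W_zexp.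
have [|p wp] := IHm _ (central_W cw' ww' _) cw'; last first.
  by exists (p + q); rewrite (rmorphD (horner_alg zz));
     apply: etrans (esym (subrK _ _)) (congr1 (+%R^~ _) wp).
have kz : kap m 0 (zz ^+ m./2) = (-1) ^+ m./2 by rewrite {1}mE kap_zexp.
rewrite kapB hq kapMl kt kz; apply/eqP; rewrite subr_eq0; apply/eqP.
have -> : (-1) ^+ m./2 = ((-1) ^+ m./2)%:P%:P :> R2 by rewrite !rmorphXn !rmorphN !rmorph1.
by rewrite -!polyCM -mulrA -expr2 sqrr_sign mulr1.
Qed.

(** The leading term of a polynomial in [z] shows its leading coefficient, whence injectivity. *)
Lemma kap_horner_zz (p : {poly k}) n : (size p <= n.+1)%N ->
  W n.*2.+1 (horner_alg zz p) /\ kap n.*2 0 (horner_alg zz p) = (p`_n * (-1) ^+ n)%:P%:P.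
Proof.
elim/poly_ind: p n => [|p t IHp] n.
  by rewrite rmorph0 kap0 coef0 mul0r !polyC0; split=> //; apply: W0.
rewrite size_MXaddC coefD coefMX coefC horner_alg_MXaddC.
have tE : t%:A = mono t%:P%:P 0 0 by rewrite -phi_mono phi2_scalar.
case: n => [|n] sp /=.
  have -> : p = 0.
    by move: sp; case: eqP => //= _; rewrite ltnS leqn0 size_poly_eq0 => /eqP.
  rewrite rmorph0 mul0r !add0r mulr1 tE kap_mono; split=> //.
  exact: Wmono.
have {}sp : (size p <= n.+1)%N.
  by move: sp; case: eqP => [->|_] //=; rewrite size_poly0.
have [wp kp] := IHp n sp; rewrite addr0 -zz_central tE; split.
  by apply: WD; [apply: WzM|apply: Wmono].
rewrite kapD kap_mono kap_z // kp addr0 exprS mulN1r mulrN !rmorphN //.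
Qed.

Lemma horner_zz_inj : injective (horner_alg zz).
Proof.
apply: raddf_inj => p hp; apply/eqP; rewrite -lead_coef_eq0 lead_coefE.
have [_] := kap_horner_zz (leqSpred (size p)).
rewrite hp kap0 => /esym/eqP; rewrite !polyC_eq0 mulf_eq0 signr_eq0 orbF //.
Qed.

End Weights.

Theorem Gf_center (k : fieldType) (g : {poly k}) :
    [pchar k] =i pred0 -> g != 0 ->
  (forall x : Gf g, is_central x <-> exists p : {poly k}, x = horner_alg (Gf_z g) p) /\
  injective (horner_alg (Gf_z g)).
Proof.
move=> k0 g0; split; last exact: (horner_zz_inj (Gf_ore g) (@Gf_domain k g) g0).
move=> x; split; first exact: (central_horner_zz (Gf_ore g) (@Gf_domain k g) g0 k0).
move=> [p ->]; exact: (horner_zz_central (Gf_ore g) (@Gf_domain k g) g0).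
Qed.

(** * Growth *)

Section LimitSuperior.
Variable R : realType.

Lemma limn_esup_le (v : nat -> R) (l : R) :
  (forall e, 0 < e -> exists N, forall n, (N <= n)%N -> v n <= l + e) ->
  (limn_esup (EFin \o v) <= l%:E)%E.
Proof.
move=> H; apply/lee_addgt0Pr => e e0; have [N HN] := H e e0.
apply: (@le_trans _ _ (ereal_sup ((EFin \o v) @` [set n | (N <= n)%N]))).
  by apply: ereal_inf_lbound; exists [set n | (N <= n)%N] => //; exists N.
by apply: ge_ereal_sup => _ [n Nn <-]; rewrite /= lee_fin; apply: HN.
Qed.

Lemma limn_esup_ge (v : nat -> R) (l : R) :
  (forall e, 0 < e -> exists N, forall n, (N <= n)%N -> l - e <= v n) ->
  (l%:E <= limn_esup (EFin \o v))%E.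
Proof.
move=> H; apply: le_ereal_inf_tmp => _ [V [M _ MV] <-].
apply/lee_addgt0Pr => e e0; have [N HN] := H e e0.
apply: (@le_trans _ _ ((v (maxn M N))%:E + e%:E)%E).
  by rewrite -EFinD lee_fin -lerBlDr; apply: HN; apply: leq_maxr.
rewrite leeD2r //; apply: ereal_sup_ubound; exists (maxn M N) => //.
by apply: MV; apply: leq_maxl.
Qed.

Lemma ln_nat_large (x : R) : exists N, forall n, (N <= n)%N -> (1 < n)%N && (x <= ln n%:R).
Proof.
exists (Num.truncn (expR x)).+2 => n Nn; have n0 : (0 < n)%N by apply: leq_trans Nn.
rewrite (leq_trans _ Nn) //= -(expRK x) ler_ln ?posrE ?expR_gt0 ?ltr0n //.
apply: ltW; apply: (lt_le_trans (truncnS_gt _)).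
by rewrite ler_nat; apply: leq_trans Nn.
Qed.

(** The ratios of logarithms below differ from an integer by a constant over [ln n], which is
    eventually smaller than [e]. *)
Lemma ln_ratio_error (C e : R) : 0 < e -> exists N, forall n, (N <= n)%N ->
  [/\ (1 < n)%N, 0 < ln n%:R :> R & C <= e * ln n%:R].
Proof.
move=> e0; have [N HN] := ln_nat_large (C / e); exists N => n /HN /andP[n1 Cn].
by split=> //; [rewrite ln_gt0 // ltr1n|rewrite mulrC -ler_pdivrMr].
Qed.

Lemma limn_esup_ln_le (d : nat -> R) (C : nat) r : (0 < C)%N ->
    (forall n, (0 < n)%N -> d n <= ((C * n) ^ r)%N%:R) ->
  (limn_esup (fun n => (ln (d n) / ln n%:R)%:E) <= (r%:R)%:E)%E.
Proof.
move=> C0 H; apply: limn_esup_le => e e0.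
have [N HN] := ln_ratio_error (ln C%:R *+ r) e0; exists N => n /HN [n1 lnn HC].
have n0 : (0 < n)%N by apply: ltnW.
rewrite ler_pdivrMr // mulrDl; apply: (@le_trans _ _ (ln ((C * n) ^ r)%N%:R)).
  have [d0|d0] := ltP 0 (d n).
    by rewrite ler_ln ?H // posrE ltr0n expn_gt0 muln_gt0 C0 n0.
  by rewrite (ln0 d0) ln_ge0 // ler1n expn_gt0 muln_gt0 C0 n0.
rewrite natrX lnXn ?ltr0n ?muln_gt0 ?C0 // natrM lnM ?posrE ?ltr0n // mulrnDl.
by rewrite addrC; apply: lerD => //; rewrite mulr_natl.
Qed.

Lemma limn_esup_ln_ge (d : nat -> R) (C : nat) r : (0 < C)%N ->
    (forall n, (0 < n)%N -> (n ^ r)%N%:R <= (C ^ r)%N%:R * d n) ->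
  ((r%:R)%:E <= limn_esup (fun n => (ln (d n) / ln n%:R)%:E))%E.
Proof.
move=> C0 H; apply: limn_esup_ge => e e0.
have [N HN] := ln_ratio_error (ln C%:R *+ r) e0; exists N => n /HN [n1 lnn HC].
have n0 : (0 < n)%N by apply: ltnW.
have C0' : 0 < (C ^ r)%N%:R :> R by rewrite ltr0n expn_gt0 C0.
have d0 : 0 < d n.
  rewrite -(pmulr_rgt0 _ C0'); apply: lt_le_trans (H n n0).
  by rewrite ltr0n expn_gt0 n0.
rewrite ler_pdivlMr // mulrBl lerBlDr.
have : ln (n ^ r)%N%:R <= ln ((C ^ r)%N%:R * d n).
  by rewrite ler_ln ?posrE ?H ?mulr_gt0 // ltr0n expn_gt0 n0.
rewrite lnM ?posrE // !natrX !lnXn ?ltr0n // mulr_natl => /le_trans.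
by apply; rewrite addrC lerD2l.
Qed.

End LimitSuperior.

Section Dimension.
Variables (k : fieldType) (R : realType) (V : lmodType k).

(** A family of linear forms that separates the points of [X] bounds its dimension: otherwise the
    matrix of values on an independent family would have more rows than columns, and a relation
    between its rows would be one between the vectors. *)
Lemma ldim_le (T : finType) (X : set V) (f : T -> V -> k) :
    (forall i x y, f i (x + y) = f i x + f i y) -> (forall i t x, f i (t *: x) = t * f i x) ->
    X 0 -> (forall x y, X x -> X y -> X (x + y)) -> (forall t x, X x -> X (t *: x)) ->
    (forall x, X x -> (forall i, f i x = 0) -> x = 0) ->
  (ldim R X <= (#|T|%:R)%:E)%E.
Proof.
move=> fD fZ X0 XD XZ finj; apply: ge_ereal_sup => _ [n [v [Xv vfree]] <-].
rewrite lee_fin ler_nat.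
have f0 i : f i 0 = 0 by rewrite -(scale0r 0) fZ mul0r.
pose B := \matrix_(i < n, j < #|T|) f (enum_val j) (v i).
suff /eqP <- : row_free B by exact: rank_leq_col.
apply: inj_row_free => r rB; apply/rowP => i; rewrite mxE.
apply: (vfree (fun i => r 0 i)); apply: finj.
  by elim/big_ind: _ => // j _; apply: XZ.
move=> j; transitivity ((r *m B) 0 (enum_rank j)); last by rewrite rB mxE.
rewrite mxE (big_morph (f j) (fD j) (f0 j)); apply: eq_bigr => l _.
by rewrite fZ mxE enum_rankK.
Qed.

Lemma ldim_ge (T : finType) (X : set V) (f : T -> V -> k) (v : T -> V) :
    (forall i x y, f i (x + y) = f i x + f i y) -> (forall i t x, f i (t *: x) = t * f i x) ->
    (forall i, X (v i)) -> (forall i j, f i (v j) = (i == j)%:R) ->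
  ((#|T|%:R)%:E <= ldim R X)%E.
Proof.
move=> fD fZ Xv fv; apply: ereal_sup_ubound; exists #|T| => //.
have f0 i : f i 0 = 0 by rewrite -(scale0r 0) fZ mul0r.
exists (fun j => v (enum_val j)); split=> [j|t vt i]; first exact: Xv.
have := congr1 (f (enum_val i)) vt; rewrite f0 (big_morph _ (fD _) (f0 _)).
rewrite (bigD1 i) //= fZ fv eqxx mulr1 big1 ?addr0 //.
by move=> j ji; rewrite fZ fv (inj_eq enum_val_inj) eq_sym (negPf ji) mulr0.
Qed.

End Dimension.

(** * The Gelfand-Kirillov dimension *)

Section WeightedDegree.
Variables (k : comNzRingType) (w : nat).
Local Notation R2 := {poly {poly k}}.

Definition wdeg_le (n : nat) (r : R2) : Prop :=
  forall i j, (n < i + w * j)%N -> r`_j`_i = 0.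

Lemma wdeg_leD n r s : wdeg_le n r -> wdeg_le n s -> wdeg_le n (r + s).
Proof. by move=> rn sn i j H; rewrite !coefD rn // sn // addr0. Qed.
Lemma wdeg_leB n r s : wdeg_le n r -> wdeg_le n s -> wdeg_le n (r - s).
Proof. by move=> rn sn i j H; rewrite !coefB rn // sn // subr0. Qed.

Lemma wdeg_leM n m r s : wdeg_le n r -> wdeg_le m s -> wdeg_le (n + m) (r * s).
Proof.
move=> rn sm i j H; rewrite coefM coef_sum big1 // => j1 _.
rewrite coefM big1 // => i1 _.
have [/rn -> |H1] := ltnP n (i1 + w * j1); first by rewrite mul0r.
rewrite (sm (i - i1)%N) ?mulr0 //.
have := ltn_ord i1; have := ltn_ord j1; nia.
Qed.

Lemma wdeg_le_euler n r : wdeg_le n r -> wdeg_le n (euler r).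
Proof. by move=> rn i j H; rewrite coef_euler rn // mul0rn. Qed.

Lemma wdeg_leC n (p : {poly k}) : (size p <= n.+1)%N -> wdeg_le n p%:P.
Proof.
move=> pn i j; rewrite coefC; case: eqP => [->|_] H; last by rewrite coef0.
by apply: nth_default; apply: leq_trans pn _; rewrite muln0 addn0 in H.
Qed.

Lemma wdeg_leX : wdeg_le w 'X.
Proof.
move=> i j; rewrite coefX; case: eqP => [->|_] H; last by rewrite coef0.
by rewrite coefC; case: i H => //; rewrite muln1 ltnn.
Qed.

End WeightedDegree.

(** The weight of [a], [b] and [u] is chosen larger than the degree of [g], so that every
    correction term in the relations has at most the weight of the term that is being reordered.
    *)
Section Filtration.
Variables (k : fieldType) (g : {poly k}) (A : algType k) (a b c u : A).
Hypothesis rel : Gf_relations g a b c u.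
Hypothesis ore : ore_ext (psiP rel) b (sigma g) (@delta k g).

Local Notation R2 := {poly {poly k}}.
Local Notation phi := (phi2 rel).
Local Notation kap := (kap ore).
Local Notation mono := (mono rel).
Local Notation w := (size g).+1.
Local Notation hh := (h2 g).

Lemma kapZ n l t x : kap n l (t *: x) = t%:P%:P * kap n l x.
Proof. by rewrite -mulr_algl -(phi2_scalar rel) kapMl. Qed.

Lemma wdeg_g : wdeg_le w w g%:P.
Proof. by apply: wdeg_leC; rewrite -addn2 leq_addr. Qed.
Lemma wdeg_h : wdeg_le w w hh.
Proof.
apply: wdeg_leC; apply: leq_trans (size_polyMleq _ _) _.
rewrite size_polyX /= ltnS; have [->|g0] := eqVneq g 0; first by rewrite derivC size_poly0.
by apply: ltnW; apply: ltnW; rewrite ltnS lt_size_deriv.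
Qed.
Lemma wdeg_D n (r : R2) : wdeg_le w n r -> wdeg_le w (w + n) (Dder g r).
Proof. by move=> rn; apply: wdeg_leM; [apply: wdeg_g|apply: wdeg_le_euler]. Qed.
Lemma wdeg_d0 n (r : R2) : wdeg_le w n r -> wdeg_le w (w + n) (d0 g r).
Proof.
move=> rn; apply: wdeg_leD; last first.
  by apply: wdeg_leM; [apply: wdeg_g|apply: wdeg_leB; do ?apply: wdeg_le_euler].
rewrite addnC; apply: wdeg_leM; first exact: wdeg_le_euler.
by apply: wdeg_leD; [apply: wdeg_h|apply: wdeg_leX].
Qed.
Lemma wdeg_d1 n (r : R2) : wdeg_le w n r -> wdeg_le w n (d1 r).
Proof. by move=> rn; apply: wdeg_leD; apply: wdeg_le_euler. Qed.

(** Spanned by the monomials [c ^+ i * u ^+ j * a ^+ p * b ^+ q] of weight at most [n]. *)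
Record Gf_le (n : nat) (x : A) : Prop := GfLe {
  Gf_le_kap : forall i j p q, (n < i + w * (j + p + q))%N -> (kap p q x)`_j`_i = 0 }.
Local Notation O := Gf_le.

Lemma O0 n : O n 0.
Proof. by split=> i j p q _; rewrite kap0 !coef0. Qed.
Lemma OD n x y : O n x -> O n y -> O n (x + y).
Proof. by move=> [xn] [yn]; split=> i j p q H; rewrite kapD !coefD xn // yn // addr0. Qed.
Lemma OZ n t x : O n x -> O n (t *: x).
Proof. by move=> [xn]; split=> i j p q H; rewrite kapZ !coefCM xn // mulr0. Qed.
Lemma OW n n' x : (n <= n')%N -> O n x -> O n' x.
Proof. by move=> nn [xn]; split=> i j p q H; apply: xn; apply: leq_ltn_trans H. Qed.

Lemma O_mono n s r p q : wdeg_le w s r -> (s + w * (p + q) <= n)%N -> O n (mono r p q).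
Proof.
move=> rs H; split=> i j p' q' H'; rewrite kap_mono.
case: eqP => [Ep|_]; case: eqP => [Eq|_]; rewrite ?coef0 //=.
by apply: rs; move: H H'; rewrite Ep Eq; move: w => v; nia.
Qed.

Lemma O_ind n (V : A -> Prop) :
  V 0 -> (forall x y, V x -> V y -> V (x + y)) ->
  (forall s r p q, wdeg_le w s r -> (s + w * (p + q) <= n)%N -> V (mono r p q)) ->
  forall x, O n x -> V x.
Proof.
move=> V0 VD Vm x; have [P ->] := ore_span ore x => -[H].
rewrite (oev_sum _ _ (leqnn _)); elim/big_ind: _ => // q _.
have -> : psiP rel P`_q * b ^+ q =
    \sum_(p < size (P`_q : {poly R2})) mono ((P`_q : {poly R2})`_p) p q.
  rewrite -[psiP rel _]/(oev phi a (P`_q : {poly R2})) (oev_sum _ _ (leqnn _)).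
  by rewrite mulr_suml.
elim/big_ind: _ => // p _; rewrite -(kapE ore); move: (kap p q _) (fun i j => H i j p q) => r Hr.
have [pqn|npq] := leqP (w * (p + q)) n.
  apply: (Vm (n - w * (p + q))%N); last by rewrite subnK.
  by move=> i j Hij; apply: Hr; move: pqn Hij; move: w => v; nia.
suff -> : r = 0 by rewrite mono0.
apply/polyP => j; apply/polyP => i; rewrite !coef0; apply: Hr.
by move: npq; move: w => v; nia.
Qed.

Lemma Ophi n s r x : wdeg_le w s r -> O n x -> O (s + n) (phi r * x).
Proof.
move=> rs xn; apply: (O_ind (V := fun x => O (s + n) (phi r * x)) _ _ _ xn).
- by rewrite mulr0; apply: O0.
- by move=> x1 x2 H1 H2; rewrite mulrDr; apply: OD.
- move=> s' r' p q rs' H; rewrite monoMl; apply: O_mono (wdeg_leM rs rs') _.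
  by rewrite -addnA leq_add2l.
Qed.

Lemma Oa n x : O n x -> O (w + n) (a * x).
Proof.
move=> xn; apply: (O_ind (V := fun x => O (w + n) (a * x)) _ _ _ xn).
- by rewrite mulr0; apply: O0.
- by move=> x1 x2 H1 H2; rewrite mulrDr; apply: OD.
- move=> s r p q rs H; rewrite a_mono; apply: OD.
    by apply: O_mono rs _; move: H; move: w => v; nia.
  by apply: O_mono (wdeg_D rs) _; move: H; move: w => v; nia.
Qed.

Lemma Obr n x l : O n x -> O (n + w * l) (x * b ^+ l).
Proof.
move=> xn; apply: (O_ind (V := fun x => O (n + w * l) (x * b ^+ l)) _ _ _ xn).
- by rewrite mul0r; apply: O0.
- by move=> x1 x2 H1 H2; rewrite mulrDl; apply: OD.
- move=> s r p q rs H; rewrite mono_b; apply: O_mono rs _.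
  by move: H; move: w => v; nia.
Qed.

Lemma wdeg1 : wdeg_le w 0 (1 : R2).
Proof. by apply: wdeg_leC; rewrite size_poly1. Qed.

Lemma Oban p : O (w * p.+1) (b * a ^+ p).
Proof.
elim: p => [|p IHp].
  have -> : b * a ^+ 0 = mono 1 0 1 by rewrite /mono rmorph1 !expr0 !mul1r mulr1.
  by apply: O_mono wdeg1 _.
have -> : b * a ^+ p.+1 = a * (b * a ^+ p) + phi hh * (b * a ^+ p) + mono (hh - 'X) p.+1 0.
  rewrite exprS mulrA (rel_ba rel) mulrDl [(a + _) * b]mulrDl mulrDl -!mulrA.
  by rewrite /mono rmorphB phi2_u phi2_const expr0 mulr1 exprS.
rewrite [(w * _)%N]mulnS; apply: OD; last first.
  apply: (@O_mono _ w); first by apply: wdeg_leB; [apply: wdeg_h|apply: wdeg_leX].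
  by rewrite leq_add2l addn0.
by apply: OD; [apply: Oa|apply: Ophi => //; apply: wdeg_h].
Qed.

Lemma Ob n x : O n x -> O (w + n) (b * x).
Proof.
move=> xn; apply: (O_ind (V := fun x => O (w + n) (b * x)) _ _ _ xn).
- by rewrite mulr0; apply: O0.
- by move=> x1 x2 H1 H2; rewrite mulrDr; apply: OD.
- move=> s r p q rs H.
  have -> : b * mono r p q =
      phi r * ((b * a ^+ p) * b ^+ q) + mono (d0 g r) p q + mono (d1 r) p.+1 q.
    by rewrite /mono !mulrA b_phi !mulrDl exprS !mulrA.
  apply: OD; last by apply: O_mono (wdeg_d1 rs) _; move: H; move: w => v; nia.
  apply: OD; last by apply: O_mono (wdeg_d0 rs) _; move: H; move: w => v; nia.
  apply: OW (Ophi rs (Obr q (Oban p))).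
  by move: H; move: w => v; nia.
Qed.

(** Left multiplication by any element raises the weight by a bounded amount, since this holds for
    the generators. *)
Lemma O_mul (y : A) : exists e, forall n x, O n x -> O (e + n) (y * x).
Proof.
elim/(presented_ind ore): y => [y z [e He] [f Hf]|y z [e He] [f Hf]|t||||].
- exists (e + f)%N => n x xn; rewrite mulrDl; apply: OD.
    by apply: OW (He n x xn); lia.
  by apply: OW (Hf n x xn); lia.
- by exists (e + f)%N => n x xn; rewrite -mulrA -addnA; apply/He/Hf.
- by exists 0%N => n x xn; rewrite mulr_algl; apply: OZ.
- by exists w => n x; apply: Oa.
- by exists w => n x; apply: Ob.
- exists w => n x xn; rewrite -(phi2_c rel); apply: Ophi => //.
  by apply: wdeg_leC; rewrite size_polyX.
- by exists w => n x xn; rewrite -(phi2_u rel); apply: Ophi => //; apply: wdeg_leX.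
Qed.

(** A common bound for the elements of [s] makes a word of length [n] of weight at most [e * n].
    *)
Lemma O_growth (s : seq A) : exists e, (0 < e)%N /\
  forall n x, growth_space s n x -> O (e * n) x.
Proof.
have [e He] : exists e, forall y, y \in s -> forall n x, O n x -> O (e + n) (y * x).
  elim: s => [|y s [e He]]; first by exists 0%N.
  have [f Hf] := O_mul y; exists (e + f)%N => z; rewrite inE => /predU1P[->|zs] n x xn.
    by apply: OW (Hf n x xn); lia.
  by apply: OW (He z zs n x xn); lia.
exists e.+1; split=> // n x [N [t [v [Hv ->]]]].
elim/big_ind: _ => [||i _]; [exact: O0|by move=> *; apply: OD|apply: OZ].
have [l [ln ls ->]] := Hv i; apply: (@OW (e * size l)); first by apply: leq_mul.
elim: (l) ls => [|y l' IHl] ls.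
  by rewrite big_nil -(mono1 rel); apply: O_mono wdeg1 _; rewrite muln0.
rewrite big_cons /= mulnS; apply: He; first by apply: ls; rewrite inE eqxx.
by apply: IHl => z zl; apply: ls; rewrite inE zl orbT.
Qed.

Local Notation box N := ('I_N.+1 * 'I_N.+1 * 'I_N.+1 * 'I_N.+1)%type.
Lemma card_box N : #|{: box N}| = (N.+1 ^ 4)%N.
Proof. by rewrite !card_prod !card_ord; lia. Qed.

Definition box_coef N (t : box N) (x : A) : k :=
  (kap t.1.2 t.2 x)`_(t.1.1.2)`_(t.1.1.1).
Definition box_mono N (t : box N) : A :=
  mono (('X^(t.1.1.1))%:P * 'X^(t.1.1.2)) t.1.2 t.2.

Lemma box_coefD N (t : box N) x y : box_coef t (x + y) = box_coef t x + box_coef t y.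
Proof. by rewrite /box_coef kapD !coefD. Qed.
Lemma box_coefZ N (t : box N) r x : box_coef t (r *: x) = r * box_coef t x.
Proof. by rewrite /box_coef kapZ !coefCM. Qed.

(** All exponents of a monomial of weight at most [N] are at most [N]. *)
Lemma box_coef_inj N x : O N x -> (forall t : box N, box_coef t x = 0) -> x = 0.
Proof.
move=> [xn] x0; apply: (W_lt0 (ore := ore)); split=> p q _.
apply/polyP => j; apply/polyP => i; rewrite !coef0.
have [|] := ltnP N (i + w * (j + p + q)); first exact: xn.
have := leq_pmull (j + p + q) (ltn0Sn (size g)); set v := muln _ _ => vE H.
have [Hi Hj Hp Hq] : [/\ i < N.+1, j < N.+1, p < N.+1 & q < N.+1]%N.
  by move: vE H; clearbody v => vE H; split; lia.
exact: (x0 (Ordinal Hi, Ordinal Hj, Ordinal Hp, Ordinal Hq)).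
Qed.

Lemma box_coef_mono N (s t : box N) : box_coef s (box_mono t) = (s == t)%:R.
Proof.
case: s => [[[i j] p] q]; case: t => [[[i' j'] p'] q'].
rewrite /box_coef /box_mono /= kap_mono !xpair_eqE.
rewrite -!(inj_eq val_inj) /=.
case: (p == p' :> nat); case: (q == q' :> nat); rewrite ?andbF /= ?coef0 //.
rewrite !andbT coefCM coefXn; case: (j == j' :> nat); rewrite ?andbF /= ?mulr0 ?coef0 //.
by rewrite mulr1 coefXn andbT.
Qed.

(** The monomial is a word in the generators, with at most [N] letters of each kind. *)
Lemma box_mono_growth N n (t : box N) : (4 * N <= n)%N ->
  growth_space [:: a; b; c; u] n (box_mono t).
Proof.
case: t => [[[i j] p] q] Nn; exists 1%N, (fun=> 1), (fun=> box_mono (i, j, p, q)).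
split; last first.
  by rewrite big_ord1 scale1r.
move=> _; exists (nseq i c ++ nseq j u ++ nseq p a ++ nseq q b); split.
- rewrite !size_cat !size_nseq; have := ltn_ord i; have := ltn_ord j.
  by have := ltn_ord p; have := ltn_ord q; lia.
- move=> y; rewrite !mem_cat !mem_nseq !inE.
  by case/or4P => /andP[_ /eqP ->]; rewrite eqxx ?orbT.
- rewrite /box_mono /mono !big_cat /= !big_nseq -!Monoid.iteropE !mulrA.
  rewrite (rmorphM phi) (rmorphXn phi) /= phi2_u phi2_const.
  by rewrite (rmorphXn (horner_alg c)) /= horner_algX.
Qed.

Lemma growth_dim_le (R : realType) (s : seq A) : exists e, (0 < e)%N /\ forall n, (0 < n)%N ->
  (ldim R (growth_space s n) <= (((e * n) ^ 4)%N%:R)%:E)%E.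
Proof.
have [e [e0 He]] := O_growth s; exists e.+1; split=> // n n0.
apply: (@le_trans _ _ (ldim R [set x | O (e * n) x])).
  apply: ereal_sup_le => _ [N [v [Hv vfree]] <-]; exists N => //; exists v.
  by split=> // i; apply: He.
apply: (@le_trans _ _ (#|{: box (e * n)}|%:R)%:E).
  apply: (@ldim_le _ _ _ _ _ (@box_coef _)).
  - exact: box_coefD.
  - exact: box_coefZ.
  - exact: O0.
  - by move=> x y; apply: OD.
  - by move=> t x; apply: OZ.
  - exact: box_coef_inj.
rewrite lee_fin ler_nat card_box leq_exp2r // mulSn; lia.
Qed.

Lemma growth_dim_ge (R : realType) n :
  ((((n %/ 4).+1 ^ 4)%N%:R)%:E <= ldim R (growth_space [:: a; b; c; u] n))%E.
Proof.
rewrite -card_box; apply: (@ldim_ge _ _ _ _ _ (@box_coef _) (@box_mono _)).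
- exact: box_coefD.
- exact: box_coefZ.
- by move=> t; apply: box_mono_growth; rewrite mulnC leq_divM.
- exact: box_coef_mono.
Qed.

Theorem presented_GKdim (R : realType) : GKdim R A = (4%:R)%:E.
Proof.
apply/eqP; rewrite eq_le; apply/andP; split.
  apply: ge_ereal_sup => _ [s _ <-]; have [e [e0 He]] := growth_dim_le R s.
  by apply: (limn_esup_ln_le e0) => n /He; case: (ldim _ _) => //= *; apply: ler0n.
apply: (@le_trans _ _ (limn_esup (fun n : nat =>
    (ln (fine (ldim R (growth_space [:: a; b; c; u] n))) / ln n%:R)%:E))); last first.
  by apply: ereal_sup_ubound; exists [:: a; b; c; u].
(* The constant 4 comes from n <= 4 * (n %/ 4).+1. *)
apply: (@limn_esup_ln_ge _ _ 4) => // n n0.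
have [e [e0 /(_ n n0)]] := growth_dim_le R [:: a; b; c; u].
move: (growth_dim_ge R n); case: (ldim _ _) => //= d; rewrite lee_fin => Hd _.
apply: le_trans (ler_wpM2l (ler0n _ _) Hd).
rewrite -natrM ler_nat -expnMn leq_exp2r //.
by rewrite {1}(divn_eq n 4); have := ltn_pmod n (isT : 0 < 4)%N; lia.
Qed.

End Filtration.

Theorem proposition7p9 (R : realType) (k : closedFieldType)
    (k_char0 : [pchar k] =i pred0) (g : {poly k}) (deg_g : (1 < size g)%N) :
  [/\ noetherian (Gf g),
      is_domain (Gf g),
      left_gldim (Gf g) R = (4%:R)%:E /\ right_gldim (Gf g) R = (4%:R)%:E,
      GKdim R (Gf g) = (4%:R)%:E &
      (forall x : Gf g,
         is_central x <-> exists p : {poly k}, x = horner_alg (Gf_z g) p) /\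
      injective (horner_alg (Gf_z g))].
Proof.
split.
- exact: Gf_noetherian.
- exact: Gf_domain.
- exact: Gf_gldim.
- exact: (presented_GKdim (Gf_ore g)).
- by apply: Gf_center => //; rewrite -size_poly_gt0 ltnW.
Qed.
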